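(* Let $B\subset W$ be a good lattice, $n\in\mathbb{N}$ (so $n\ge 0$), and let $\psi$ be a primitive character of the ring $O_n=\mathcal{O}/\varpi^{n+1}\mathcal{O}$. (i) Assume $\varpi B^*\subsetneq B$. Let $S$ be a Weil representation of type $\psi$ of $Sp(\mathrm{b}_n)$, where $\mathrm b_n=B/\varpi^{n+1}B^*$. Then there is a unique Weil representation $\sigma$ of type $\psi$ of $Sp(\mathrm{b}_n)$ relative to the natural morphism from $Sp(\mathrm{b}_n)$ to $Sp(\overline{\mathrm u^\perp})$ (which is $Sp(\mathrm{b})$ if $n$ is even, $Sp(\mathrm{b}^* )$ if $n$ is odd) such that $S=S^{\mathrm{u},\sigma}$. In all cases the representations appearing in the decomposition (D) of $S^{\mathrm u,\sigma}$ described in the context are irreducible and pairwise inequivalent. When $B\subsetneq B^*$ there are $2n+2$ of them; when $B=B^*$ there are $n+2$ of them. They are monomial if $B=B^*$ and $n$ is odd. (ii) Assume $B\subsetneq B^*$. Let $S$ be a Weil representation of type $\psi$ of $Sp(\mathrm{b}^*_n)$, where $\mathrm b^*_n=B^*/\varpi^nB$. Then there is a unique Weil representation $\sigma$ of type $\psi$ of $Sp(\mathrm{b}^*_n)$ relative to the natural morphism from $Sp(\mathrm{b}^*_n)$ to $Sp(\overline{\mathrm u^{*\perp}})$ (which is $Sp(\mathrm{b}^* )$ if $n$ is even, $Sp(\mathrm{b})$ if $n$ is odd) such that $S=S^{\mathrm{u}^*,\sigma}$. In all cases the representations appearing in the decomposition (D) of $S^{\mathrm u^*,\sigma}$ are irreducible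 and pairwise inequivalent. When $\varpi B^*\subsetneq B$ there are $2n+2$ of them; when $\varpi B^*=B$ there are $n+2$ of them. They are monomial if $\varpi B^*=B$ and $n$ is odd.
   Context: **Lattices.** $k$ is a non-archimedean local field of characteristic $0$ with ring of integers $\mathcal{O}$, uniformizer $\varpi$, residue field $\mathbb{F}_q$ of characteristic $p\ne 2$. $\lambda_\psi$ is a fixed integer (the conductor of a fixed non-trivial additive character of $k$). $(W,\beta)$ is a symplectic $k$-vector space of dimension $2r$. A lattice is a compact open $\mathcal{O}$-submodule $B$ of $W$; its dual is $B^*=\{v\in W:\beta(v,b)\in\varpi^{\lambda_\psi}\mathcal{O}\ \forall b\in B\}$. $B$ is *good* if $\varpi B^*\subset B\subset B^*$. $\mathrm{b}_n=B/\varpi^{n+1}B^*$ and $\mathrm{b}^*_n=B^*/\varpi^nB$ are finite $O_n$-modules with non-degenerate alternating forms $\beta_{\mathrm{b}_n}(\bar v,\bar w)=\varpi^{-\lambda_\psi}\beta(v,w)\bmod\varpi^{n+1}$ ($v,w\in B$) and $\beta_{\mathrm{b}^*_n}(\bar v,\bar w)=\varpi^{1-\lambda_\psi}\beta(v,w)\bmod \varpi^{n+1}$ ($v,w\in B^*$). $Sp(\cdot)$ denotes the group of $O_n$-linear automorphisms preserving the form. Put $\mathrm{b}=\mathrm{b}_0$, $\mathrm{b}^*=\mathrm{b}^*_0$. **Weil representations over a finite local ring $F$** (here $F=O_n$). A character $\psi$ of $(F,+)$ is primitive if its kernel contains no ideal other than $\{0\}$. For a finite symplectic $F$-module $(V,\beta)$,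 $H(V)=V\times F$ with $(w,t)(w',t')=(w+w',t+t'+\frac12\beta(w,w'))$, and $\rho_\psi$ is its unique irreducible unitary representation with central character $\psi$ (Schrödinger representation). $Sp(V)$ acts on $H(V)$ by $g.(w,t)=(gw,t)$. If $\gamma:G\to Sp(V)$ is a morphism from a finite group, a *Weil representation of type $\psi$ of $G$ relative to $\gamma$* is a representation $S$ of $G$ on the space of $\rho_\psi$ with $S(g)\rho_\psi(h)S(g)^{-1}=\rho_\psi(\gamma(g).h)$; for $G=Sp(V)$, $\gamma=\mathrm{Id}$, one says Weil representation of $Sp(V)$. Equality and uniqueness of Weil representations are understood up to isomorphisms intertwining both the Heisenberg representations and the representations of $G$. **The representation $S^{U,\sigma}$.** Let $U\subset V$ be an $Sp(V)$-invariant isotropic submodule, $U^\perp$ its orthogonal, $\overline{U^\perp}=U^\perp/U$ with the induced symplectic form, $r_U:Sp(V)\to Sp(\overline{U^\perp})$ the natural morphism, $\sigma$ a Weil representation of type $\psi$ of $Sp(V)$ relative to $r_U$, on a space $\mathcal{H}_\sigma$ that also carries the Schrödinger representation of $H(\overline{U^\perp})$; let $\rho_{U^\perp,\psi}$ be its inflation to $H(U^\perp)=U^\perp\times F$. Let $\mathcal{H}^U$ be the space of functions $\varphi:V\to\mathcal{H}_\sigma$ with $\varphi(x+w)=\psi(\frac12\beta(x,w))\rho_{U^\perp,\psi}(w,0)\varphi(x)$ for $x\in V$, $w\in U^\perp$. $H(V)$ acts on $\mathcal{H}^U$ by $((v,t)\varphi)(x)=\psi(t+\frac12\beta(x,v))\varphi(x+v)$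 (a model of $\rho_\psi$) and $S^{U,\sigma}(g)\varphi(x)=\sigma(g)[\varphi(g^{-1}x)]$, which is a Weil representation of $Sp(V)$. **Decomposition (D).** For $x\in V\setminus U^\perp$ let $G(\hat x)$ be the stabilizer of $x+U^\perp$ in $Sp(V)$ and $\sigma_{\dot x}(g)=\sigma(g)\rho_{U^\perp,\psi}(g^{-1}x-x,\frac12\beta(x,g^{-1}x))$, a representation of $G(\hat x)$ on $\mathcal{H}_\sigma$. One has $-\mathrm{Id}\notin G(\hat x)$; let $\sigma^{\pm}_{\dot x}$ be its extension to $\{\pm \mathrm{Id}\}G(\hat x)$ with $\sigma_{\dot x}^\pm(-\mathrm{Id})=\pm\mathrm{Id}$, and $S^\pm_{\dot x}=\mathrm{Ind}_{\{\pm\mathrm{Id}\}G(\hat x)}^{Sp(V)}\sigma^\pm_{\dot x}$. Let $\sigma^\pm$ be the subrepresentation of $\sigma$ on the $\pm1$-eigenspace of $\sigma(-\mathrm{Id})$. If $X\subset V$ is a set of representatives of the $Sp(V)$-orbits in $(V/U^\perp)\setminus\{0\}$, then $$(D)\quad S^{U,\sigma}=\begin{cases}\sigma\oplus\bigoplus_{x\in X}(S^+_{\dot x}\oplus S^-_{\dot x})&\text{if }\overline{U^\perp}=\{0\},\\ (\sigma^+\oplus\sigma^-)\oplus\bigoplus_{x\in X}(S^+_{\dot x}\oplus S^-_{\dot x})&\text{if }\overline{U^\perp}\neq\{0\}.\end{cases}$$ The ''representations appearing in (D)'' are these listed summands. **The submodules $\mathrm u$, $\mathrm u^*$** (the maximal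 isotropic invariant submodules). For $V=\mathrm{b}_n$: if $n=2m$, $\mathrm{u}=\varpi^{m+1}B^*/\varpi^{n+1}B^*$, $\mathrm{u}^\perp=\varpi^mB/\varpi^{n+1}B^*$, $\overline{\mathrm{u}^\perp}\cong\mathrm{b}$; if $n=2m+1$, $\mathrm{u}=\varpi^{m+1}B/\varpi^{n+1}B^*$, $\mathrm{u}^\perp=\varpi^{m+1}B^*/\varpi^{n+1}B^*$, $\overline{\mathrm{u}^\perp}\cong\mathrm{b}^*$. For $V=\mathrm{b}^*_n$: if $n=2m$, $\mathrm{u}^*=\varpi^mB/\varpi^nB$, $\mathrm{u}^{*\perp}=\varpi^mB^*/\varpi^nB$, $\overline{\mathrm{u}^{*\perp}}\cong\mathrm{b}^*$; if $n=2m+1$, $\mathrm{u}^*=\varpi^{m+1}B^*/\varpi^nB$, $\mathrm{u}^{*\perp}=\varpi^mB/\varpi^nB$, $\overline{\mathrm{u}^{*\perp}}\cong\mathrm{b}$. The isomorphisms are division by the power of $\varpi$, and identify the symplectic groups. Monomial means induced from a one-dimensional character of a subgroup. *)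

(* Defs.v *)
From HB Require Import structures.
From mathcomp Require Import all_boot all_order all_algebra all_fingroup.
From mathcomp Require Import ring_quotient generic_quotient.
From mathcomp Require Import finmap boolp classical_sets functions cardinality.
From mathcomp Require Import topology ring.

Set Implicit Arguments.
Unset Strict Implicit.
Unset Printing Implicit Defensive.

Import Order.TTheory GRing.Theory Num.Theory.
Local Open Scope ring_scope.
Local Open Scope quotient_scope.

(* The value of lf_val at 0 is irrelevant; v(0) = +oo is built into ppow. *)
Record localField := LocalField {
  lf_field :> fieldType;
  lf_val : lf_field -> int;
  lf_valM : forall x y, x != 0 -> y != 0 ->
    lf_val (x * y) = lf_val x + lf_val y;
  lf_valD : forall x y, x != 0 -> y != 0 -> x + y != 0 ->
    Num.min (lf_val x) (lf_val y) <= lf_val (x + y);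
  lf_unif : lf_field;
  lf_unif_neq0 : lf_unif != 0;
  lf_val_unif : lf_val lf_unif = 1;
  lf_complete : forall u : nat -> lf_field,
    (forall N : int, exists M : nat, forall i j, (M <= i)%N -> (M <= j)%N ->
       (u i == u j) || (N <= lf_val (u i - u j))) ->
    exists l, forall N : int, exists M : nat, forall i, (M <= i)%N ->
       (u i == l) || (N <= lf_val (u i - l));
  lf_residue_finite : exists s : seq lf_field,
    forall x, (x == 0) || (0 <= lf_val x) ->
    exists2 y, y \in s & (x == y) || (1 <= lf_val (x - y));
  lf_char0 : [pchar lf_field] =i pred0
}.

(* ppow k i is the fractional ideal ϖ^i O. *)
Definition ppow (k : localField) (i : int) : {pred k} :=
  [pred x | (x == 0) || (i <= lf_val x)].
Arguments ppow : clear implicits.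

Section Valuation.
Variable k : localField.
Implicit Types (x y : k) (i j : int).

Lemma ppow0 i : 0 \in ppow k i. Proof. by rewrite inE eqxx. Qed.

Lemma ppowW i j x : j <= i -> x \in ppow k i -> x \in ppow k j.
Proof.
by move=> ji; rewrite !inE => /orP[->//|h]; rewrite (le_trans ji h) orbT.
Qed.

Lemma val1 : lf_val (1 : k) = 0.
Proof.
have := lf_valM (oner_neq0 k) (oner_neq0 k); rewrite mulr1 => /eqP.
by rewrite -subr_eq0 opprD addrA subrr add0r oppr_eq0 => /eqP.
Qed.

Lemma ppowM i j x y :
  x \in ppow k i -> y \in ppow k j -> x * y \in ppow k (i + j).
Proof.
rewrite !inE; have [->|x0] := eqVneq x 0; first by rewrite mul0r eqxx.
have [->|y0] := eqVneq y 0; first by rewrite mulr0 eqxx.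
by move=> /= hx hy; rewrite lf_valM// lerD ?orbT.
Qed.

Lemma ppowD i x y : x \in ppow k i -> y \in ppow k i -> x + y \in ppow k i.
Proof.
rewrite !inE; have [->|x0] := eqVneq x 0; first by rewrite add0r.
have [->|y0] := eqVneq y 0; first by rewrite addr0 (negPf x0).
move=> /= hx hy; have [//|xy0] := eqVneq (x + y) 0.
by rewrite (le_trans _ (lf_valD x0 y0 xy0))// le_min hx hy.
Qed.

Lemma ppow1 : 1 \in ppow k 0.
Proof. by rewrite inE val1 lexx orbT. Qed.

Lemma ppowN1 : -1 \in ppow k 0.
Proof.
have N10 : -1 != 0 :> k by rewrite oppr_eq0 oner_neq0.
have := lf_valM N10 N10; rewrite mulrNN mulr1 val1 => h.
by rewrite inE; apply/orP; right; rewrite -(pmulrn_lge0 _ (isT : 0 < 2)%N) mulr2n -h.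
Qed.

Lemma ppowN i x : x \in ppow k i -> - x \in ppow k i.
Proof. by move=> h; rewrite -mulN1r -[i]add0r ppowM// ppowN1. Qed.

Lemma ppowB i x y : x \in ppow k i -> y \in ppow k i -> x - y \in ppow k i.
Proof. by move=> hx hy; rewrite ppowD// ppowN. Qed.

Lemma val_unifX i : lf_val (lf_unif k ^ i) = i.
Proof.
have u0 := lf_unif_neq0 k.
have hn (n : nat) : lf_val (lf_unif k ^+ n) = n.
  elim: n => [|n IH]; first by rewrite expr0 val1.
  by rewrite exprS lf_valM ?expf_neq0// IH lf_val_unif.
case: i => n; first exact: hn.
change (lf_val (lf_unif k ^- n.+1) = Negz n).
rewrite NegzE; apply/eqP; rewrite -subr_eq0 opprK addrC.
have := lf_valM (expf_neq0 n.+1 u0) (invr_neq0 (expf_neq0 n.+1 u0)).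
by rewrite divff ?expf_neq0// val1 hn => <-; rewrite eqxx.
Qed.

Lemma unifX_neq0 i : lf_unif k ^ i != 0.
Proof. by rewrite expfz_neq0 ?lf_unif_neq0. Qed.

Lemma ppow_unif i : lf_unif k ^ i \in ppow k i.
Proof. by rewrite inE val_unifX lexx orbT. Qed.

Lemma ppow_shift i j x : (lf_unif k ^ i * x \in ppow k j) = (x \in ppow k (j - i)).
Proof.
apply/idP/idP => h; last by have := ppowM (ppow_unif i) h; rewrite subrKC.
have := ppowM (ppow_unif (- i)) h.
by rewrite mulrA -expfzDr ?lf_unif_neq0// addNr expr0z mul1r addrC.
Qed.

Lemma ppow_subring : subring_closed (ppow k 0).
Proof.
split; [exact: ppow1|by move=> x y; exact: ppowB|].
by move=> x y hx hy; have := ppowM hx hy; rewrite addr0.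
Qed.

Definition oring_pred : {pred k} := ppow k 0.
HB.instance Definition _ := GRing.isSubringClosed.Build k oring_pred ppow_subring.

(* O *)
Record oring := ORing { oval :> k; ovalP : oval \in oring_pred }.
HB.instance Definition _ := [isSub for oval].
HB.instance Definition _ := [Choice of oring by <:].
HB.instance Definition _ := [SubChoice_isSubComNzRing of oring by <:].

(* ϖ^(n+1) O as an ideal of O *)
Definition oideal (n : nat) : {pred oring} := [pred a | oval a \in ppow k n.+1].

Lemma oideal_closed n : idealr_closed (oideal n).
Proof.
split.
- by rewrite inE ppow0.
- by rewrite !inE /= oner_eq0 val1.
- move=> a u v hu hv; rewrite inE /=; apply: ppowD; last exact: hv.
  by rewrite -[X in ppow _ X]add0r; apply: ppowM => //; exact: ovalP.
Qed.
HB.instance Definition _ n := isIdealr.Build oring (oideal n) (oideal_closed n).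

(* O_n = O / ϖ^(n+1) O *)
Definition On (n : nat) : Type := {ideal_quot (oideal n : idealr oring)}.
HB.instance Definition _ n := GRing.ComNzRing.on (On n).

Lemma On_cover N : exists s : seq k, forall x, x \in oring_pred ->
  exists2 y, y \in s & x - y \in ppow k N%:Z.
Proof.
elim: N => [|N [s hs]].
  by exists [:: 0] => x hx; exists 0; rewrite ?mem_head// subr0.
have [t ht] := lf_residue_finite k.
exists [seq y + lf_unif k ^ N%:Z * z | y <- s, z <- t] => x hx.
have [y ys hy] := hs _ hx.
have : lf_unif k ^ (- N%:Z) * (x - y) \in ppow k 0.
  by rewrite ppow_shift sub0r opprK.
move=> /ht[z zt hz]; exists (y + lf_unif k ^ N%:Z * z).
  by apply/allpairsP; exists (y, z).
have -> : x - (y + lf_unif k ^ N%:Z * z)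
    = lf_unif k ^ N%:Z * (lf_unif k ^ (- N%:Z) * (x - y) - z).
  by rewrite mulrBr mulrA -expfzDr ?lf_unif_neq0// subrr expr0z mul1r opprD addrA.
by rewrite ppow_shift intS addrK inE subr_eq0.
Qed.

Lemma oring_predE x : (x \in oring_pred) = (x \in ppow k 0). Proof. by []. Qed.

Definition oring_of x : oring := insubd 0 x.
Lemma oring_ofK x : x \in oring_pred -> oval (oring_of x) = x.
Proof. by move=> h; rewrite /oring_of insubdK. Qed.

Definition redn n x : On n := \pi_(On n) (oring_of x).

End Valuation.

Section FiniteOfSeq.
Variables (T : choiceType) (s : seq T) (hs : forall x, x \in s).

Lemma index_onthK : pcancel (fun x => index x s) (onth s).
Proof.
by move=> x; rewrite onthE (nth_map x) ?index_mem ?hs// nth_index ?hs.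
Qed.

Lemma undup_enumP : Finite.axiom (undup s).
Proof. by move=> x; rewrite count_uniq_mem ?undup_uniq// mem_undup hs. Qed.
End FiniteOfSeq.

Section OnFinite.
Variables (k : localField) (n : nat).

Lemma On_finite : exists s : seq (On k n), forall a, a \in s.
Proof.
have [s hs] := On_cover k n.+1.
exists [seq redn n y | y <- s] => a.
have [y ys hy] := hs _ (ovalP (repr a)).
apply/mapP; exists y => //; rewrite /redn -[LHS]reprK.
apply/eqP; rewrite -Quotient.idealrBE inE /= oring_ofK//.
rewrite -[y]opprK -[- y](addKr (oval (repr a))) opprD opprK.
apply: ppowB; first exact: ovalP.
by apply: ppowW hy.
Qed.

Definition On_enum := proj1_sig (cid On_finite).
Definition On_enumP := proj2_sig (cid On_finite).

HB.instance Definition _ : isCountable (On k n) :=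
  PCanIsCountable (index_onthK On_enumP).
HB.instance Definition _ := isFinite.Build (On k n) (undup_enumP On_enumP).

Definition On_unit : {pred On k n} := [pred a | [exists b : On k n, b * a == 1]].
Definition On_inv (a : On k n) := odflt a [pick b | b * a == 1].

Lemma On_mulVr : {in On_unit, left_inverse 1 On_inv *%R}.
Proof.
by move=> a /existsP[b h]; rewrite /On_inv; case: pickP => [c /eqP//|/(_ b)]; rewrite h.
Qed.
Lemma On_unitP (a b : On k n) : b * a = 1 -> a \in On_unit.
Proof. by move=> /eqP h; apply/existsP; exists b. Qed.
Lemma On_inv_out : {in [predC On_unit], On_inv =1 id}.
Proof.
move=> a; rewrite !inE negb_exists => /forallP h; rewrite /On_inv.
by case: pickP => // c; rewrite (negPf (h c)).
Qed.
HB.instance Definition _ :=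
  GRing.ComNzRing_hasMulInverse.Build (On k n) On_mulVr On_unitP On_inv_out.

End OnFinite.

(* P / (P :&: Q) for subgroups P and Q of an abelian group. *)
Section Subquotient.
Variables (M : zmodType) (P Q : zmodClosed M).

Record sub_of := SubOf { sub_val : M; sub_valP : sub_val \in P }.
HB.instance Definition _ := [isSub for sub_val].
HB.instance Definition _ := [Choice of sub_of by <:].
HB.instance Definition _ := [SubChoice_isSubZmodule of sub_of by <:].

Definition sub_mem : {pred sub_of} := [pred x | sub_val x \in Q].
Lemma sub_mem_closed : zmod_closed sub_mem.
Proof. by split=> [|x y]; rewrite !inE ?rpred0//= => *; rewrite rpredB. Qed.
HB.instance Definition _ := GRing.isZmodClosed.Build sub_of sub_mem sub_mem_closed.

Definition subquot : Type := Quotient.quot (sub_mem : zmodClosed sub_of).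
HB.instance Definition _ := GRing.Zmodule.on subquot.

(* the class of x, for x in P (0 otherwise), and a representative of a class *)
Definition sq_pi (x : M) : subquot := \pi_(subquot) (insubd (0 : sub_of) x).
Definition sq_repr (c : subquot) : M := sub_val (repr c).

Lemma sq_reprP c : sq_repr c \in P. Proof. exact: sub_valP. Qed.

Lemma sq_reprK : cancel sq_repr sq_pi.
Proof.
by move=> c; rewrite /sq_pi /sq_repr -[RHS]reprK; congr \pi; exact: valKd.
Qed.

Lemma sq_eqE x y : x \in P -> y \in P -> (sq_pi x == sq_pi y) = (x - y \in Q).
Proof.
move=> xP yP; rewrite /sq_pi -Quotient.idealrBE inE.
by rewrite -[sub_val _]/(val _) raddfB /= !insubdK.
Qed.

Lemma sq_eqP x y : x \in P -> y \in P -> x - y \in Q -> sq_pi x = sq_pi y.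
Proof. by move=> xP yP h; apply/eqP; rewrite sq_eqE. Qed.

Lemma sq_repr_pi x : x \in P -> sq_repr (sq_pi x) - x \in Q.
Proof. by move=> xP; rewrite -sq_eqE ?sq_reprP// sq_reprK. Qed.

Lemma sq_piD x y : x \in P -> y \in P -> sq_pi (x + y) = sq_pi x + sq_pi y.
Proof.
move=> xP yP; rewrite /sq_pi -[RHS]raddfD; congr \pi.
by apply: val_inj; rewrite raddfD /= !insubdK ?rpredD.
Qed.

Lemma sq_pi0 : sq_pi 0 = 0.
Proof. by apply: (addrI (sq_pi 0)); rewrite -sq_piD ?rpred0// !addr0. Qed.

Lemma sq_reprD c d : sq_repr (c + d) - (sq_repr c + sq_repr d) \in Q.
Proof. by rewrite -sq_eqE ?rpredD ?sq_reprP// sq_reprK sq_piD ?sq_reprP// !sq_reprK. Qed.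

End Subquotient.

(* (V, β) with β alternating and F-bilinear.  Nondegeneracy of β is not needed
   to state the definitions below; it holds for the modules b_n and b*_n. *)
Record altMod (F : finComUnitRingType) := AltMod {
  am_mod :> finLmodType F;
  am_form : am_mod -> am_mod -> F;
  am_linl : forall y, scalar (fun x => am_form x y);
  am_linr : forall x, scalar (am_form x);
  am_alt : forall x, am_form x x = 0
}.

Section FormTheory.
Variables (F : finComUnitRingType) (V : altMod F).
Implicit Types x y z : V.
Local Notation b := (@am_form F V).

Lemma formDl x y z : b (x + y) z = b x z + b y z.
Proof. by have := am_linl z 1 x y; rewrite scale1r mul1r. Qed.
Lemma formDr x y z : b x (y + z) = b x y + b x z.
Proof. by have := am_linr x 1 y z; rewrite scale1r mul1r. Qed.
Lemma form0l x : b 0 x = 0.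
Proof. by apply: (addrI (b 0 x)); rewrite -formDl !addr0. Qed.
Lemma form0r x : b x 0 = 0.
Proof. by apply: (addrI (b x 0)); rewrite -formDr !addr0. Qed.
Lemma formZl a x y : b (a *: x) y = a * b x y.
Proof. by have := am_linl y a x 0; rewrite form0l !addr0. Qed.
Lemma formZr a x y : b x (a *: y) = a * b x y.
Proof. by have := am_linr x a y 0; rewrite form0r !addr0. Qed.
Lemma formNl x y : b (- x) y = - b x y.
Proof. by rewrite -scaleN1r formZl mulN1r. Qed.
Lemma formNr x y : b x (- y) = - b x y.
Proof. by rewrite -scaleN1r formZr mulN1r. Qed.
Lemma formC x y : b x y = - b y x.
Proof.
have := am_alt (x + y); rewrite formDl !formDr !am_alt addr0 add0r.
by move/eqP; rewrite addr_eq0 => /eqP.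
Qed.
End FormTheory.

Section Sp.
Variables (F : finComUnitRingType) (V : altMod F).

Definition is_sp (g : {perm V}) : bool :=
  [forall a, forall x, forall y, g (a *: x + y) == a *: g x + g y] &&
  [forall x, forall y, am_form (g x) (g y) == am_form x y].

Lemma is_spP (g : {perm V}) :
  reflect ((forall a x y, g (a *: x + y) = a *: g x + g y) /\
           (forall x y, am_form (g x) (g y) = am_form x y)) (is_sp g).
Proof.
apply: (iffP andP) => -[h1 h2]; split.
- by move=> a x y; move: h1 => /forallP/(_ a)/forallP/(_ x)/forallP/(_ y)/eqP.
- by move=> x y; move: h2 => /forallP/(_ x)/forallP/(_ y)/eqP.
- by apply/forallP => a; apply/forallP => x; apply/forallP => y; rewrite h1.
- by apply/forallP => x; apply/forallP => y; rewrite h2.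
Qed.

Record Sp := MkSp { sp_perm :> {perm V}; sp_permP : is_sp sp_perm }.
HB.instance Definition _ := [isSub for sp_perm].
HB.instance Definition _ := [Finite of Sp by <:].

Lemma sp_lin (g : Sp) a x y : g (a *: x + y) = a *: g x + g y.
Proof. by case: g => g /= /is_spP[]. Qed.
Lemma sp_form (g : Sp) x y : am_form (g x) (g y) = am_form x y.
Proof. by case: g => g /= /is_spP[]. Qed.

Lemma sp_one_subproof : is_sp 1%g.
Proof. by apply/is_spP; split=> *; rewrite !perm1. Qed.
Definition sp_one := MkSp sp_one_subproof.

(* The product of {perm V} is the reversed composition; Sp V is the group of
   maps under composition, (g * h) x = g (h x). *)
Lemma sp_mul_subproof (g h : Sp) : is_sp (sp_perm h * sp_perm g)%g.
Proof. by apply/is_spP; split=> *; rewrite !permM ?sp_form// !sp_lin. Qed.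
Definition sp_mul (g h : Sp) := MkSp (sp_mul_subproof g h).

Lemma sp_inv_subproof (g : Sp) : is_sp (sp_perm g)^-1%g.
Proof.
apply/is_spP; split=> [a x y|x y]; last by rewrite -(sp_form g) !permKV.
by apply: (@perm_inj _ (sp_perm g)); rewrite sp_lin !permKV.
Qed.
Definition sp_inv (g : Sp) := MkSp (sp_inv_subproof g).

Lemma sp_mulA : associative sp_mul.
Proof. by move=> f g h; apply: val_inj => /=; rewrite mulgA. Qed.
Lemma sp_mul1 : left_id sp_one sp_mul.
Proof. by move=> g; apply: val_inj => /=; rewrite mulg1. Qed.
Lemma sp_mulV : left_inverse sp_one sp_inv sp_mul.
Proof. by move=> g; apply: val_inj => /=; rewrite mulgV. Qed.
HB.instance Definition _ := Finite_isGroup.Build Sp sp_mulA sp_mul1 sp_mulV.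

Lemma sp_opp_subproof : is_sp (perm (@oppr_inj V)).
Proof.
apply/is_spP; split=> [a x y|x y]; rewrite !permE ?formNl ?formNr ?opprK//.
by rewrite opprD scalerN.
Qed.
(* - Id *)
Definition sp_opp := MkSp sp_opp_subproof.

End Sp.

Section Heisenberg.
Variables (F : finComUnitRingType) (V : altMod F).

Definition heis : Type := (V * F)%type.
HB.instance Definition _ := Finite.on heis.

Definition heis_mul (h h' : heis) : heis :=
  (h.1 + h'.1, h.2 + h'.2 + 2%:R^-1 * am_form h.1 h'.1).
Definition heis_one : heis := (0, 0).
Definition heis_inv (h : heis) : heis := (- h.1, - h.2).

Lemma heis_mulA : associative heis_mul.
Proof.
move=> [u r] [v s] [w t]; rewrite /heis_mul /=; congr pair; first exact: addrA.
by rewrite formDl formDr; ring.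
Qed.
Lemma heis_mul1 : left_id heis_one heis_mul.
Proof. by move=> [v t]; rewrite /heis_mul /= form0l mulr0 !add0r addr0. Qed.
Lemma heis_mulV : left_inverse heis_one heis_inv heis_mul.
Proof.
by move=> [v t]; rewrite /heis_mul /= formNl am_alt oppr0 mulr0 !addNr addr0.
Qed.
HB.instance Definition _ :=
  Finite_isGroup.Build heis heis_mulA heis_mul1 heis_mulV.

Definition sp_heis (g : Sp V) (h : heis) : heis := (g h.1, h.2).

End Heisenberg.

(* Sp(V)-invariant isotropic submodules U *)
Record invIso (F : finComUnitRingType) (V : altMod F) := InvIso {
  ii_set :> {set V};
  ii_submod : submod_closed ii_set;
  ii_isotropic : {in ii_set &, forall x y, am_form x y = 0};
  ii_inv : forall g : Sp V, {in ii_set, forall x, g x \in ii_set}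
}.

Section UBar.
Variables (F : finComUnitRingType) (V : altMod F) (U : invIso V).

Definition perp : {pred V} := [pred x | [forall y in ii_set U, am_form x y == 0]].
Definition ii_pred : {pred V} := [pred x | x \in ii_set U].

Lemma perpP x : reflect {in ii_set U, forall y, am_form x y = 0} (x \in perp).
Proof. by apply: (iffP forall_inP) => h y yU; apply/eqP; exact/h. Qed.

Lemma perp_submod : submod_closed perp.
Proof.
split=> [|a x y /perpP hx /perpP hy]; apply/perpP => z zU; first by rewrite form0l.
by rewrite formDl formZl hx// hy// mulr0 addr0.
Qed.
HB.instance Definition _ := GRing.isZmodClosed.Build V perp
  (GRing.submod_closedB perp_submod).
Lemma ii_pred_submod : submod_closed ii_pred.
Proof. exact: ii_submod. Qed.
HB.instance Definition _ := GRing.isZmodClosed.Build V ii_pred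
  (GRing.submod_closedB ii_pred_submod).

Lemma perpZ a x : x \in perp -> a *: x \in perp.
Proof.
by move=> h; rewrite -[_ *: _]addr0; apply: perp_submod.2 => //; exact: rpred0.
Qed.
Lemma ii_predZ a x : x \in ii_pred -> a *: x \in ii_pred.
Proof.
by move=> h; rewrite -[_ *: _]addr0; apply: ii_pred_submod.2 => //; exact: rpred0.
Qed.
Lemma sp_perp (g : Sp V) x : x \in perp -> g x \in perp.
Proof.
move=> /perpP h; apply/perpP => y yU.
by rewrite -(sp_form g^-1%g) permK h// ii_inv.
Qed.

(* U^⊥ / U *)
Definition ubar_sort : Type := subquot (perp : zmodClosed V) (ii_pred : zmodClosed V).
HB.instance Definition _ := GRing.Zmodule.on ubar_sort.

Definition ubar_pi (x : V) : ubar_sort := sq_pi _ _ x.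
Definition ubar_repr (c : ubar_sort) : V := sq_repr c.

Lemma ubar_enumP (c : ubar_sort) : c \in [seq ubar_pi x | x : V].
Proof.
by rewrite -[c]sq_reprK; apply/mapP; exists (sq_repr c) => //; rewrite mem_enum.
Qed.
HB.instance Definition _ : isCountable ubar_sort :=
  PCanIsCountable (index_onthK ubar_enumP).
HB.instance Definition _ := isFinite.Build ubar_sort (undup_enumP ubar_enumP).

Definition ubar_scale (a : F) (c : ubar_sort) : ubar_sort :=
  ubar_pi (a *: ubar_repr c).

Lemma ubar_scale_pi a x : x \in perp -> ubar_scale a (ubar_pi x) = ubar_pi (a *: x).
Proof.
move=> xP; apply: sq_eqP; rewrite ?perpZ ?sq_reprP//.
by rewrite -scalerBr; apply: ii_predZ; exact: sq_repr_pi.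
Qed.

Lemma ubar_ind (K : ubar_sort -> Prop) :
  (forall x, x \in perp -> K (ubar_pi x)) -> forall c, K c.
Proof. by move=> h c; rewrite -[c]sq_reprK; apply: h; exact: sq_reprP. Qed.

Lemma ubar_piD x y : x \in perp -> y \in perp ->
  ubar_pi (x + y) = ubar_pi x + ubar_pi y.
Proof. exact: sq_piD. Qed.

Lemma ubar_scaleA a b c : ubar_scale a (ubar_scale b c) = ubar_scale (a * b) c.
Proof.
by elim/ubar_ind: c => x xP; rewrite !ubar_scale_pi ?perpZ// scalerA.
Qed.
Lemma ubar_scale1 : left_id 1 ubar_scale.
Proof. by elim/ubar_ind => x xP; rewrite ubar_scale_pi ?scale1r. Qed.
Lemma ubar_scaleDr : right_distributive ubar_scale +%R.
Proof.
move=> a; elim/ubar_ind => x xP; elim/ubar_ind => y yP.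
by rewrite -ubar_piD// !ubar_scale_pi ?rpredD// scalerDr ubar_piD ?perpZ.
Qed.
Lemma ubar_scaleDl c : {morph ubar_scale^~ c : a b / a + b}.
Proof.
move=> a b; elim/ubar_ind: c => x xP.
by rewrite !ubar_scale_pi// scalerDl ubar_piD ?perpZ.
Qed.
HB.instance Definition _ := GRing.Zmodule_isLmodule.Build F ubar_sort
  ubar_scaleA ubar_scale1 ubar_scaleDr ubar_scaleDl.

Definition ubar_form (c d : ubar_sort) : F := am_form (ubar_repr c) (ubar_repr d).

Lemma ubar_form_pi x y : x \in perp -> y \in perp ->
  ubar_form (ubar_pi x) (ubar_pi y) = am_form x y.
Proof.
move=> xP yP; rewrite /ubar_form /ubar_repr /ubar_pi.
set x' := sq_repr _; set y' := sq_repr _.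
have hx : x' - x \in ii_set U by exact: sq_repr_pi.
have hy : y' - y \in ii_set U by exact: sq_repr_pi.
rewrite -[x'](subrK x) -[y'](subrK y) formDl [in X in X + _]formC.
have -> : y' - y + y = y' by rewrite subrK.
have /perpP -> // : y' \in perp by exact: sq_reprP.
by rewrite oppr0 add0r -[y'](subrK y) formDr; move/perpP: xP => ->//; rewrite add0r.
Qed.

Lemma ubar_linl d : scalar (fun c => ubar_form c d).
Proof.
move=> a; elim/ubar_ind => x xP; elim/ubar_ind => y yP.
elim/ubar_ind: d => z zP.
rewrite [a *: _]ubar_scale_pi// -ubar_piD ?perpZ// !ubar_form_pi ?rpredD ?perpZ//.
exact: am_linl.
Qed.
Lemma ubar_linr c : scalar (ubar_form c).
Proof.
move=> a; elim/ubar_ind => x xP; elim/ubar_ind => y yP.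
elim/ubar_ind: c => z zP.
rewrite [a *: _]ubar_scale_pi// -ubar_piD ?perpZ// !ubar_form_pi ?rpredD ?perpZ//.
exact: am_linr.
Qed.
Lemma ubar_alt c : ubar_form c c = 0. Proof. exact: am_alt. Qed.

Definition ubar : altMod F := @AltMod F ubar_sort ubar_form ubar_linl ubar_linr ubar_alt.

Definition rU_fun (g : Sp V) (c : ubar) : ubar := ubar_pi (g (ubar_repr c)).

Lemma rU_pi g x : x \in perp -> rU_fun g (ubar_pi x) = ubar_pi (g x).
Proof.
move=> xP; apply: sq_eqP; rewrite ?sp_perp ?sq_reprP//.
have := sp_lin g (-1) x (ubar_repr (ubar_pi x)).
rewrite !scaleN1r ![- _ + _]addrC => <-; apply: ii_inv; exact: sq_repr_pi.
Qed.

Lemma rU_inj g : injective (rU_fun g).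
Proof.
apply: (@can_inj _ _ _ (rU_fun g^-1%g)); elim/ubar_ind => x xP.
by rewrite !rU_pi ?sp_perp// permK.
Qed.

Lemma rU_subproof g : is_sp (perm (@rU_inj g) : {perm ubar}).
Proof.
apply/is_spP; split=> [a|]; elim/ubar_ind => x xP; elim/ubar_ind => y yP.
  rewrite !permE [a *: ubar_pi x]ubar_scale_pi// -ubar_piD ?perpZ//.
  rewrite !rU_pi ?rpredD ?perpZ// sp_lin ubar_piD ?perpZ ?sp_perp//.
  by congr (_ + _); rewrite [RHS]ubar_scale_pi ?sp_perp.
by rewrite !permE !rU_pi// /= !ubar_form_pi ?sp_perp// sp_form.
Qed.

(* the natural morphism Sp(V) -> Sp(U^⊥ / U) *)
Definition rU (g : Sp V) : Sp ubar := MkSp (rU_subproof g).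

End UBar.

Local Open Scope classical_set_scope.

Definition subspace (C : fieldType) (E : lmodType C) (A : set E) : Prop :=
  A 0 /\ forall (a : C) u v, A u -> A v -> A (a *: u + v).

(* Candidate representations: operators on an ambient finite-dimensional space,
   of which only the action on the subspace rp_space is meaningful. *)
Record repn (C : fieldType) (gT : Type) := Repn {
  rp_sort : vectType C;
  rp_space : set rp_sort;
  rp_op : gT -> rp_sort -> rp_sort
}.
Arguments rp_space {C gT} r _.
Arguments rp_op {C gT} r g _.

Section Representations.
Variables (C : numClosedFieldType) (gT : finGroupType).
Implicit Types r : repn C gT.

Definition is_repn r : Prop :=
  [/\ subspace (rp_space r),
      forall g v, rp_space r v -> rp_space r (rp_op r g v),
      forall g (a : C) u v, rp_space r u -> rp_space r v ->
        rp_op r g (a *: u + v) = a *: rp_op r g u + rp_op r g v,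
      forall v, rp_space r v -> rp_op r 1%g v = v
    & forall g h v, rp_space r v ->
        rp_op r (g * h)%g v = rp_op r g (rp_op r h v)].

Definition irreducible r : Prop :=
  [/\ is_repn r, rp_space r <> [set 0]
    & forall A : set (rp_sort r), subspace A -> A `<=` rp_space r ->
        (forall g v, A v -> A (rp_op r g v)) -> A = [set 0] \/ A = rp_space r].

Definition unitary r : Prop :=
  exists f : rp_sort r -> rp_sort r -> C,
  [/\ forall (a : C) u v w, rp_space r u -> rp_space r v -> rp_space r w ->
        f (a *: u + v) w = a * f u w + f v w,
      forall u v, rp_space r u -> rp_space r v -> f v u = Num.conj (f u v),
      forall u, rp_space r u -> u != 0 -> 0 < f u u
    & forall g u v, rp_space r u -> rp_space r v ->
        f (rp_op r g u) (rp_op r g v) = f u v].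

Definition repn_iso r1 r2 : Prop :=
  exists f : 'Hom(rp_sort r1, rp_sort r2),
  [/\ f @` rp_space r1 = rp_space r2,
      {in rp_space r1 &, injective f}
    & forall g v, rp_space r1 v -> f (rp_op r1 g v) = rp_op r2 g (f v)].

(* Ind_H^G t, realized on {f : G -> E | f (h g) = t(h) f(g) for h in H} with
   G acting by right translations *)
Definition induced (H : {set gT}) (t : repn C gT) : repn C gT :=
  @Repn C gT {ffun gT -> rp_sort t}
    [set f : {ffun gT -> rp_sort t} | (forall g, rp_space t (f g)) /\
             (forall h g, h \in H -> f (h * g)%g = rp_op t h (f g))]
    (fun g f => [ffun x => f (x * g)%g]).

Definition char_repn (chi : gT -> C) : repn C gT :=
  @Repn C gT C^o setT (fun g v => chi g * v).

Definition monomial r : Prop :=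
  exists (H : {group gT}) (chi : gT -> C),
  [/\ chi 1%g = 1,
      {in H &, forall g h, chi (g * h)%g = chi g * chi h}
    & repn_iso r (induced H (char_repn chi))].

End Representations.

Definition primitive_char (C : fieldType) (F : finComUnitRingType) (psi : F -> C)
    : Prop :=
  [/\ psi 0 = 1,
      forall s t, psi (s + t) = psi s * psi t
    & forall I : {set F},
        0 \in I -> {in I &, forall s t, s + t \in I} ->
        (forall a, {in I, forall s, a * s \in I}) ->
        {in I, forall s, psi s = 1} -> I = [set 0]%SET].

(* A space carrying operators indexed by H(V) and by G *)
Record weilRep (C : fieldType) (F : finComUnitRingType) (V : altMod F)
    (gT : Type) := WeilRep {
  wr_sort : vectType C;
  wr_space : set wr_sort;
  wr_heis : heis V -> wr_sort -> wr_sort;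
  wr_grp : gT -> wr_sort -> wr_sort
}.
Arguments wr_space {C F V gT} w _.
Arguments wr_heis {C F V gT} w h _.
Arguments wr_grp {C F V gT} w g _.

Section Weil.
Variables (C : numClosedFieldType) (F : finComUnitRingType) (psi : F -> C).

Section Relative.
Variables (V : altMod F) (gT : finGroupType).
Implicit Types S : weilRep C V gT.

Definition heis_repn S : repn C (heis V) := Repn (wr_space S) (wr_heis S).
Definition grp_repn S : repn C gT := Repn (wr_space S) (wr_grp S).

(* S is a Weil representation of type psi of G relative to gamma *)
Definition is_weil (gamma : gT -> Sp V) S : Prop :=
  [/\ irreducible (heis_repn S) /\ unitary (heis_repn S),
      forall t v, wr_space S v -> wr_heis S (0, t) v = psi t *: v,
      is_repn (grp_repn S)
    & forall g h v, wr_space S v ->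
        wr_grp S g (wr_heis S h (wr_grp S g^-1%g v)) =
        wr_heis S (sp_heis (gamma g) h) v].

(* equality of Weil representations *)
Definition weil_iso S1 S2 : Prop :=
  exists f : 'Hom(wr_sort S1, wr_sort S2),
  [/\ f @` wr_space S1 = wr_space S2,
      {in wr_space S1 &, injective f},
      forall h v, wr_space S1 v -> f (wr_heis S1 h v) = wr_heis S2 h (f v)
    & forall g v, wr_space S1 v -> f (wr_grp S1 g v) = wr_grp S2 g (f v)].

End Relative.

Section Model.
Variables (V : altMod F) (U : invIso V) (sigma : weilRep C (ubar U) (Sp V)).

(* rho_{U^⊥,psi}(w, t), for w in U^⊥ *)
Definition rho_perp (w : V) (t : F) : wr_sort sigma -> wr_sort sigma :=
  wr_heis sigma (ubar_pi U w, t).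

(* S^{U,sigma} *)
Definition weil_model : weilRep C V (Sp V) :=
  @WeilRep C F V (Sp V) {ffun V -> wr_sort sigma}
    [set phi : {ffun V -> wr_sort sigma} | (forall x, wr_space sigma (phi x)) /\
       (forall x w, w \in perp U ->
          phi (x + w) = psi (2%:R^-1 * am_form x w) *: rho_perp w 0 (phi x))]
    (fun h phi => [ffun x => psi (h.2 + 2%:R^-1 * am_form x h.1) *: phi (x + h.1)])
    (fun g phi => [ffun x => wr_grp sigma g (phi (g^-1%g x))]).

(* G(x^) *)
Definition stab (x : V) : {set Sp V} := [set g : Sp V | g x - x \in perp U]%SET.

(* {± Id} G(x^) *)
Definition pm_stab (x : V) : {set Sp V} :=
  [set g : Sp V | (g \in stab x) || ((sp_opp V * g)%g \in stab x)]%SET.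

Definition sigma_dot (x : V) (g : Sp V) (v : wr_sort sigma) : wr_sort sigma :=
  wr_grp sigma g (rho_perp (g^-1%g x - x) (2%:R^-1 * am_form x (g^-1%g x)) v).

(* In what follows e = false stands for the sign + and e = true for the sign -. *)
Definition sigma_dot_sgn (e : bool) (x : V) (g : Sp V) (v : wr_sort sigma) :=
  if g \in stab x then sigma_dot x g v
  else (-1) ^+ e *: sigma_dot x (sp_opp V * g)%g v.

Definition S_dot (e : bool) (x : V) : repn C (Sp V) :=
  induced (pm_stab x) (Repn (wr_space sigma) (sigma_dot_sgn e x)).

Definition sigma_sgn (e : bool) : repn C (Sp V) :=
  Repn [set v | wr_space sigma v /\ wr_grp sigma (sp_opp V) v = (-1) ^+ e *: v]
       (wr_grp sigma).

(* representatives of the Sp(V)-orbits in (V / U^⊥) \ {0} *)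
Definition orbit_reps (X : {set V}) : Prop :=
  [/\ {in X, forall x, x \notin perp U},
      forall y, y \notin perp U ->
        exists2 x, x \in X & exists g : Sp V, g x - y \in perp U
    & {in X &, forall x x', (exists g : Sp V, g x - x' \in perp U) -> x = x'}].

Definition ubar_trivial : bool := [forall c : ubar U, c == 0].

(* The representations appearing in the decomposition of S^{U,sigma} are the
   summand i for i in summand_index X: inl false stands for sigma itself if
   U^⊥/U = 0, the inl e stand for sigma^± otherwise, and inr (x, e) stands
   for S^±_{x.}. *)
Definition summand_index (X : {set V}) : {set bool + V * bool} :=
  [set i : bool + V * bool | match i with
           | inl e => ~~ (e && ubar_trivial)
           | inr (x, _) => x \in X
           end]%SET.

Definition summand (i : bool + V * bool) : repn C (Sp V) :=
  match i with
  | inl e => if ubar_trivial then grp_repn sigma else sigma_sgn e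
  | inr (x, e) => S_dot e x
  end.

End Model.
End Weil.

Section VectorTopology.
Variables (k : localField) (W : vectType k).

(* W with the product topology of k^(dim W), for the coordinates in vbasis *)
Definition vtop : Type := W.
HB.instance Definition _ := Choice.on vtop.

Definition vball (i : int) : set vtop :=
  [set w | forall j, coord (vbasis {:W}%VS) j (w : W) \in ppow k i].
Definition vopen : set_system vtop :=
  [set A | forall w, A w ->
     exists i, forall w' : vtop, vball i ((w' : W) - (w : W)) -> A w'].

Lemma vopenT : vopen setT. Proof. by move=> w _; exists 0. Qed.
Lemma vopenI : setI_closed vopen.
Proof.
move=> A B oA oB w [/oA[i hi] /oB[j hj]].
exists (Num.max i j) => w' hw'; split; [apply: hi|apply: hj] => l;
  by apply: ppowW (hw' l); rewrite le_max lexx ?orbT.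
Qed.
Lemma vopenU (I : Type) (f : I -> set vtop) :
  (forall i, vopen (f i)) -> vopen (\bigcup_i f i).
Proof.
move=> of_ w [i _ /of_[j hj]]; exists j => w' /hj fw'; by exists i.
Qed.
HB.instance Definition _ := isOpenTopological.Build vtop vopenT vopenI vopenU.
HB.instance Definition _ := isPointed.Build vtop (0 : W).
Lemma vopenE : (open : set_system vtop) = vopen. Proof. by []. Qed.
End VectorTopology.

Record sympSpace (k : localField) := SympSpace {
  ss_vect :> vectType k;
  ss_form : ss_vect -> ss_vect -> k;
  ss_linl : forall y, scalar (fun x => ss_form x y);
  ss_linr : forall x, scalar (ss_form x);
  ss_alt : forall x, ss_form x x = 0;
  ss_nondegenerate : forall x, (forall y, ss_form x y = 0) -> x = 0
}.

(* O-submodules of W *)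
Record osub (k : localField) (W : vectType k) := OSub {
  os_pred :> {pred W};
  os_0 : 0 \in os_pred;
  os_D : {in os_pred &, forall x y, x + y \in os_pred};
  os_Z : forall a : k, a \in ppow k 0 -> {in os_pred, forall x, a *: x \in os_pred}
}.

Definition osub_proper (k : localField) (W : vectType k) (P Q : osub W) : Prop :=
  {subset P <= Q} /\ ~ {subset Q <= P}.

Record lattice (k : localField) (W : vectType k) := Lattice {
  lat_osub :> osub W;
  lat_compact : compact ([set` os_pred lat_osub] : set (vtop W));
  lat_open : open ([set` os_pred lat_osub] : set (vtop W))
}.

Section OSub.
Variables (k : localField) (W : vectType k).
Implicit Types P Q L : osub W.
Local Notation pi := (lf_unif k).

Lemma osub_zmod P : zmod_closed (os_pred P).
Proof.
split=> [|x y xP yP]; first exact: os_0.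
by apply: os_D => //; rewrite -scaleN1r; apply: os_Z => //; exact: ppowN1.
Qed.
HB.instance Definition _ P := GRing.isZmodClosed.Build W (os_pred P) (osub_zmod P).

Definition oscale_pred (i : int) P : {pred W} := [pred x | pi ^ (- i) *: x \in P].
Lemma oscale_0 i P : 0 \in oscale_pred i P.
Proof. by rewrite inE scaler0 os_0. Qed.
Lemma oscale_D i P : {in oscale_pred i P &, forall x y, x + y \in oscale_pred i P}.
Proof. by move=> x y; rewrite !inE scalerDr; exact: os_D. Qed.
Lemma oscale_Z i P (a : k) : a \in ppow k 0 ->
  {in oscale_pred i P, forall x, a *: x \in oscale_pred i P}.
Proof.
by move=> ha x; rewrite !inE scalerA mulrC -scalerA; exact: os_Z.
Qed.
(* ϖ^i P *)
Definition oscale i P : osub W := OSub (oscale_0 i P) (@oscale_D i P) (@oscale_Z i P).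

Lemma in_oscale i P x : (x \in oscale i P) = (pi ^ (- i) *: x \in P).
Proof. by []. Qed.

Lemma unifXD i j (x : W) : pi ^ i *: (pi ^ j *: x) = pi ^ (i + j) *: x.
Proof. by rewrite scalerA expfzDr ?lf_unif_neq0. Qed.

Lemma unifXK i (x : W) : pi ^ i *: (pi ^ (- i) *: x) = x.
Proof. by rewrite unifXD subrr expr0z scale1r. Qed.

Lemma in_oscale_shift i j P x :
  (pi ^ j *: x \in oscale i P) = (x \in oscale (i - j) P).
Proof. by rewrite !in_oscale unifXD opprB addrC. Qed.

Lemma osub_unif i P x : 0 <= i -> x \in P -> pi ^ i *: x \in P.
Proof. by move=> i0; apply: os_Z; apply: ppowW i0 (ppow_unif _ _). Qed.

Lemma oscale_sub i j P : j <= i -> {subset oscale i P <= oscale j P}.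
Proof.
move=> ji x; rewrite !in_oscale => /(osub_unif (i := i - j)).
by rewrite subr_ge0 ji unifXD addrAC subrr add0r; exact.
Qed.

Lemma lattice_cover (L : lattice W) (N : int) :
  exists s : seq W, forall x, x \in L -> exists2 y, y \in s & x - y \in oscale N L.
Proof.
have := @lat_compact _ _ L; rewrite compact_cover => /(_ W setT
  (fun y => [set x : vtop W | (x : W) - y \in oscale N L])).
case=> [y _|x _|s _ hs].
- rewrite vopenE => w /= hw; have [i hi] := (@lat_open _ _ L : vopen _) _ (os_0 L).
  exists (i + N) => w' hw' /=.
  have -> : (w' : W) - y = ((w' : W) - (w : W)) + ((w : W) - y) by rewrite addrA subrK.
  apply: oscale_D; last exact: hw.
  rewrite inE; apply: hi => j; rewrite subr0 linearZ /= ppow_shift opprK.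
  exact: hw'.
- by exists x => //=; rewrite subrr; exact: oscale_0.
- by exists (enum_fset s) => x /hs[y ys hy]; exists y.
Qed.

End OSub.

Section RednTheory.
Variables (k : localField) (n : nat).
Implicit Types (a b : On k n) (x y : k).

Lemma ppowM0 x y : x \in ppow k 0 -> y \in ppow k 0 -> x * y \in ppow k 0.
Proof. by move=> hx hy; have := ppowM hx hy; rewrite addr0. Qed.

Lemma redn_repr a : redn n (oval (repr a)) = a.
Proof. by rewrite /redn -[RHS]reprK; congr \pi; exact: valKd. Qed.

Lemma redn_eqE x y : x \in ppow k 0 -> y \in ppow k 0 ->
  (redn n x == redn n y) = (x - y \in ppow k n.+1).
Proof.
by move=> hx hy; rewrite /redn -Quotient.idealrBE inE /= !oring_ofK.
Qed.

Lemma rednD x y : x \in ppow k 0 -> y \in ppow k 0 ->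
  redn n (x + y) = redn n x + redn n y.
Proof.
move=> hx hy; rewrite /redn -[RHS]raddfD; congr \pi; apply: val_inj => /=.
by rewrite !oring_ofK //; exact: ppowD.
Qed.

Lemma rednM x y : x \in ppow k 0 -> y \in ppow k 0 ->
  redn n (x * y) = redn n x * redn n y.
Proof.
move=> hx hy; rewrite /redn -[RHS]rmorphM; congr \pi; apply: val_inj => /=.
by rewrite !oring_ofK//; have := ppowM hx hy; rewrite addr0.
Qed.

Lemma redn1 : redn n 1 = 1 :> On k n.
Proof.
rewrite /redn -[RHS](rmorph1 \pi_(On k n)); congr \pi; apply: val_inj => /=.
by rewrite oring_ofK//; exact: ppow1.
Qed.

Lemma redn0 : redn n 0 = 0 :> On k n.
Proof. by apply: (addrI (redn n 0)); rewrite -rednD ?ppow0// !addr0. Qed.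

Lemma redn_eq0 x : x \in ppow k n.+1 -> redn n x = 0.
Proof.
move=> hx; apply/eqP; rewrite -redn0 redn_eqE ?ppow0 ?subr0//.
exact: ppowW hx.
Qed.

Lemma On_ind (K : On k n -> Prop) :
  (forall x, x \in ppow k 0 -> K (redn n x)) -> forall a, K a.
Proof. by move=> h a; rewrite -[a]redn_repr; apply: h; exact: ovalP. Qed.

End RednTheory.

Section WFormTheory.
Variables (k : localField) (W : sympSpace k).
Implicit Types x y z : W.
Local Notation b := (@ss_form k W).

Lemma wformDl x y z : b (x + y) z = b x z + b y z.
Proof. by have := ss_linl z 1 x y; rewrite scale1r mul1r. Qed.
Lemma wformDr x y z : b x (y + z) = b x y + b x z.
Proof. by have := ss_linr x 1 y z; rewrite scale1r mul1r. Qed.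
Lemma wform0l x : b 0 x = 0.
Proof. by apply: (addrI (b 0 x)); rewrite -wformDl !addr0. Qed.
Lemma wform0r x : b x 0 = 0.
Proof. by apply: (addrI (b x 0)); rewrite -wformDr !addr0. Qed.
Lemma wformZl a x y : b (a *: x) y = a * b x y.
Proof. by have := ss_linl y a x 0; rewrite wform0l !addr0. Qed.
Lemma wformZr a x y : b x (a *: y) = a * b x y.
Proof. by have := ss_linr x a y 0; rewrite wform0r !addr0. Qed.
Lemma wformC x y : b x y = - b y x.
Proof.
have := ss_alt (x + y); rewrite wformDl !wformDr !ss_alt addr0 add0r.
by move/eqP; rewrite addr_eq0 => /eqP.
Qed.
End WFormTheory.

(* O-submodules Q <= P of W for which P / Q is a finite O_n-module on which
   c β induces an O_n-valued form *)
Record sqData (k : localField) (W : sympSpace k) (n : nat) := SqData {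
  sqd_P : osub W;
  sqd_Q : osub W;
  sqd_c : k;
  sqd_sub : {subset sqd_Q <= sqd_P};
  sqd_fin : exists s : seq W,
    forall x, x \in sqd_P -> exists2 y, y \in s & x - y \in sqd_Q;
  sqd_ann : forall x, x \in sqd_P -> lf_unif k ^ n.+1 *: x \in sqd_Q;
  sqd_int : {in sqd_P &, forall x y, sqd_c * ss_form x y \in ppow k 0};
  sqd_rad : forall x y, x \in sqd_P -> y \in sqd_Q ->
    sqd_c * ss_form x y \in ppow k n.+1
}.

Section SqModule.
Variables (k : localField) (W : sympSpace k) (n : nat) (d : sqData W n).
Local Notation P := (sqd_P d).
Local Notation Q := (sqd_Q d).

(* P / Q *)
Definition sqm_sort : Type :=
  subquot (os_pred P : zmodClosed W) (os_pred Q : zmodClosed W).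
HB.instance Definition _ := GRing.Zmodule.on sqm_sort.

Definition sqm_pi (x : W) : sqm_sort := sq_pi _ _ x.
Definition sqm_repr (c : sqm_sort) : W := sq_repr c.

Lemma sqm_finite : exists s : seq sqm_sort, forall c, c \in s.
Proof.
have [s hs] := sqd_fin d; exists [seq sqm_pi y | y <- s] => c.
have [y ys hy] := hs _ (sq_reprP c); apply/mapP; exists y => //.
rewrite -[LHS]sq_reprK; apply: sq_eqP => //; first exact: sq_reprP.
rewrite -[y]opprK -[- y](addKr (sq_repr c)) opprD opprK.
by rewrite rpredB ?sq_reprP//; exact: sqd_sub hy.
Qed.
Definition sqm_enum := proj1_sig (cid sqm_finite).
Definition sqm_enumP := proj2_sig (cid sqm_finite).
HB.instance Definition _ : isCountable sqm_sort :=
  PCanIsCountable (index_onthK sqm_enumP).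
HB.instance Definition _ := isFinite.Build sqm_sort (undup_enumP sqm_enumP).

Lemma sqm_ind (K : sqm_sort -> Prop) :
  (forall x, x \in P -> K (sqm_pi x)) -> forall c, K c.
Proof. by move=> h c; rewrite -[c]sq_reprK; apply: h; exact: sq_reprP. Qed.

Lemma sqm_piD x y : x \in P -> y \in P -> sqm_pi (x + y) = sqm_pi x + sqm_pi y.
Proof. exact: sq_piD. Qed.

Definition sqm_scale (a : On k n) (c : sqm_sort) : sqm_sort :=
  sqm_pi (oval (repr a) *: sqm_repr c).

Lemma sqd_annZ a x : a \in ppow k n.+1 -> x \in P -> a *: x \in Q.
Proof.
move=> ha xP; have -> : a = (lf_unif k ^ (- n.+1%:Z) * a) * lf_unif k ^ n.+1%:Z.
  by rewrite mulrAC -expfzDr ?lf_unif_neq0// addNr expr0z mul1r.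
by rewrite -scalerA os_Z ?sqd_ann// ppow_shift sub0r opprK.
Qed.

Lemma sqm_scale_pi a x : a \in ppow k 0 -> x \in P ->
  sqm_scale (redn n a) (sqm_pi x) = sqm_pi (a *: x).
Proof.
move=> ha xP; apply: sq_eqP; rewrite ?os_Z ?sq_reprP//; first exact: ovalP.
set a' := oval _; set x' := sqm_repr _.
have ha' : a' \in ppow k 0 by exact: ovalP.
have -> : a' *: x' - a *: x = a' *: (x' - x) + (a' - a) *: x.
  by rewrite scalerBr scalerBl addrA subrK.
apply: rpredD; first by apply: os_Z => //; exact: sq_repr_pi.
by apply: sqd_annZ => //; rewrite -redn_eqE// redn_repr.
Qed.

Lemma sqm_scaleA a b c : sqm_scale a (sqm_scale b c) = sqm_scale (a * b) c.
Proof.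
elim/On_ind: a => a ha; elim/On_ind: b => b hb; elim/sqm_ind: c => x xP.
have hab : a * b \in ppow k 0 by have := ppowM ha hb; rewrite addr0.
by rewrite -rednM// !sqm_scale_pi ?os_Z// scalerA.
Qed.
Lemma sqm_scale1 : left_id 1 sqm_scale.
Proof.
elim/sqm_ind => x xP.
by rewrite -(redn1 k n) sqm_scale_pi ?scale1r//; exact: ppow1.
Qed.
Lemma sqm_scaleDr : right_distributive sqm_scale +%R.
Proof.
elim/On_ind => a ha; elim/sqm_ind => x xP; elim/sqm_ind => y yP.
by rewrite -sqm_piD// !sqm_scale_pi ?os_D// scalerDr sqm_piD ?os_Z.
Qed.
Lemma sqm_scaleDl c : {morph sqm_scale^~ c : a b / a + b}.
Proof.
elim/On_ind => a ha; elim/On_ind => b hb; elim/sqm_ind: c => x xP.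
by rewrite -rednD// !sqm_scale_pi ?ppowD// scalerDl sqm_piD ?os_Z.
Qed.
HB.instance Definition _ := GRing.Zmodule_isLmodule.Build (On k n) sqm_sort
  sqm_scaleA sqm_scale1 sqm_scaleDr sqm_scaleDl.

Definition sqm_form (x y : sqm_sort) : On k n :=
  redn n (sqd_c d * ss_form (sqm_repr x) (sqm_repr y)).

Lemma sqm_form_pi x y : x \in P -> y \in P ->
  sqm_form (sqm_pi x) (sqm_pi y) = redn n (sqd_c d * ss_form x y).
Proof.
move=> xP yP; apply/eqP; rewrite redn_eqE; try by apply: sqd_int => //; exact: sq_reprP.
set x' := sqm_repr _; set y' := sqm_repr _.
have hx : x' - x \in Q by exact: sq_repr_pi.
have hy : y' - y \in Q by exact: sq_repr_pi.
have y'P : y' \in P by exact: sq_reprP.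
have -> : sqd_c d * ss_form x' y' - sqd_c d * ss_form x y
   = - (sqd_c d * ss_form y' (x' - x)) + sqd_c d * ss_form x (y' - y).
  by rewrite [ss_form y' _]wformC -[- y]scaleN1r -[- x]scaleN1r !wformDl !wformDr !wformZl wformZr; ring.
by apply: ppowD; rewrite ?ppowN// sqd_rad.
Qed.

Lemma sqm_linl y : scalar (fun x => sqm_form x y).
Proof.
elim/On_ind => a ha; elim/sqm_ind => u uP; elim/sqm_ind => v vP.
elim/sqm_ind: y => w wP.
rewrite [_ *: _]sqm_scale_pi// -sqm_piD ?os_Z// !sqm_form_pi ?os_D ?os_Z//.
have huw := @sqd_int _ _ _ d u w uP wP; have hvw := @sqd_int _ _ _ d v w vP wP.
by rewrite wformDl wformZl mulrDr mulrCA (rednD n (ppowM0 ha huw) hvw) (rednM n ha huw).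
Qed.
Lemma sqm_alt x : sqm_form x x = 0.
Proof. by rewrite /sqm_form ss_alt mulr0 redn0. Qed.
Lemma sqm_formC x y : sqm_form x y = - sqm_form y x.
Proof.
elim/sqm_ind: x => x xP; elim/sqm_ind: y => y yP; rewrite !sqm_form_pi//.
apply/eqP; rewrite -addr_eq0 -rednD; try exact: sqd_int.
by rewrite -mulrDr wformC addNr mulr0 redn0.
Qed.
Lemma sqm_linr x : scalar (sqm_form x).
Proof.
by move=> a u v; rewrite sqm_formC sqm_linl opprD -mulrN -!sqm_formC.
Qed.

Definition sqm : altMod (On k n) :=
  @AltMod (On k n) sqm_sort sqm_form sqm_linl sqm_linr sqm_alt.

End SqModule.

Lemma sp_0 (F : finComUnitRingType) (V : altMod F) (g : Sp V) : g 0 = 0.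
Proof. by have := sp_lin g (-1) 0 0; rewrite !scaleN1r oppr0 addr0 addNr. Qed.
Lemma sp_scale (F : finComUnitRingType) (V : altMod F) (g : Sp V) a x :
  g (a *: x) = a *: g x.
Proof. by have := sp_lin g a x 0; rewrite sp_0 !addr0. Qed.

Section Image.
Variables (k : localField) (W : sympSpace k) (n : nat) (d : sqData W n).
Local Notation P := (sqd_P d).
Local Notation Q := (sqd_Q d).
Variables (T : osub W) (TP : {subset T <= P}).

(* the image of T in P / Q *)
Definition sqm_img : {set sqm d} :=
  [set c : sqm d | `[< exists2 x, x \in T & c = sqm_pi d x >]]%SET.

Lemma sqm_imgP (c : sqm d) :
  reflect (exists2 x, x \in T & c = sqm_pi d x) (c \in sqm_img).
Proof. by rewrite inE; exact: asboolP. Qed.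

Lemma sqm_img_submod : submod_closed sqm_img.
Proof.
split=> [|a _ _ /sqm_imgP[x xT ->] /sqm_imgP[y yT ->]]; apply/sqm_imgP.
  by exists 0; rewrite ?os_0// [RHS]sq_pi0.
elim/On_ind: a => a ha; exists (a *: x + y); first by rewrite os_D ?os_Z.
by rewrite sqm_piD ?os_Z ?TP// [X in X + _]sqm_scale_pi ?TP.
Qed.

Lemma sqm_img_isotropic :
  {in T &, forall x y, sqd_c d * ss_form x y \in ppow k n.+1} ->
  {in sqm_img &, forall x y, am_form x y = 0}.
Proof.
move=> h _ _ /sqm_imgP[x xT ->] /sqm_imgP[y yT ->].
by rewrite [LHS]sqm_form_pi ?TP// redn_eq0// h.
Qed.

Lemma sqm_pi_unif (j : nat) x : x \in P ->
  sqm_pi d (lf_unif k ^ j%:Z *: x) = redn n (lf_unif k ^ j%:Z) *: (sqm_pi d x : sqm d).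
Proof.
by move=> xP; rewrite [RHS]sqm_scale_pi//; apply: ppowW (ppow_unif _ _).
Qed.

Lemma sqm_img_inv_im (j : nat) : T =i oscale j%:Z P ->
  forall g : Sp (sqm d), {in sqm_img, forall x, g x \in sqm_img}.
Proof.
move=> hT g _ /sqm_imgP[x xT ->]; apply/sqm_imgP.
have xP : lf_unif k ^ (- j%:Z) *: x \in P by rewrite -in_oscale -hT.
rewrite -[x](unifXK j%:Z) sqm_pi_unif// sp_scale.
elim/sqm_ind: (g _) => y yP; exists (lf_unif k ^ j%:Z *: y).
  by rewrite hT in_oscale unifXD addNr expr0z scale1r.
by rewrite sqm_pi_unif.
Qed.

Lemma sqm_img_inv_ker (j : nat) :
  (forall x, x \in P -> (x \in T) = (lf_unif k ^ j%:Z *: x \in Q)) ->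
  forall g : Sp (sqm d), {in sqm_img, forall x, g x \in sqm_img}.
Proof.
move=> hT g c cT; apply/sqm_imgP.
have h0 x : x \in P ->
    (x \in T) = (redn n (lf_unif k ^ j%:Z) *: (sqm_pi d x : sqm d) == 0).
  move=> xP; rewrite hT// -sqm_pi_unif// -(sq_pi0 (os_pred P) (os_pred Q)).
  by rewrite sq_eqE ?rpred0 ?subr0// osub_unif.
have : redn n (lf_unif k ^ j%:Z) *: g c == 0.
  move/sqm_imgP: cT => [x xT ->]; rewrite -sp_scale.
  by have := xT; rewrite h0 ?TP// => /eqP ->; rewrite sp_0.
elim/sqm_ind: (g c) => y yP h; exists y => //.
by rewrite h0.
Qed.

End Image.

Section Dual.
Variables (k : localField) (W : sympSpace k) (lam : int).

Definition dual_pred (P : osub W) : {pred W} :=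
  [pred x | `[< forall b, b \in P -> ss_form x b \in ppow k lam >]].

Lemma dualP (P : osub W) x :
  reflect (forall b, b \in P -> ss_form x b \in ppow k lam) (x \in dual_pred P).
Proof. exact: asboolP. Qed.

Lemma dual_0 P : 0 \in dual_pred P.
Proof. by apply/dualP => b _; rewrite wform0l ppow0. Qed.
Lemma dual_D P : {in dual_pred P &, forall x y, x + y \in dual_pred P}.
Proof.
move=> x y /dualP hx /dualP hy; apply/dualP => b bP.
by rewrite wformDl ppowD ?hx ?hy.
Qed.
Lemma dual_Z P (a : k) : a \in ppow k 0 ->
  {in dual_pred P, forall x, a *: x \in dual_pred P}.
Proof.
move=> ha x /dualP hx; apply/dualP => b bP; rewrite wformZl -[lam]add0r.
by apply: ppowM => //; exact: hx.
Qed.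
(* P^* *)
Definition dual (P : osub W) : osub W :=
  OSub (dual_0 P) (@dual_D P) (@dual_Z P).

Record goodLattice := GoodLattice {
  gl_lattice :> lattice W;
  gl_sub1 : {subset oscale 1 (dual gl_lattice) <= gl_lattice};
  gl_sub2 : {subset gl_lattice <= dual gl_lattice}
}.

Variables (B : goodLattice) (n : nat).
Local Notation pi := (lf_unif k).
Local Notation Bd := (dual B).

Lemma gl_scale1 i x : x \in oscale (i + 1) Bd -> x \in oscale i B.
Proof.
by rewrite !in_oscale => h; apply: gl_sub1; rewrite in_oscale unifXD -opprD addrC.
Qed.
Lemma gl_scale2 i x : x \in oscale i B -> x \in oscale i Bd.
Proof. by rewrite !in_oscale; exact: gl_sub2. Qed.

Lemma oscale0 (P : osub W) x : (x \in oscale 0 P) = (x \in P).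
Proof. by rewrite in_oscale oppr0 expr0z scale1r. Qed.

(* the values of β on ϖ^i B* x ϖ^j B, ϖ^i B* x ϖ^j B* *)
Lemma form_dB i j x y : x \in oscale i Bd -> y \in oscale j B ->
  ss_form x y \in ppow k (lam + i + j).
Proof.
rewrite !in_oscale => /dualP/[apply]; rewrite wformZl wformZr !ppow_shift !opprK.
by rewrite addrAC addrC addrA [X in ppow _ X]addrC addrA.
Qed.
Lemma form_dd i j x y : x \in oscale i Bd -> y \in oscale j Bd ->
  ss_form x y \in ppow k (lam + i + j - 1).
Proof.
move=> hx hy; have : y \in oscale (j - 1) B by apply: gl_scale1; rewrite subrK.
by move/(form_dB hx); rewrite addrA.
Qed.
Lemma form_BB i j x y : x \in oscale i B -> y \in oscale j B ->
  ss_form x y \in ppow k (lam + i + j).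
Proof. by move=> /gl_scale2; exact: form_dB. Qed.

Lemma bn_sub : {subset oscale n.+1 Bd <= B}.
Proof.
move=> x hx; rewrite -oscale0; apply: gl_scale1.
by apply: oscale_sub hx; rewrite add0r.
Qed.
Lemma bn_fin : exists s : seq W, forall x, x \in B ->
  exists2 y, y \in s & x - y \in oscale n.+1 Bd.
Proof.
have [s hs] := lattice_cover B n.+1; exists s => x /hs[y ys hy].
by exists y => //; exact: gl_scale2.
Qed.
Lemma bn_ann x : x \in B -> pi ^ n.+1 *: x \in oscale n.+1 Bd.
Proof. by move=> xB; rewrite in_oscale_shift subrr oscale0; exact: gl_sub2. Qed.
Lemma bn_int : {in B &, forall x y, pi ^ (- lam) * ss_form x y \in ppow k 0}.
Proof.
move=> x y xB yB; rewrite ppow_shift sub0r opprK.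
by move/dualP: (gl_sub2 xB) => /(_ _ yB).
Qed.
Lemma bn_rad x y : x \in B -> y \in oscale n.+1 Bd ->
  pi ^ (- lam) * ss_form x y \in ppow k n.+1.
Proof.
rewrite -oscale0 => xB yQ; rewrite ppow_shift opprK wformC ppowN//.
by have := form_dB yQ xB; rewrite addr0 addrC.
Qed.

(* b_n = B / ϖ^(n+1) B*, with the form ϖ^(-λ) β mod ϖ^(n+1) *)
Definition bn_data : sqData W n := SqData bn_sub bn_fin bn_ann bn_int bn_rad.
Definition bn : altMod (On k n) := sqm bn_data.

Lemma bs_sub : {subset oscale n B <= Bd}.
Proof.
by move=> x hx; apply: gl_sub2; rewrite -oscale0; apply: oscale_sub hx.
Qed.
Lemma bs_fin : exists s : seq W, forall x, x \in Bd ->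
  exists2 y, y \in s & x - y \in oscale n B.
Proof.
have [s hs] := lattice_cover B n.+1.
exists [seq pi ^ (-1) *: y | y <- s] => x xB.
have [|y ys hy] := hs (pi ^ 1 *: x).
  by apply: gl_sub1; rewrite in_oscale unifXD addNr expr0z scale1r.
exists (pi ^ (-1) *: y); first by apply/mapP; exists y.
rewrite -[x](scale1r) -(expr0z pi) -(addNr 1) -unifXD -scalerBr.
by rewrite in_oscale_shift opprK -PoszD addn1.
Qed.
Lemma bs_ann x : x \in Bd -> pi ^ n.+1 *: x \in oscale n B.
Proof.
move=> xB; rewrite in_oscale_shift; apply: gl_scale1.
by rewrite intS opprD addrCA subrr addr0 addNr oscale0.
Qed.
Lemma bs_int : {in Bd &, forall x y, pi ^ (1 - lam) * ss_form x y \in ppow k 0}.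
Proof.
move=> x y; rewrite -(oscale0 Bd x) -(oscale0 Bd y) => xB yB.
rewrite ppow_shift sub0r opprB; by have := form_dd xB yB; rewrite !addr0.
Qed.
Lemma bs_rad x y : x \in Bd -> y \in oscale n B ->
  pi ^ (1 - lam) * ss_form x y \in ppow k n.+1.
Proof.
rewrite -oscale0 => xB yQ; rewrite ppow_shift.
have := form_dB xB yQ; congr (_ \in ppow k _); rewrite intS; ring.
Qed.

(* b*_n = B* / ϖ^n B, with the form ϖ^(1-λ) β mod ϖ^(n+1) *)
Definition bs_data : sqData W n := SqData bs_sub bs_fin bs_ann bs_int bs_rad.
Definition bs : altMod (On k n) := sqm bs_data.

(* With m = n./2: u is the image of ϖ^(m+1) B* if n = 2m and of ϖ^(m+1) B if
   n = 2m + 1; u* is that of ϖ^m B if n = 2m and of ϖ^(m+1) B* if n = 2m + 1. *)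
Definition u_osub : osub W :=
  if odd n then oscale n./2.+1 B else oscale n./2.+1 Bd.
Definition us_osub : osub W :=
  if odd n then oscale n./2.+1 Bd else oscale n./2 B.

Lemma n_odd : odd n -> n%:Z = 1 + n./2%:Z *+ 2.
Proof.
move=> on; rewrite -{1}(odd_double_half n) on PoszD -addnn PoszD mulr2n.
by [].
Qed.
Lemma n_even : odd n = false -> n%:Z = n./2%:Z *+ 2.
Proof. by move=> on; rewrite -{1}(odd_double_half n) on -addnn PoszD mulr2n. Qed.

Lemma u_sub : {subset u_osub <= B}.
Proof.
move=> x; rewrite /u_osub -(oscale0 B); case: ifP => _; first by apply: oscale_sub.
by move=> h; apply: gl_scale1; apply: oscale_sub h; rewrite add0r.
Qed.
Lemma u_iso : {in u_osub &, forall x y, pi ^ (- lam) * ss_form x y \in ppow k n.+1}.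
Proof.
move=> x y; rewrite /u_osub ppow_shift (intS n); case: ifP => [/n_odd|/n_even] -> hx hy.
  by have := form_BB hx hy; congr (_ \in ppow k _); rewrite !intS; ring.
have := form_dd hx hy; congr (_ \in ppow k _); rewrite !intS; ring.
Qed.
Lemma u_inv (g : Sp bn) : {in sqm_img bn_data u_osub, forall x, g x \in sqm_img bn_data u_osub}.
Proof.
have := @sqm_img_inv_im _ _ _ bn_data u_osub n./2.+1.
have := @sqm_img_inv_ker _ _ _ bn_data _ u_sub n./2.
move=> hker him; case on : (odd n); [apply: him|apply: hker] => x.
  by rewrite /u_osub on.
move=> xB; rewrite /u_osub on in_oscale_shift /=; congr (x \in oscale _ _).
by rewrite !intS (n_even on); ring.
Qed.
Definition u_n : invIso bn :=
  @InvIso _ bn (sqm_img bn_data u_osub) (sqm_img_submod (d := bn_data) u_sub)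
    (sqm_img_isotropic (d := bn_data) u_sub u_iso) u_inv.

Lemma us_sub : {subset us_osub <= Bd}.
Proof.
move=> x; rewrite /us_osub -(oscale0 Bd); case: ifP => _; first by apply: oscale_sub.
by move=> h; apply: gl_scale2; apply: oscale_sub h.
Qed.
Lemma us_iso :
  {in us_osub &, forall x y, pi ^ (1 - lam) * ss_form x y \in ppow k n.+1}.
Proof.
move=> x y; rewrite /us_osub ppow_shift (intS n); case: ifP => [/n_odd|/n_even] -> hx hy.
  by have := form_dd hx hy; congr (_ \in ppow k _); rewrite !intS; ring.
by have := form_BB hx hy; congr (_ \in ppow k _); ring.
Qed.
Lemma us_inv (g : Sp bs) : {in sqm_img bs_data us_osub, forall x, g x \in sqm_img bs_data us_osub}.
Proof.
have := @sqm_img_inv_im _ _ _ bs_data us_osub n./2.+1.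
have := @sqm_img_inv_ker _ _ _ bs_data _ us_sub n./2.
move=> hker him; case on : (odd n); [apply: him|apply: hker] => x.
  by rewrite /us_osub on.
move=> xB; rewrite /us_osub on in_oscale_shift /=; congr (x \in oscale _ _).
by rewrite (n_even on); ring.
Qed.
Definition us_n : invIso bs :=
  @InvIso _ bs (sqm_img bs_data us_osub) (sqm_img_submod (d := bs_data) us_sub)
    (sqm_img_isotropic (d := bs_data) us_sub us_iso) us_inv.

End Dual.

(* Main.v *)
(** The H(V)-module S is recovered from its U-fixed vectors: P being the
    projection onto them, v |-> (x |-> P rho(x,0) v) identifies S with
    S^{U,sigma} for sigma the action on the fixed vectors, and in any model
    S^{U,sigma'} the U-fixed functions are those supported on U^perp, so that
    evaluation at 0 recovers sigma'.

    An operator T on S is the combination of the rho(v), v in V, whose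
    coefficient c_v is the scalar obtained by averaging T rho(-v) over H(V).  If
    T commutes with Sp(V), then v |-> c_v is constant on orbits; hence the
    commutant of Sp(V) has dimension at most the number of orbits in V.  The
    representations in (D) are nonzero direct summands of S^{U,sigma}, so they
    are irreducible and pairwise inequivalent as soon as there are at least as
    many of them as there are orbits.

    The orbits are the differences of consecutive terms of the chain
    P > pi P' > pi P > pi^2 P' > ... > pi^(n+1) P', where P = B and P' = dual B
    in case (i), P = dual B and P' = pi^(-1) B in case (ii): transvections act
    transitively on them.
    The orthogonal of the j-th term is the (2n+1-j)-th one, U is the (n+1)-st
    and U^perp the n-th, so both counts can be made. *)

From Pilot Require Import Defs.
From HB Require Import structures.
From mathcomp Require Import all_boot all_order all_algebra all_fingroup.
From mathcomp Require Import boolp classical_sets reals topology complex.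
From mathcomp Require Import ring zify.

Set Implicit Arguments.
Unset Strict Implicit.
Unset Printing Implicit Defensive.

Import Order.TTheory GRing.Theory Num.Theory.
Local Open Scope ring_scope.
(* [subspace], [formDl] and other names of Defs are shadowed by the imports above. *)
Import Pilot.Defs.

(** * Linear algebra and Schur's lemma *)

(** Two choices shape the argument. That the model of $S^{U,\sigma}$ is irreducible under the
    Heisenberg group and satisfies the Weil relations is not computed in the model but transported
    from [S] along the isomorphism. And the summands are not added up to the whole space: for each
    one a map from the model and a section of it are written down, with vanishing cross terms. The
    resulting idempotents together with one more commuting operator outnumber the operators spanning
    the commutant, so a linear relation expresses that operator through the idempotents. Hence the
    same number must be reached twice: all levels of the chain bound the commutant, while those
    below [n] count the summands.

    Arithmetic enters in the transitivity on a level. A transvection taking x to y has a coefficient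
    with the pairing of x and y in its denominator, so this pairing must have the least valuation
    that the level permits. Suitable partners exist because each lattice of the pair is exactly the
    dual of the other; one half of this is double duality, drawn from compactness and openness. *)

Section LinearAlgebra.
Variable C : fieldType.

(** The operators of a [repn] are meaningful only on [rp_space], so linearity is relative to a set
    of vectors. *)
Definition lin_on (E E' : lmodType C) (A : set E) (f : E -> E') : Prop :=
  forall (a : C) u v, A u -> A v -> f (a *: u + v) = a *: f u + f v.

Lemma subspaceD (E : lmodType C) (A : set E) u v :
  subspace A -> A u -> A v -> A (u + v).
Proof. by move=> [_ h] Au Av; rewrite -[u]scale1r; apply: h. Qed.

Lemma subspaceZ (E : lmodType C) (A : set E) a u : subspace A -> A u -> A (a *: u).
Proof. by move=> [A0 h] Au; rewrite -[_ *: _]addr0; apply: h. Qed.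

Lemma subspace_sum (E : lmodType C) (A : set E) (I : Type) (r : seq I)
    (P : pred I) (f : I -> E) :
  subspace A -> (forall i, P i -> A (f i)) -> A (\sum_(i <- r | P i) f i).
Proof.
by move=> sA h; elim/big_ind: _ => //; [case: sA | move=> *; exact: subspaceD].
Qed.

Section LinOn.
Variables (E E' : lmodType C) (A : set E) (f : E -> E').
Hypotheses (sA : subspace A) (hf : lin_on A f).

Lemma lin_on0 : f 0 = 0.
Proof.
have A0 := sA.1; have := hf (-1) A0 A0.
by rewrite scaler0 addr0 scaleN1r addNr.
Qed.

Lemma lin_onD u v : A u -> A v -> f (u + v) = f u + f v.
Proof. by move=> Au Av; have := hf 1 Au Av; rewrite !scale1r. Qed.

Lemma lin_onZ a u : A u -> f (a *: u) = a *: f u.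
Proof. by move=> Au; have := hf a Au sA.1; rewrite lin_on0 !addr0. Qed.

Lemma lin_on_sum (I : Type) (r : seq I) (P : pred I) (u : I -> E) :
  (forall i, P i -> A (u i)) ->
  f (\sum_(i <- r | P i) u i) = \sum_(i <- r | P i) f (u i).
Proof.
move=> h; elim: r => [|i r IH]; first by rewrite !big_nil lin_on0.
rewrite !big_cons; case: ifP => // Pi; rewrite lin_onD ?IH//; first exact: h.
exact: subspace_sum.
Qed.
End LinOn.

Variable E : vectType C.

(** A [vspace] of maximal dimension inside [A] is all of [A], since a missing vector would enlarge
    it. *)
Lemma subspace_vspace (A : set E) : subspace A ->
  exists U : {vspace E}, forall v, A v <-> v \in U.
Proof.
move=> sA.
pose P d := `[< exists2 U : {vspace E}, \dim U = d & forall v, v \in U -> A v >].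
have exP : exists d, P d.
  exists 0%N; apply/asboolP; exists 0%VS; first by rewrite dimv0.
  by move=> v; rewrite memv0 => /eqP ->; case: sA.
have ubP d : P d -> (d <= \dim {:E})%N.
  by move=> /asboolP[U <- _]; rewrite dimvS ?subvf.
case: (ex_maxnP exP ubP) => d /asboolP[U dU UA] maxd; exists U => v; split=> [Av|/UA//].
apply: contraT => vU; suff /maxd : P (\dim (U + <[v]>)%VS).
  rewrite leqNgt -dU ltn_neqAle dimvS ?addvSl// andbT negbK => /eqP dE.
  case/negP: vU; have /eqP -> : (U == U + <[v]>)%VS by rewrite eqEdim addvSl dE leqnn.
  by apply: subvP (addvSr _ _) _ (memv_line v).
apply/asboolP; eexists; first by [].
move=> w /memv_addP[u uU [x /vlineP[a ->] ->]].
by rewrite addrC; case: sA => _; apply => //; exact: UA.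
Qed.

(** Composing with a projection onto the subspace gives a genuine ['Hom], the form in which
    [repn_iso] and [weil_iso] want their maps. *)
Lemma lin_on_extend (E' : vectType C) (A : set E) (f : E -> E') :
  subspace A -> lin_on A f -> exists h : 'Hom(E, E'), forall v, A v -> h v = f v.
Proof.
move=> sA hf; have [U hU] := subspace_vspace sA.
pose g v := f (projv U v).
have gl : linear g.
  by move=> a u v; rewrite /g linearP hf// hU memv_proj.
pose gL := GRing.isLinear.Build C E E' _ g gl.
pose gl' : {linear E -> E'} := HB.pack g gL.
by exists (linfun gl') => v /hU vU; rewrite lfunE /= /g projv_id.
Qed.
End LinearAlgebra.

Lemma eigenvector_on (C : numClosedFieldType) (E : vectType C) (A : set E) (f : E -> E) :
  subspace A -> lin_on A f -> (forall v, A v -> A (f v)) -> A <> [set 0]%classic ->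
  exists (a : C) v, [/\ A v, v != 0 & f v = a *: v].
Proof.
move=> sA hf fA A0; have [U hU] := subspace_vspace sA.
have dU : (0 < \dim U)%N.
  rewrite lt0n dimv_eq0; apply/eqP => U0; apply: A0; apply/seteqP; split=> v /=.
    by move/hU; rewrite U0 memv0 => /eqP.
  by move=> ->; exact: sA.1.
pose b := vbasis U.
have bb : basis_of U b := vbasisP U.
have bA i : A b`_i.
  apply/hU; case: (ltnP i (\dim U)) => hi; first by rewrite vbasis_mem// mem_nth ?size_tuple.
  by rewrite nth_default ?size_tuple// mem0v.
pose M : 'M_(\dim U) := \matrix_(i, j) coord b j (f b`_i).
have [a /eigenvalueP[x hx x0]] := spectral.eigenvalue_closed M dU.
pose v := \sum_i x 0 i *: b`_i.
have Av : A v by apply: subspace_sum => // i _; apply: subspaceZ.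
exists a, v; split => //.
  apply: contra x0 => /eqP v0; apply/eqP/rowP => i; rewrite mxE.
  have /freeP := basis_free bb; apply; exact: v0.
rewrite /v (lin_on_sum sA hf); last by move=> i _; exact: subspaceZ.
transitivity (\sum_j (x *m M) 0 j *: b`_j); last first.
  by rewrite hx scaler_sumr; apply: eq_bigr => j _; rewrite mxE scalerA.
under [RHS]eq_bigr do rewrite mxE scaler_suml.
rewrite exchange_big /=; apply: eq_bigr => i _; rewrite (lin_onZ sA hf)//.
rewrite {1}(coord_basis bb (v := f b`_i)); last by apply/hU/fA.
by rewrite scaler_sumr; apply: eq_bigr => j _; rewrite scalerA mxE.
Qed.

(** A matrix with more rows than columns has a nonzero left kernel vector. The rows will be
    coordinates of operators in a spanning family. *)
Lemma linear_relation (C : fieldType) (I J : finType) (P : pred I) (M : I -> J -> C) :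
  (#|J| < #|P|)%N ->
  exists c : I -> C, (exists2 i, P i & c i != 0) /\
    forall j, \sum_(i | P i) c i * M i j = 0.
Proof.
move=> cJ; pose A : 'M[C]_(#|P|, #|J|) := \matrix_(i, j) M (enum_val i) (enum_val j).
have : kermx A != 0.
  by rewrite kermx_eq0 /row_free neq_ltn (leq_ltn_trans (rank_leq_col _)).
case/rowV0Pn => x /sub_kermxP xA x0.
have [i xi] : exists i, x 0 i != 0.
  apply: contrapT => h; case/negP: x0; apply/eqP/rowP => i; rewrite mxE.
  by apply/eqP; apply: contrapT => /negP xi; apply: h; exists i.
have Pi := enum_valP i.
exists (fun y => x 0 (enum_rank_in Pi y)); split.
  by exists (enum_val i) => //; rewrite enum_valK_in.
move=> j; have := congr1 (fun B : 'rV_#|J| => B 0 (enum_rank j)) xA; rewrite !mxE => {2}<-.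
rewrite (big_enum_val (A := P)) /=; apply: eq_bigr => l _.
by rewrite enum_valK_in mxE enum_rankK.
Qed.

Section Schur.
Variables (C : numClosedFieldType) (gT : finGroupType) (r : repn C gT).

Lemma irreducible_nonzero : irreducible r -> exists2 v, rp_space r v & v != 0.
Proof.
move=> [[sA _ _ _ _] n0 _]; apply: contrapT => h; apply: n0; apply/seteqP; split=> v.
  by move=> rv; apply/eqP; apply: contrapT => /negP v0; apply: h; exists v.
by move=> ->; exact: sA.1.
Qed.

Lemma schur (f : rp_sort r -> rp_sort r) : irreducible r ->
  lin_on (rp_space r) f -> (forall v, rp_space r v -> rp_space r (f v)) ->
  (forall g v, rp_space r v -> f (rp_op r g v) = rp_op r g (f v)) ->
  exists a, forall v, rp_space r v -> f v = a *: v.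
Proof.
move=> [[sA st li _ _] n0 irr] hf fA fG.
have [a [v [Av v0 fv]]] := eigenvector_on sA hf fA n0.
exists a; pose A := [set w | rp_space r w /\ f w = a *: w]%classic.
have [|||A0|AE] := irr A.
- split=> [|b u w [Au fu] [Aw fw]]; first by split; [exact: sA.1|rewrite (lin_on0 sA hf) scaler0].
  split; first exact: sA.2.
  by rewrite hf// fu fw scalerDr !scalerA mulrC.
- by move=> w [].
- move=> g w [Aw fw]; split; first exact: st.
  by rewrite fG// fw (lin_onZ sA (li g)).
- by have : A v by []; rewrite A0 => /= v0'; rewrite v0' eqxx in v0.
- by move=> w; rewrite -AE => -[].
Qed.

Lemma maschke (A : set (rp_sort r)) : is_repn r -> subspace A ->
  (forall v, A v -> rp_space r v) -> (forall g v, A v -> A (rp_op r g v)) ->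
  exists p : rp_sort r -> rp_sort r,
  [/\ lin_on (rp_space r) p, forall v, rp_space r v -> A (p v),
      forall v, A v -> p v = v
    & forall g v, rp_space r v -> p (rp_op r g v) = rp_op r g (p v)].
Proof.
move=> [sr st li r1 rM] sA Ar AG; have [U hU] := subspace_vspace sA.
pose q v := projv U v; have qA v : A (q v) by apply/hU; exact: memv_proj.
have qid v : A v -> q v = v by move=> /hU; exact: projv_id.
pose N : C := #|gT|%:R.
have N0 : N != 0 by rewrite pnatr_eq0 -lt0n; apply/card_gt0P; exists 1%g.
pose p v := N^-1 *: \sum_(g : gT) rp_op r g (q (rp_op r g^-1%g v)).
exists p; split.
- move=> a u v ru rv; rewrite /p scalerA mulrC -scalerA -scalerDr; congr (_ *: _).
  rewrite scaler_sumr -big_split; apply: eq_bigr => g _.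
  by rewrite li// /q linearP /= li//; apply: Ar; exact: qA.
- by move=> v rv; apply: subspaceZ => //; apply: subspace_sum => // g _; exact: AG.
- move=> v Av; rewrite /p (eq_bigr (fun=> v)) => [|g _].
    by rewrite sumr_const -scaler_nat scalerA mulVf ?scale1r.
  by rewrite qid; [rewrite -rM ?mulgV ?r1//; exact: Ar|exact: AG].
- move=> g v rv; rewrite /p (lin_onZ sr (li g)); last first.
    by apply: Ar; apply: subspace_sum => // h _; exact: AG.
  congr (_ *: _); rewrite (lin_on_sum sr (li g)); last by move=> h _; apply/Ar/AG.
  rewrite (reindex_inj (mulgI g)) /=; apply: eq_bigr => h _.
  rewrite invMg -(rM (h^-1 * g^-1)%g g)// -mulgA mulVg mulg1 rM//.
  by apply: Ar.
Qed.
End Schur.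

(** * Summands of a representation with a small commutant *)

Section Intertwiners.
Variables (C : numClosedFieldType) (gT : finGroupType).
Implicit Types r : repn C gT.

Definition intertwiner r1 r2 (f : rp_sort r1 -> rp_sort r2) : Prop :=
  [/\ lin_on (rp_space r1) f, forall v, rp_space r1 v -> rp_space r2 (f v)
    & forall g v, rp_space r1 v -> f (rp_op r1 g v) = rp_op r2 g (f v)].

Lemma intertwiner_comp r1 r2 r3 (f : rp_sort r1 -> rp_sort r2)
    (h : rp_sort r2 -> rp_sort r3) :
  intertwiner f -> intertwiner h -> @intertwiner r1 r3 (h \o f).
Proof.
move=> [fl fs fG] [hl hs hG]; split.
- by move=> a u v ru rv; rewrite /comp fl// hl//; apply: fs.
- by move=> v /fs/hs.
- by move=> g v rv; rewrite /comp fG ?hG//; exact: fs.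
Qed.

Variables (M : repn C gT) (J K : finType) (D : {set K}) (r : K -> repn C gT).
Variables (s : J -> rp_sort M -> rp_sort M).
Hypothesis hM : is_repn M.
Hypothesis commutant_span : forall T : rp_sort M -> rp_sort M, intertwiner T ->
  exists c : J -> C, forall v, rp_space M v -> T v = \sum_j c j *: s j v.
Hypothesis cardJ : (#|J| <= #|D|)%N.
Variables (Phi : forall i, rp_sort M -> rp_sort (r i))
          (Psi : forall i, rp_sort (r i) -> rp_sort M).
Hypothesis r_repn : {in D, forall i, is_repn (r i)}.
Hypothesis r_nz : {in D, forall i, exists2 v, rp_space (r i) v & v != 0}.
Hypothesis PhiP : {in D, forall i, intertwiner (Phi i)}.
Hypothesis PsiP : {in D, forall i, @intertwiner (r i) M (@Psi i)}.
Hypothesis PhiPsi : {in D, forall i v, rp_space (r i) v -> Phi i (Psi v) = v}.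
Hypothesis PhiPsi0 : {in D &, forall i j, i != j ->
  forall v : rp_sort (r i), rp_space (r i) v -> Phi j (Psi v) = 0}.

(** The [#|D|] idempotents [Psi \o Phi i] and [T] lie in the span of at most [#|D|] operators, so
    they are dependent; the idempotents alone are independent, so the relation can be solved for
    [T]. *)
Lemma commutant_diagonal (T : rp_sort M -> rp_sort M) : intertwiner T ->
  exists c : K -> C, forall v, rp_space M v ->
    T v = \sum_(i in D) c i *: Psi (Phi i v).
Proof.
move=> hT; pose X (o : option K) := if o is Some i then @Psi i \o Phi i else T.
pose P (o : option K) := if o is Some i then i \in D else true.
have XP o : P o -> exists c : J -> C, forall v, rp_space M v -> X o v = \sum_j c j *: s j v.
  case: o => [i|_] /=; last exact: commutant_span.
  move=> iD; apply: commutant_span.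
  by apply: (intertwiner_comp (PhiP iD)); exact: PsiP.
have /choice[m hm] o : exists c : J -> C, P o -> forall v, rp_space M v -> X o v = \sum_j c j *: s j v.
  by case Po : (P o); [have [c hc] := XP _ Po; exists c|exists (fun=> 0)].
have cP : (#|J| < #|P|)%N.
  apply: leq_ltn_trans cardJ _; rewrite -(card_imset _ Some_inj).
  have /subset_leq_card : None |: [set Some i | i in D]%SET \subset P.
    apply/fintype.subsetP => o; rewrite in_setU1 => /orP[/eqP ->//|/imsetP[i iD ->]].
    exact: iD.
  by rewrite cardsU1; case: imsetP => [[]//|_]; rewrite add1n.
have [c [[o Po co] hc]] := linear_relation m cP.
have rel v : rp_space M v -> \sum_(o | P o) c o *: X o v = 0.
  move=> Mv; rewrite (eq_bigr (fun o => \sum_j (c o * m o j) *: s j v)).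
    by rewrite exchange_big big1 // => j _; rewrite -scaler_suml hc scale0r.
  by move=> o' Po'; rewrite hm// scaler_sumr; apply: eq_bigr => j _; rewrite scalerA.
have relE v : rp_space M v ->
    c None *: T v + \sum_(i in D) c (Some i) *: Psi (Phi i v) = 0.
  move=> /rel; rewrite (bigD1 None)//= (reindex_omap Some id) /=; last by case.
  by congr (_ + _ = _); apply: eq_bigl => i; rewrite eqxx !andbT.
(* If [T] had coefficient 0, the relation evaluated on [Psi v] with [v] in [r i] would keep only the
   term of [i] and kill its coefficient. *)
have c0 : c None != 0.
  apply: contra_neq co => cN; case: o Po => [i /= iD|_//].
  have [v rv v0] := r_nz iD; have [_ sPsi _] := PsiP iD.
  have := relE _ (sPsi _ rv); rewrite cN scale0r add0r.
  rewrite (bigD1 i)//= big1 ?addr0 => [|j /andP[jD ji]]; last first.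
    rewrite PhiPsi0// 1?eq_sym//; have [lj _ _] := PsiP jD.
    by have [sj _ _ _ _] := r_repn jD; rewrite (lin_on0 sj lj) scaler0.
  rewrite PhiPsi// => /(congr1 (Phi i)).
  have [lPhi _ _] := PhiP iD; have [sM _ _ _ _] := hM.
  rewrite (lin_onZ sM lPhi _ (sPsi _ rv)) PhiPsi// (lin_on0 sM lPhi) => /eqP.
  by rewrite scaler_eq0 (negPf v0) orbF => /eqP.
exists (fun i => - (c None)^-1 * c (Some i)) => v /relE/eqP.
rewrite addr_eq0 => /eqP/(congr1 (fun x => (c None)^-1 *: x)).
rewrite scalerA mulVf// scale1r scalerN -scaleNr scaler_sumr => ->.
by apply: eq_bigr => i _; rewrite scalerA.
Qed.

Section Hom.
Variables (i j : K) (iD : i \in D) (jD : j \in D) (f : rp_sort (r i) -> rp_sort (r j)).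
Hypothesis hf : intertwiner f.

(** Moved to [M] as [Psi \o f \o Phi i], the intertwiner is a combination of idempotents, of which
    only the [i]-th survives on the image of [r i]. *)
Let eqn : exists c : K -> C, forall v, rp_space (r i) v -> Psi (f v) = c i *: Psi v.
Proof.
have hT := intertwiner_comp (intertwiner_comp (PhiP iD) hf) (PsiP jD).
have [c hc] := commutant_diagonal hT; exists c => v rv.
have [_ sPsi _] := PsiP iD.
have := hc _ (sPsi _ rv); rewrite /comp PhiPsi// => ->.
rewrite (bigD1 i)//= PhiPsi// big1 ?addr0// => l /andP[lD li].
rewrite PhiPsi0// 1?eq_sym//; have [lj _ _] := PsiP lD.
by have [sj _ _ _ _] := r_repn lD; rewrite (lin_on0 sj lj) scaler0.
Qed.

Lemma hom_distinct : i != j -> forall v, rp_space (r i) v -> f v = 0.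
Proof.
move=> ij v rv; have [c hc] := eqn; have := congr1 (Phi j) (hc _ rv).
have [lPhi _ _] := PhiP jD; have [sM _ _ _ _] := hM; have [_ sPsi _] := PsiP iD.
rewrite (lin_onZ sM lPhi _ (sPsi _ rv)) (PhiPsi0 iD jD ij rv) scaler0 PhiPsi//.
by have [_ sf _] := hf; exact: sf.
Qed.
End Hom.

Lemma hom_scalar i (f : rp_sort (r i) -> rp_sort (r i)) : i \in D -> intertwiner f ->
  exists a, forall v, rp_space (r i) v -> f v = a *: v.
Proof.
move=> iD hf.
have hT := intertwiner_comp (intertwiner_comp (PhiP iD) hf) (PsiP iD).
have [c hc] := commutant_diagonal hT; exists (c i) => v rv.
have [_ sPsi _] := PsiP iD; have [_ sf _] := hf.
have [lPhi _ _] := PhiP iD; have [sM _ _ _ _] := hM.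
have := congr1 (Phi i) (hc _ (sPsi _ rv)); rewrite /comp !PhiPsi//; last exact: sf.
rewrite (bigD1 i)//= PhiPsi// big1 ?addr0 => [|l /andP[lD li]].
  by rewrite (lin_onZ sM lPhi _ (sPsi _ rv)) PhiPsi.
rewrite PhiPsi0// 1?eq_sym//; have [lj _ _] := PsiP lD.
by have [sj _ _ _ _] := r_repn lD; rewrite (lin_on0 sj lj) scaler0.
Qed.

(** By Maschke a stable subspace is the image of an equivariant projection. This is a scalar, equal
    to 1 as soon as it fixes a nonzero vector. *)
Lemma summands_irreducible : {in D, forall i, irreducible (r i)}.
Proof.
move=> i iD; split; first exact: r_repn.
  by have [v rv v0] := r_nz iD; move=> h; move: rv v0; rewrite h => ->; rewrite eqxx.
move=> A sA Ar AG; have [p [pl pA pid pG]] := maschke (r_repn iD) sA Ar AG.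
have [|a ha] := hom_scalar iD (f := p); first by split => // v rv; exact/Ar/pA.
have [hA|hA] := pselect (exists2 v, A v & v != 0); [right|left].
  have [v Av v0] := hA; have := ha _ (Ar _ Av); rewrite pid// => /esym/eqP.
  rewrite -subr_eq0 -[X in _ - X]scale1r -scalerBl scaler_eq0 (negPf v0) orbF subr_eq0 => /eqP a1.
  apply/seteqP; split=> // w rw; have := ha _ rw; rewrite a1 scale1r => <-.
  exact: pA.
apply/seteqP; split=> v; last by move=> ->; exact: sA.1.
by move=> Av; apply/eqP; apply: contrapT => /negP v0; apply: hA; exists v.
Qed.

Lemma summands_distinct : {in D &, forall i j, i != j -> ~ repn_iso (r i) (r j)}.
Proof.
move=> i j iD jD ij [f [fS fI fG]].
have [v rv v0] := r_nz iD; have [[r0 _] _ _ _ _] := r_repn iD.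
have hf : intertwiner f.
  split=> //; first by move=> a u w _ _; rewrite linearP.
  by move=> w rw; rewrite -fS; exists w.
have := hom_distinct iD jD hf ij rv; rewrite -(linear0 f) => /fI => /(_ _ _)/eqP.
by rewrite (negPf v0) !inE => /(_ rv r0).
Qed.
End Intertwiners.

(** * Heisenberg operators and the commutant of Sp(V) *)

Lemma perm_invE (F : finComUnitRingType) (V : altMod F) (g : Sp V) x : g (g^-1%g x) = x.
Proof. exact: permKV. Qed.
Lemma perm_invK (F : finComUnitRingType) (V : altMod F) (g : Sp V) x : g^-1%g (g x) = x.
Proof. exact: permK. Qed.
Lemma sp_mulE (F : finComUnitRingType) (V : altMod F) (g h : Sp V) x : (g * h)%g x = g (h x).
Proof. exact: permM. Qed.
Lemma sp_oppE (F : finComUnitRingType) (V : altMod F) x : sp_opp V x = - x.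
Proof. exact: permE. Qed.
Lemma sp_1E (F : finComUnitRingType) (V : altMod F) x : (1%g : Sp V) x = x.
Proof. exact: perm1. Qed.
Lemma sp_D (F : finComUnitRingType) (V : altMod F) (g : Sp V) x y : g (x + y) = g x + g y.
Proof. by have := sp_lin g 1 x y; rewrite !scale1r. Qed.
Lemma sp_N (F : finComUnitRingType) (V : altMod F) (g : Sp V) x : g (- x) = - g x.
Proof. by rewrite -scaleN1r sp_scale scaleN1r. Qed.

Lemma formBr (F : finComUnitRingType) (V : altMod F) (x y z : V) :
  am_form x (y - z) = am_form x y - am_form x z.
Proof. by rewrite formDr formNr. Qed.
Lemma formBl (F : finComUnitRingType) (V : altMod F) (x y z : V) :
  am_form (x - y) z = am_form x z - am_form y z.
Proof. by rewrite formDl formNl. Qed.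

Lemma heis_mulE (F : finComUnitRingType) (V : altMod F) (h k : heis V) :
  (h * k)%g = (h.1 + k.1, h.2 + k.2 + 2%:R^-1 * am_form h.1 k.1).
Proof. by []. Qed.
Lemma heis_invE (F : finComUnitRingType) (V : altMod F) (h : heis V) :
  (h^-1)%g = (- h.1, - h.2).
Proof. by []. Qed.

(** * Sums of a primitive character *)

Section CharacterSums.
Variables (C : numClosedFieldType) (F : finComUnitRingType) (psi : F -> C).
Hypothesis psi_prim : primitive_char psi.
Variable V : altMod F.

Lemma psi0 : psi 0 = 1. Proof. by case: psi_prim. Qed.
Lemma psiD s t : psi (s + t) = psi s * psi t. Proof. by case: psi_prim. Qed.
Lemma psiN s : psi s * psi (- s) = 1. Proof. by rewrite -psiD subrr psi0. Qed.

Section Sum.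
Variables (A : {set V}) (z : V).
Hypothesis sA : submod_closed A.

(** Primitivity speaks of ideals, and the values [am_form u z] for [u] in a submodule form one. *)
Lemma primitive_form : {in A, forall u, psi (am_form u z) = 1} ->
  {in A, forall u, am_form u z = 0}.
Proof.
move=> h u uA; pose I := [set am_form w z | w in A]%SET.
have : I = [set 0]%SET.
  case: psi_prim => _ _; apply.
  - by apply/imsetP; exists 0; rewrite ?form0l//; case: sA.
  - move=> _ _ /imsetP[x xA ->] /imsetP[y yA ->]; rewrite -formDl.
    by apply: imset_f; rewrite -[x]scale1r; apply: sA.2.
  - move=> a _ /imsetP[x xA ->]; rewrite -formZl; apply: imset_f.
    by rewrite -[_ *: _]addr0; apply: sA.2 => //; exact: sA.1.
  - by move=> _ /imsetP[x xA ->]; exact: h.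
by move=> IE; have := imset_f (fun w => am_form w z) uA; rewrite -/I IE => /set1P.
Qed.

Lemma psi_sum_nontriv u : u \in A -> am_form u z != 0 ->
  \sum_(u in A) psi (am_form u z) = 0.
Proof.
move=> uA uz.
have [w wA hw] : exists2 w, w \in A & psi (am_form w z) != 1.
  apply: contrapT => h; case/eqP: uz; apply: primitive_form uA => w wA.
  by apply/eqP; apply: contrapT => /negP hw; apply: h; exists w.
set s := \sum_(_ in _) _; have : psi (am_form w z) * s = s.
  rewrite {2}/s (reindex_inj (addrI w)) mulr_sumr /=; apply: eq_big => [x|x _].
    apply/idP/idP => h; first by rewrite -[w]scale1r; apply: sA.2.
    by rewrite -[x](addKr w) -scaleN1r; apply: sA.2.
  by rewrite formDl psiD.
move/eqP; rewrite -subr_eq0 -{2}[s]mul1r -mulrBl mulf_eq0 subr_eq0 (negPf hw).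
by move/eqP.
Qed.
End Sum.

Lemma psi_sum_full y : (forall x : V, (forall y, am_form y x = 0) -> x = 0) ->
  \sum_(x : V) psi (am_form x y) = if y == 0 then #|V|%:R else 0.
Proof.
move=> nondeg; have [->|y0] := eqVneq y 0.
  by under eq_bigr do rewrite form0r psi0; rewrite sumr_const cardT.
have [u uy] : exists u : V, am_form u y != 0.
  apply: contrapT => h; case/eqP: y0; apply: nondeg => u; apply/eqP.
  by apply: contrapT => /negP h'; apply: h; exists u.
rewrite -(eq_bigl _ _ (fun u => finset.in_setT u)).
apply: (psi_sum_nontriv _ (finset.in_setT u) uy).
by split=> [|a x z _ _]; exact: finset.in_setT.
Qed.
End CharacterSums.

Lemma halfD (F : finComUnitRingType) (a : F) : (2%:R : F) \is a GRing.unit ->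
  2%:R^-1 * a + 2%:R^-1 * a = a.
Proof. by move=> h; rewrite -mulrDr -mulr2n -[a *+ 2]mulr_natl mulKr. Qed.

Section HeisenbergOps.
Variables (C : numClosedFieldType) (F : finComUnitRingType) (psi : F -> C).
Hypothesis psi_prim : primitive_char psi.
Variables (V : altMod F) (gT : finGroupType) (gamma : gT -> Sp V).
Variable S : weilRep C V gT.

(** [is_weil] stripped of irreducibility and unitarity: enough for calculating with operators, and
    carried along [weil_iso] to the model. *)
Definition weil_core : Prop :=
  [/\ is_repn (heis_repn S),
      forall t v, wr_space S v -> wr_heis S (0, t) v = psi t *: v,
      is_repn (grp_repn S)
    & forall g h v, wr_space S v ->
        wr_grp S g (wr_heis S h (wr_grp S g^-1%g v)) =
        wr_heis S (sp_heis (gamma g) h) v].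

Hypothesis hS : weil_core.
Local Notation E := (wr_space S).
Local Notation rho := (wr_heis S).
Local Notation sg := (wr_grp S).

Lemma wspace : subspace E. Proof. by case: hS => -[]. Qed.
Lemma rho_in h v : E v -> E (rho h v).
Proof. by case: hS => -[_ h1 _ _ _] _ _ _; exact: h1. Qed.
Lemma rho_lin h : lin_on E (rho h).
Proof. by case: hS => -[_ _ h1 _ _] _ _ _; exact: h1. Qed.
Lemma rho_M h k v : E v -> rho h (rho k v) = rho (h * k)%g v.
Proof. by case: hS => -[_ _ _ _ h1] _ _ _ Ev; exact/esym/h1. Qed.
Lemma sg_in g v : E v -> E (sg g v).
Proof. by case: hS => _ _ [_ h1 _ _ _] _; exact: h1. Qed.
Lemma sg_lin g : lin_on E (sg g).
Proof. by case: hS => _ _ [_ _ h1 _ _] _; exact: h1. Qed.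
Lemma sg_1 v : E v -> sg 1%g v = v.
Proof. by case: hS => _ _ [_ _ _ h1 _] _; exact: h1. Qed.
Lemma sg_M g h v : E v -> sg g (sg h v) = sg (g * h)%g v.
Proof. by case: hS => _ _ [_ _ _ _ h1] _ Ev; exact/esym/h1. Qed.
Lemma rhoE w t v : E v -> rho (w, t) v = psi t *: rho (w, 0) v.
Proof.
case: hS => _ h1 _ _ Ev; rewrite -h1 ?rho_M//; last exact: rho_in.
by congr (rho _ v); rewrite heis_mulE /= form0l mulr0 !add0r !addr0.
Qed.
Lemma rho_0 v : E v -> rho (0, 0) v = v.
Proof. by case: hS => _ h1 _ _ Ev; rewrite h1// psi0// scale1r. Qed.
Lemma rhoD x y t s v : E v ->
  rho (x, t) (rho (y, s) v) = psi (t + s + 2%:R^-1 * am_form x y) *: rho (x + y, 0) v.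
Proof. by move=> Ev; rewrite rho_M// heis_mulE /= rhoE. Qed.
Lemma sg_rho g x t v : E v -> sg g (rho (x, t) v) = rho (gamma g x, t) (sg g v).
Proof.
case: hS => _ _ _ h Ev; rewrite -[X in sg g (rho _ X)]sg_1// -(mulVg g) -sg_M//.
by rewrite h//; exact: sg_in.
Qed.
Lemma sg_K g v : E v -> sg g (sg g^-1%g v) = v.
Proof. by move=> Ev; rewrite sg_M// mulgV sg_1. Qed.
Lemma sg_KV g v : E v -> sg g^-1%g (sg g v) = v.
Proof. by move=> Ev; rewrite sg_M// mulVg sg_1. Qed.
Lemma rho_Z h a v : E v -> rho h (a *: v) = a *: rho h v.
Proof. by move=> Ev; rewrite (lin_onZ wspace (@rho_lin h)). Qed.
Lemma sg_Z g a v : E v -> sg g (a *: v) = a *: sg g v.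
Proof. by move=> Ev; rewrite (lin_onZ wspace (@sg_lin g)). Qed.
Lemma space_Z a v : E v -> E (a *: v). Proof. exact: subspaceZ wspace. Qed.

Lemma rho_sum h (I : finType) (P : pred I) (u : I -> wr_sort S) :
  (forall i, P i -> E (u i)) -> rho h (\sum_(i | P i) u i) = \sum_(i | P i) rho h (u i).
Proof. exact: (lin_on_sum wspace (@rho_lin h)). Qed.
Lemma sg_sum g (I : finType) (P : pred I) (u : I -> wr_sort S) :
  (forall i, P i -> E (u i)) -> sg g (\sum_(i | P i) u i) = \sum_(i | P i) sg g (u i).
Proof. exact: (lin_on_sum wspace (@sg_lin g)). Qed.

End HeisenbergOps.

Section Commutant.
Variables (C : numClosedFieldType) (F : finComUnitRingType) (psi : F -> C).
Hypothesis psi_prim : primitive_char psi.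
Variables (V : altMod F) (gT : finGroupType) (gamma : gT -> Sp V).
Hypothesis two_unit : (2%:R : F) \is a GRing.unit.
Hypothesis nondeg : forall x : V, (forall y, am_form y x = 0) -> x = 0.
Variable S : weilRep C V gT.
Hypothesis hS : weil_core psi gamma S.
Hypothesis irrS : irreducible (heis_repn S).
Variable T : wr_sort S -> wr_sort S.
Hypothesis hT : @intertwiner _ _ (grp_repn S) (grp_repn S) T.
Local Notation E := (wr_space S).
Local Notation rho := (wr_heis S).
Local Notation sg := (wr_grp S).

Let sE := wspace hS.
Let T_lin : lin_on E T. Proof. by case: hT. Qed.
Let T_in v : E v -> E (T v). Proof. by case: hT => _ h _; exact: h. Qed.
Let T_sg g v : E v -> T (sg g v) = sg g (T v). Proof. by case: hT => _ _ h; exact: h. Qed.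

(* Averaging T rho(-x) over the Heisenberg group produces a scalar, which is
   the coefficient of rho(x) in T. *)
Let avg (x : V) v := \sum_(h : heis V) rho h (T (rho (- x, 0) (rho h^-1%g v))).

Let avg_term_in x h v : E v -> E (rho h (T (rho (- x, 0) (rho h^-1%g v)))).
Proof. by move=> Ev; apply/(rho_in hS)/T_in/(rho_in hS)/(rho_in hS). Qed.

(** An average over conjugation by the Heisenberg group commutes with that group, so Schur's lemma
    applies. *)
Let avg_scalar x : exists a, forall v, E v -> avg x v = a *: v.
Proof.
apply: (@schur _ _ (heis_repn S)) => //=.
- move=> a u v Eu Ev; rewrite /avg scaler_sumr -big_split; apply: eq_bigr => h _ /=.
  rewrite (rho_lin hS)// (rho_lin hS); try exact: (rho_in hS).
  rewrite T_lin; try by do 2 apply: (rho_in hS).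
  by rewrite (rho_lin hS)//; apply/T_in/(rho_in hS)/(rho_in hS).
- by move=> v Ev; apply: subspace_sum => // h _; exact: avg_term_in.
- move=> k v Ev; rewrite (rho_sum hS); last by move=> h _; exact: avg_term_in.
  rewrite /avg (reindex_inj (mulgI k)); apply: eq_bigr => h _ /=.
  rewrite !(rho_M hS)//; try exact: (rho_in hS); last first.
    by apply/T_in/(rho_in hS).
  by rewrite invMg -!mulgA mulVg mulg1.
Qed.

Let sp_heis_inj g : injective (@sp_heis F V (gamma g)).
Proof. by move=> [x t] [y s] [] /perm_inj -> ->. Qed.

(** [T] commutes with [sg g], and conjugation by [sg g] permutes the Heisenberg group through
    [gamma g]; so the scalar of [x] is that of [gamma g x]. *)
Let avg_equivariant g x v : E v -> avg (gamma g x) v = sg g (avg x (sg g^-1%g v)).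
Proof.
move=> Ev; have Egv := sg_in hS g^-1%g Ev; rewrite /avg (sg_sum hS); last first.
  by move=> h _; exact: avg_term_in.
rewrite (reindex_inj (@sp_heis_inj g)); apply: eq_bigr => -[y t] _ /=.
rewrite (sg_rho hS); last by apply/T_in/(rho_in hS)/(rho_in hS).
rewrite /sp_heis /=; congr (rho _ _).
rewrite -T_sg; last by do 2 apply: (rho_in hS).
rewrite (sg_rho hS); last by apply: (rho_in hS).
rewrite !heis_invE (sg_rho hS)// (sg_K hS)// /= !sp_N.
by [].
Qed.

(** Fourier inversion: moving [rho (x, 0)] past [rho h^-1] costs [psi (am_form x h.1)], and the sum
    over [x] leaves only the central [h], each giving [#|V|] times [T v]. *)
Let avg_sum v : E v ->
  \sum_x avg x (rho (x, 0) v) = (#|V| * #|F|)%:R *: T v.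
Proof.
move=> Ev.
have step (x : V) (h : heis V) : rho h (T (rho (- x, 0) (rho h^-1%g (rho (x, 0) v)))) =
    psi (am_form x h.1) *: rho h (T (rho h^-1%g v)).
  have -> : rho (- x, 0) (rho h^-1%g (rho (x, 0) v)) = psi (am_form x h.1) *: rho h^-1%g v.
    rewrite !(rho_M hS)//; last exact: (rho_in hS).
    rewrite (rhoE hS (- h.1) (- h.2))// scalerA -psiD//.
    rewrite !heis_mulE heis_invE /= (rhoE hS)//.
    congr (psi _ *: rho (_, _) _); last by rewrite addrAC addNr add0r.
    rewrite !formDl !formNl !formNr am_alt oppr0 opprK [am_form h.1 x]formC.
    rewrite -[am_form x h.1 in RHS](halfD _ two_unit); ring.
  rewrite (lin_onZ sE T_lin); last exact: (rho_in hS).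
  by rewrite (rho_Z hS)//; apply/T_in/(rho_in hS).
rewrite /avg exchange_big /=.
under eq_bigr => h _.
  under eq_bigr => x _ do rewrite step.
  rewrite -scaler_suml.
  over.
transitivity (\sum_(y : V) \sum_(t : F) (\sum_i psi (am_form i y)) *:
    rho (y, t) (T (rho ((y, t) : heis V)^-1%g v))).
  by rewrite pair_bigA; apply: eq_bigr => -[].
rewrite (bigD1 0)//= [X in _ + X]big1 ?addr0 => [|y y0]; last first.
  by apply: big1 => t _; rewrite psi_sum_full// (negPf y0) scale0r.
rewrite (eq_bigr (fun=> #|V|%:R *: T v)) => [|t _].
  by rewrite sumr_const -scaler_nat scalerA -natrM mulnC.
rewrite psi_sum_full// eqxx; congr (_ *: _).
have cen s u : E u -> rho (0, s) u = psi s *: u by case: hS => _ h _ _; exact: h.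
rewrite heis_invE /= oppr0 (cen (- t))// (lin_onZ sE T_lin)// cen.
  by rewrite scalerA psiN// scale1r.
exact/(space_Z hS)/T_in.
Qed.

(** Any [o] whose fibres each lie in one orbit is allowed, so the commutant is spanned by [#|J|]
    operators without forming the quotient by the group. *)
Lemma commutant_orbits (J : finType) (o : V -> J) :
  (forall x y, o x = o y -> exists g, gamma g x = y) ->
  exists c : J -> C, forall v, E v ->
    T v = \sum_j c j *: \sum_(x | o x == j) rho (x, 0) v.
Proof.
move=> ho; have /choice[a ha] := avg_scalar.
have [w Ew w0] := irreducible_nonzero irrS.
have aG g x : a (gamma g x) = a x.
  have := avg_equivariant g x Ew; have Egw := sg_in hS g^-1%g Ew.
  rewrite !ha// (sg_Z hS)// (sg_K hS)// => /eqP.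
  by rewrite -subr_eq0 -scalerBl scaler_eq0 (negPf w0) orbF subr_eq0 => /eqP.
pose N : C := (#|V| * #|F|)%:R.
have N0 : N != 0.
  rewrite pnatr_eq0 muln_eq0 negb_or -!lt0n.
  by apply/andP; split; apply/card_gt0P; exists 0.
(* The default 0 concerns values that [o] does not take, whose inner sum is empty. *)
pose c j := if [pick x | o x == j] is Some x then a x else 0.
have cE x : c (o x) = a x.
  rewrite /c; case: pickP => [y /eqP/ho[g <-]|/(_ x)]; last by rewrite eqxx.
  by rewrite aG.
exists (fun j => N^-1 * c j) => v Ev.
rewrite -[LHS]scale1r -(mulVf N0) -scalerA -avg_sum//.
under [RHS]eq_bigr do rewrite -scalerA.
rewrite -scaler_sumr; congr (_ *: _).
rewrite (partition_big o predT)//=; apply: eq_bigr => j _; rewrite scaler_sumr.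
by apply: eq_bigr => x /eqP <-; rewrite ha ?cE//; exact: (rho_in hS).
Qed.
End Commutant.

(** * Vectors fixed by U *)

Lemma is_weil_core (C : numClosedFieldType) (F : finComUnitRingType) (psi : F -> C)
    (V : altMod F) (gT : finGroupType) (gamma : gT -> Sp V) (S : weilRep C V gT) :
  is_weil psi gamma S -> weil_core psi gamma S.
Proof. by case=> -[[]]. Qed.

Section FixedVectors.
Variables (C : numClosedFieldType) (F : finComUnitRingType) (psi : F -> C).
Hypothesis psi_prim : primitive_char psi.
Variables (V : altMod F) (U : invIso V).
Hypothesis two_unit : (2%:R : F) \is a GRing.unit.
Hypothesis nondeg : forall x : V, (forall y, am_form y x = 0) -> x = 0.
Variable S : weilRep C V (Sp V).

(** The quotient acts through chosen representatives; on vectors fixed by [U] the choice is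
    immaterial, as [rho_repr] shows. *)
Definition fixed_rep : weilRep C (ubar U) (Sp V) :=
  @WeilRep C F (ubar U) (Sp V) (wr_sort S)
    [set v | wr_space S v /\ {in ii_set U, forall u, wr_heis S (u, 0) v = v}]%classic
    (fun h => wr_heis S (ubar_repr h.1, h.2)) (wr_grp S).

Hypothesis hS : is_weil psi id S.
Local Notation E := (wr_space S).
Local Notation rho := (wr_heis S).
Local Notation sg := (wr_grp S).
Local Notation Fx := (wr_space fixed_rep).

Let cS := is_weil_core hS.
Let sE := wspace cS.
Let rhoI := rho_in cS.
Let sgI := sg_in cS.

Let Fx_E v : Fx v -> E v. Proof. by case. Qed.
Let Fx_U v u : Fx v -> u \in ii_set U -> rho (u, 0) v = v.
Proof. by case=> _; apply. Qed.

Lemma perp_sym w u : w \in perp U -> u \in ii_set U -> am_form u w = 0.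
Proof. by move=> /perpP h uU; rewrite formC (h _ uU) oppr0. Qed.
Lemma sub_perp u : u \in ii_set U -> u \in perp U.
Proof. by move=> uU; apply/perpP => y yU; exact: (ii_isotropic uU yU). Qed.

(** A translate by [z] of a fixed vector is an eigenvector of [U], whose character is trivial
    exactly when [z] is orthogonal to [U]. This yields [fixed_rho] and [PU_rho]. *)
Let swap u z t v : Fx v -> u \in ii_set U ->
  rho (u, 0) (rho (z, t) v) = psi (am_form u z) *: rho (z, t) v.
Proof.
move=> Fv uU; have Ev := Fx_E Fv.
rewrite -[v in RHS](Fx_U Fv uU) !(rhoD cS)// scalerA -psiD// [z + u]addrC.
congr (psi _ *: _); rewrite [am_form z u]formC.
by rewrite -[X in _ = X + _](halfD _ two_unit); ring.
Qed.

Lemma fixed_rho w t v : w \in perp U -> Fx v -> Fx (rho (w, t) v).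
Proof.
move=> wP Fv; split; first exact/rhoI/Fx_E.
by move=> u uU; rewrite swap// perp_sym// psi0// scale1r.
Qed.

Lemma rho_repr w t v : w \in perp U -> Fx v ->
  rho (ubar_repr (ubar_pi U w), t) v = rho (w, t) v.
Proof.
move=> wP Fv; set x := ubar_repr _.
have xwU : x - w \in ii_set U by exact: sq_repr_pi.
have -> : x = w + (x - w) by rewrite addrC subrK.
rewrite (rhoE cS _ t (Fx_E Fv)) (rhoE cS w t (Fx_E Fv)); congr (_ *: _).
have := rhoD cS w (x - w) 0 0 (Fx_E Fv).
rewrite (_ : am_form w (x - w) = 0); last by move/perpP: wP; apply.
by rewrite mulr0 !addr0 psi0// scale1r => <-; rewrite (Fx_U Fv xwU).
Qed.

Let Fx_sub : subspace Fx.
Proof.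
split=> [|a u v [Eu hu] [Ev hv]]; split.
- exact: sE.1.
- by move=> u _; rewrite (lin_on0 sE (rho_lin cS _)).
- exact: sE.2.
- by move=> x xU; rewrite (rho_lin cS)// hu// hv.
Qed.

Lemma mem_spV (g : Sp V) u : (g u \in ii_set U) = (u \in ii_set U).
Proof.
apply/idP/idP => h; last exact: (ii_inv g h).
by rewrite -(perm_invK g u); exact: (ii_inv g^-1%g h).
Qed.

Let Fx_sg g v : Fx v -> Fx (sg g v).
Proof.
move=> Fv; have Ev := Fx_E Fv; split; first exact: sgI.
move=> u uU; have -> : u = g (g^-1%g u) by rewrite perm_invE.
by rewrite -(sg_rho cS)// Fx_U// mem_spV.
Qed.

Definition proj_fixed v := #|ii_set U|%:R^-1 *: \sum_(u in ii_set U) rho (u, 0) v.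
Local Notation PU := proj_fixed.

Let cardU : #|ii_set U|%:R != 0 :> C.
Proof.
rewrite pnatr_eq0 -lt0n; apply/card_gt0P; exists 0.
by case: (ii_submod U).
Qed.

Let PU_lin : lin_on E PU.
Proof.
move=> a u v Eu Ev; rewrite /PU scalerA mulrC -scalerA -scalerDr; congr (_ *: _).
by rewrite scaler_sumr -big_split; apply: eq_bigr => x _; rewrite (rho_lin cS).
Qed.

Let PU_Fx v : E v -> Fx (PU v).
Proof.
move=> Ev; split.
  by apply: subspaceZ => //; apply: subspace_sum => // u _; exact: rhoI.
move=> x xU; rewrite (rho_Z cS); last by apply: subspace_sum => // u _; exact: rhoI.
congr (_ *: _); rewrite (rho_sum cS) => [|u _]; last exact: rhoI.
rewrite [RHS](reindex_inj (addrI x)) /=; apply: eq_big => [u|u uU].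
  have [_ h] := ii_submod U; apply/idP/idP => hu; first by rewrite -[x]scale1r; apply: h.
  by rewrite -[u](addKr x) -scaleN1r; apply: h.
by rewrite (rhoD cS)// (ii_isotropic xU uU) mulr0 !addr0 psi0// scale1r.
Qed.

Let PU_id v : Fx v -> PU v = v.
Proof.
move=> Fv; rewrite /PU (eq_bigr (fun=> v)) => [|u uU]; last by rewrite Fx_U.
by rewrite sumr_const -scaler_nat scalerA mulVf ?scale1r.
Qed.

Let PU_rho z t v : Fx v -> PU (rho (z, t) v) = if z \in perp U then rho (z, t) v else 0.
Proof.
move=> Fv; case: ifP => zP; first by apply/PU_id/fixed_rho.
rewrite /PU (eq_bigr _ (fun u => @swap u z t v Fv)) -scaler_suml.
have [u uU uz] : exists2 u, u \in ii_set U & am_form u z != 0.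
  apply: contrapT => h; move/negP: zP; apply; apply/perpP => u uU.
  rewrite formC; apply/eqP; rewrite oppr_eq0; apply: contrapT => /negP h'.
  by apply: h; exists u.
by rewrite (psi_sum_nontriv psi_prim (ii_submod U) uU uz) scale0r scaler0.
Qed.

Let PU_perp w t v : w \in perp U -> E v -> PU (rho (w, t) v) = rho (w, t) (PU v).
Proof.
move=> wP Ev; rewrite /PU (rho_Z cS); last by apply: subspace_sum => // u _; exact: rhoI.
congr (_ *: _); rewrite (rho_sum cS) => [|u _]; last exact: rhoI.
apply: eq_bigr => u uU; rewrite !(rhoD cS)// [u + w]addrC perp_sym//.
by rewrite (_ : am_form w u = 0) ?[t + 0]addrC//; move/perpP: wP; apply.
Qed.

Let PU_sg g v : E v -> PU (sg g v) = sg g (PU v).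
Proof.
move=> Ev; rewrite /PU (sg_Z cS); last by apply: subspace_sum => // u _; exact: rhoI.
congr (_ *: _); rewrite (sg_sum cS) => [|u _]; last exact: rhoI.
rewrite (reindex_inj (@perm_inj _ (sp_perm g))) /=; apply: eq_big => [u|u uU].
  exact: mem_spV.
by rewrite (sg_rho cS).
Qed.

(** A reconstruction formula, from which [to_model] is injective: after exchanging the sums,
    summation over [x] kills every [u] except 0 by nondegeneracy. *)
Let PU_avg v : E v ->
  \sum_(x : V) rho (- x, 0) (PU (rho (x, 0) v)) = (#|ii_set U|%:R^-1 * #|V|%:R) *: v.
Proof.
move=> Ev.
have st (x u : V) : rho (- x, 0) (rho (u, 0) (rho (x, 0) v)) = psi (am_form u x) *: rho (u, 0) v.
  rewrite [rho (u, 0) _](rhoD cS)// (rho_Z cS) ?(rhoD cS)//; last exact: rhoI.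
  rewrite scalerA -psiD// [u + x]addrC addKr; congr (psi _ *: _).
  rewrite !add0r !formDr formNl formNl am_alt oppr0 add0r [am_form x u]formC opprK.
  by rewrite halfD.
transitivity (#|ii_set U|%:R^-1 *:
    \sum_(u in ii_set U) (\sum_(x : V) psi (am_form u x)) *: rho (u, 0) v).
  under [in RHS]eq_bigr => u _ do rewrite scaler_suml.
  rewrite exchange_big /= scaler_sumr; apply: eq_bigr => x _.
  rewrite (rho_Z cS); last by apply: subspace_sum => // u _; apply/rhoI/rhoI.
  rewrite (rho_sum cS) => [|u _]; last by apply/rhoI/rhoI.
  by congr (_ *: _); apply: eq_bigr => u _; rewrite st.
rewrite -scalerA; congr (_ *: _); rewrite (bigD1 0) /=; last by case: (ii_submod U).
rewrite [X in _ + X]big1 ?addr0 => [|u /andP[uU u0]].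
  rewrite (rho_0 psi_prim cS)//; congr (_ *: _).
  by under eq_bigr do rewrite form0l psi0//; rewrite sumr_const.
under eq_bigr => x _ do rewrite -[am_form u x]opprK -formC -formNr.
by rewrite psi_sum_full// oppr_eq0 (negPf u0) scale0r.
Qed.

Let model := weil_model psi fixed_rep.

Definition to_model v : {ffun V -> wr_sort S} := [ffun x => PU (rho (x, 0) v)].

Let to_model_in v : E v -> wr_space model (to_model v).
Proof.
move=> Ev; split=> [x|x w wP]; rewrite !ffunE; first exact/PU_Fx/rhoI.
rewrite /rho_perp /= rho_repr//; last exact/PU_Fx/rhoI.
rewrite -PU_perp//; last exact: rhoI.
rewrite (rhoD cS)// [w + x]addrC (lin_onZ sE PU_lin); last exact: rhoI.
rewrite scalerA -psiD// [am_form w x]formC mulrN !add0r subrr psi0// scale1r.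
by [].
Qed.

Let to_model_lin : lin_on E to_model.
Proof.
move=> a u v Eu Ev; apply/ffunP => x; rewrite !ffunE (rho_lin cS)//.
by rewrite PU_lin//; exact: rhoI.
Qed.

Let to_model_heis h v : E v -> to_model (rho h v) = wr_heis model h (to_model v).
Proof.
case: h => y t Ev; apply/ffunP => x; rewrite !ffunE /= (rhoD cS)//.
by rewrite (lin_onZ sE PU_lin) ?add0r//; exact: rhoI.
Qed.

Let to_model_sg g v : E v -> to_model (sg g v) = wr_grp model g (to_model v).
Proof.
move=> Ev; apply/ffunP => x; rewrite !ffunE /= -PU_sg; last exact: rhoI.
by rewrite (sg_rho cS)// perm_invE.
Qed.

Let to_model_inj v : E v -> to_model v = 0 -> v = 0.
Proof.
move=> Ev v0; have := PU_avg Ev; rewrite big1 => [/esym/eqP|x _]; last first.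
  by have /ffunP/(_ x) := v0; rewrite !ffunE => ->; rewrite (lin_on0 sE (rho_lin cS _)).
rewrite scaler_eq0 mulf_eq0 invr_eq0 (negPf cardU) /= pnatr_eq0 => /orP[|/eqP//].
by rewrite eqn0Ngt => /negP[]; apply/card_gt0P; exists 0.
Qed.

Let to_model_surj phi : wr_space model phi -> exists2 v, E v & to_model v = phi.
Proof.
move=> [hF hP]; have hE x := Fx_E (hF x).
have cardP : #|perp U|%:R != 0 :> C.
  by rewrite pnatr_eq0 -lt0n; apply/card_gt0P; exists 0; exact: rpred0.
(* Under [PU (rho (y, 0) _)] only the [x] in the coset of [y] modulo [perp U] contribute, and each
   gives [phi y]; hence the normalization. *)
exists (#|perp U|%:R^-1 *: \sum_x rho (- x, 0) (phi x)).
  by apply: subspaceZ => //; apply: subspace_sum => // x _; exact: rhoI.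
apply/ffunP => y; rewrite ffunE (rho_Z cS); last first.
  by apply: subspace_sum => // x _; exact: rhoI.
rewrite (rho_sum cS) => [|x _]; last exact: rhoI.
rewrite (lin_onZ sE PU_lin); last by apply: subspace_sum => // x _; apply/rhoI/rhoI.
rewrite (lin_on_sum sE PU_lin) => [|x _]; last by apply/rhoI/rhoI.
rewrite (bigID (fun x => y - x \in perp U)) /= [X in _ + X]big1 ?addr0 => [|x xP]; last first.
  rewrite (rhoD cS)// (lin_onZ sE PU_lin); last exact: rhoI.
  by rewrite PU_rho// (negPf xP) scaler0.
rewrite (eq_bigr (fun=> phi y)) => [|x xP].
  have sI : injective (fun w : V => y - w) by move=> a b /addrI/oppr_inj.
  rewrite (reindex_inj sI) (eq_bigl (mem (perp U))) => [|w]; last first.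
    by rewrite /= opprB addrC subrK.
  by rewrite sumr_const -scaler_nat scalerA mulVf ?scale1r.
rewrite (rhoD cS)// (lin_onZ sE PU_lin); last exact: rhoI.
rewrite PU_rho// xP.
have xP' : x - y \in perp U by rewrite -opprB rpredN.
have hx : y + (x - y) = x by rewrite addrC subrK.
have := hP y _ xP'; rewrite hx => ->.
rewrite /rho_perp /= rho_repr// (rho_Z cS); last exact: rhoI.
rewrite (rhoD cS)// !scalerA -!psiD//.
have -> : y - x + (x - y) = 0 by rewrite addrA subrK subrr.
rewrite (rho_0 psi_prim cS)// -[RHS]scale1r -(psi0 psi_prim); congr (psi _ *: _).
rewrite !formBr !formBl !formNr !am_alt [am_form x y]formC; ring.
Qed.

Lemma fixed_model_iso : weil_iso S model.
Proof.
have [f hf] := lin_on_extend sE to_model_lin; exists f; split.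
- apply/seteqP; split=> [_ [v Ev <-]|phi /to_model_surj[v Ev <-]].
    by rewrite hf//; exact: to_model_in.
  by exists v => //; exact: hf.
- move=> u v; rewrite !inE => Eu Ev fuv; apply/eqP; rewrite -subr_eq0; apply/eqP.
  have Euv : E (u - v) by rewrite addrC -scaleN1r; apply: sE.2.
  by apply: to_model_inj => //; rewrite -hf// linearB /= fuv subrr.
- by move=> h v Ev; rewrite !hf ?to_model_heis//; exact: rhoI.
- by move=> g v Ev; rewrite !hf ?to_model_sg//; exact: sgI.
Qed.

Lemma ubar_reprP (c : ubar U) : ubar_repr c \in perp U.
Proof. exact: sq_reprP. Qed.
Lemma ubar_reprK (c : ubar U) : ubar_pi U (ubar_repr c) = c.
Proof. exact: sq_reprK. Qed.
Lemma ubar_pi0 : ubar_pi U 0 = 0.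
Proof. exact: sq_pi0. Qed.
Lemma ubar_pi_eq0 x : x \in perp U -> (ubar_pi U x == 0) = (x \in ii_set U).
Proof. by move=> xP; rewrite -ubar_pi0 sq_eqE ?rpred0// subr0. Qed.

Lemma am_form_ubar x y : x \in perp U -> y \in perp U ->
  am_form (ubar_pi U x : ubar U) (ubar_pi U y) = am_form x y.
Proof. exact: ubar_form_pi. Qed.

Let fixed_heis_repn : is_repn (heis_repn fixed_rep).
Proof.
split=> //=.
- by move=> h v Fv; apply: fixed_rho => //; exact: ubar_reprP.
- by move=> h a u v /Fx_E Eu /Fx_E Ev; exact: (rho_lin cS).
- move=> v Fv; rewrite -ubar_pi0 rho_repr ?rpred0//.
  exact/(rho_0 psi_prim cS)/Fx_E.
- move=> [c t] [d s] v Fv; rewrite (rho_M cS) ?heis_mulE /=; last exact: Fx_E.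
  rewrite -{1}(ubar_reprK c) -{1}(ubar_reprK d) -ubar_piD ?ubar_reprP//.
  by rewrite rho_repr ?rpredD ?ubar_reprP.
Qed.

Let fixed_irreducible : irreducible (heis_repn fixed_rep).
Proof.
split=> //=.
  have [[irrS _] _ _ _] := hS.
  have [v Ev v0] := irreducible_nonzero irrS.
  move=> F0; case/eqP: v0; apply: to_model_inj => //; apply/ffunP => x.
  rewrite !ffunE; suff : [set 0]%classic (PU (rho (x, 0) v)) by [].
  by rewrite -F0; exact/PU_Fx/rhoI.
move=> A sA AF AH.
(* The largest Heisenberg submodule whose projection lies in [A]. It contains [A], and its own fixed
   vectors lie in [A], so [B] being 0 or everything decides [A]. *)
pose B := [set v | E v /\ forall x, A (PU (rho (x, 0) v))]%classic.
have [[[_ _ irrS] _] _ _ _] := hS.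
have [|||B0|BE] := irrS B.
- split=> [|a u v [Eu hu] [Ev hv]].
    split=> [|x]; first exact: sE.1.
    by rewrite (lin_on0 sE (rho_lin cS _)) (lin_on0 sE PU_lin); exact: sA.1.
  split=> [|x]; first exact: sE.2.
  rewrite (rho_lin cS)// PU_lin; try exact: rhoI.
  exact: sA.2.
- by move=> v [].
- move=> [y t] v [Ev hv]; split=> [|x]; first exact: rhoI.
  rewrite /= (rhoD cS)// (lin_onZ sE PU_lin); last exact: rhoI.
  exact: subspaceZ.
- left; apply/seteqP; split=> v; last by move=> ->; exact: sA.1.
  move=> Av; rewrite -B0; split=> [|x]; first exact/Fx_E/AF.
  rewrite PU_rho; last exact: AF.
  case: ifP => xP; last exact: sA.1.
  by have := AH (ubar_pi U x, 0) v Av; rewrite /= rho_repr//; exact: AF.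
- right; apply/seteqP; split=> // v Fv; have : B v by rewrite BE; exact: Fx_E.
  by case=> Ev /(_ 0); rewrite (rho_0 psi_prim cS)// PU_id.
Qed.

Lemma fixed_is_weil : is_weil psi (rU U) fixed_rep.
Proof.
split.
- split=> //; have [[_ [f [f1 f2 f3 f4]]] _ _ _] := hS; exists f.
  split; move=> *; [apply: f1|apply: f2|apply: f3|apply: f4] => //; exact: Fx_E.
- move=> t v Fv; rewrite /= -ubar_pi0 rho_repr ?rpred0//.
  by case: hS => _ h _ _; apply: h; exact: Fx_E.
- split=> //=.
  + by move=> g a u v /Fx_E Eu /Fx_E Ev; exact: (sg_lin cS).
  + by move=> v /Fx_E; exact: (sg_1 cS).
  + by move=> g h v /Fx_E Ev; rewrite (sg_M cS).
- move=> g [c t] v Fv; have Ev := Fx_E Fv.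
  rewrite /= (sg_rho cS) ?(sg_K cS)//; last exact: sgI.
  by rewrite permE /rU_fun rho_repr// sp_perp// ubar_reprP.
Qed.

(** * Uniqueness of sigma *)

Section Uniqueness.
Variable sigma : weilRep C (ubar U) (Sp V).
Hypothesis hsigma : is_weil psi (rU U) sigma.
Let cs := is_weil_core hsigma.
Let model' := weil_model psi sigma.

Lemma model_U u phi x : wr_space model' phi -> u \in ii_set U ->
  wr_heis model' (u, 0) phi x = psi (am_form x u) *: phi x.
Proof.
move=> [hE hP] uU; rewrite ffunE /= hP ?sub_perp// /rho_perp.
have /eqP -> : ubar_pi U u == 0 by rewrite ubar_pi_eq0// sub_perp.
by rewrite (rho_0 psi_prim cs)// scalerA -psiD// add0r halfD.
Qed.

Lemma model_perp phi w : wr_space model' phi -> w \in perp U ->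
  phi w = wr_heis sigma (ubar_pi U w, 0) (phi 0).
Proof.
by move=> [hE hP] wP; have := hP 0 w wP; rewrite add0r form0l mulr0 psi0// scale1r.
Qed.

(** The functions supported on the orthogonal of [U], parametrized by their value at 0. It also
    serves as the embedding of [sigma] and its sign parts into the model. *)
Definition extend0 (e : wr_sort sigma) : {ffun V -> wr_sort sigma} :=
  [ffun x => if x \in perp U then wr_heis sigma (ubar_pi U x, 0) e else 0].

Lemma extend0_in e : wr_space sigma e -> wr_space model' (extend0 e).
Proof.
move=> Ee; split=> [x|x w wP]; rewrite !ffunE.
  by case: ifP => _; [exact: (rho_in cs)|exact: (wspace cs).1].
have -> : (x + w \in perp U) = (x \in perp U).
  by apply/idP/idP => h; [rewrite -(addrK w x) rpredB|rewrite rpredD].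
case: ifP => xP; last by rewrite /rho_perp (lin_on0 (wspace cs) (rho_lin cs _)) scaler0.
rewrite /rho_perp (rhoD cs)// ubar_piD// scalerA -psiD// [ubar_pi U w + _]addrC.
rewrite am_form_ubar// [am_form w x]formC.
by rewrite mulrN !add0r subrr psi0// scale1r.
Qed.

Lemma fixed_unique : weil_iso S model' -> weil_iso fixed_rep sigma.
Proof.
move=> [f [fS fI fH fG]].
have fM v : E v -> wr_space model' (f v) by move=> Ev; rewrite -fS; exists v.
have [||g hg] := @lin_on_extend C (wr_sort S) (wr_sort sigma) setT
  (fun v => (f v : {ffun V -> wr_sort sigma}) 0).
- by [].
- by move=> a u v _ _; rewrite linearP /= !ffunE.
have f_out v x : Fx v -> x \notin perp U -> f v x = 0.
  move=> Fv; apply: contraNeq => fx0; apply/perpP => u uU.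
  rewrite formC; apply/eqP; rewrite oppr_eq0; apply/eqP; move: u uU.
  apply: (primitive_form psi_prim (ii_submod U)) => u uU.
  have := model_U x (fM _ (Fx_E Fv)) uU; rewrite -fH ?Fx_U//; last exact: Fx_E.
  move/esym/eqP; rewrite -subr_eq0 -{2}[f v x]scale1r -scalerBl scaler_eq0 (negPf fx0) orbF.
  rewrite subr_eq0 => /eqP h; have := psiN psi_prim (am_form x u).
  by rewrite h mul1r -formC.
exists g; split.
- apply/seteqP; split=> [_ [v Fv <-]|e Ee].
    by rewrite hg//; have [h _] := fM _ (Fx_E Fv); exact: h.
  have : wr_space model' (extend0 e) by exact: extend0_in.
  rewrite -fS => -[v Ev fv]; exists v; last first.
    by rewrite hg// fv ffunE rpred0 ubar_pi0 (rho_0 psi_prim cs).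
  split=> // u uU; apply: fI; rewrite ?inE//; first exact: rhoI.
  rewrite fH// fv; apply/ffunP => x; rewrite model_U//; last exact: extend0_in.
  rewrite ffunE; case: ifP => [/perpP -> //|]; last by rewrite scaler0.
  by rewrite psi0// scale1r.
- move=> u v; rewrite !inE => Fu Fv guv; apply/eqP; rewrite -subr_eq0; apply/eqP.
  have Fuv : Fx (u - v) by rewrite addrC -scaleN1r; apply: Fx_sub.2.
  apply: fI; rewrite ?inE; [exact: Fx_E|exact: sE.1|].
  rewrite linear0; apply/ffunP => x; rewrite [RHS]ffunE.
  have [xP|xP] := boolP (x \in perp U); last exact: f_out.
  rewrite (model_perp (fM _ (Fx_E Fuv)) xP) -hg// linearB /= guv subrr.
  exact: (lin_on0 (wspace cs) (rho_lin cs _)).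
- move=> [c t] v Fv; have Ev := Fx_E Fv.
  rewrite !hg// fH// ffunE /= add0r (model_perp (fM _ Ev)) ?ubar_reprP//.
  rewrite ubar_reprK form0l mulr0 addr0 [RHS](rhoE cs)//.
  by have [h _] := fM _ Ev.
- move=> h v Fv; have Ev := Fx_E Fv.
  by rewrite !hg// fG// ffunE (sp_0 h^-1%g).
Qed.
End Uniqueness.

End FixedVectors.

(** * The summands of S^{U,sigma} *)

Section Transport.
Variables (C : numClosedFieldType) (gT : finGroupType).
Variables (r1 r2 : repn C gT).
Hypothesis iso : repn_iso r1 r2.

Lemma iso_is_repn : is_repn r1 -> is_repn r2.
Proof.
case: iso => f [fS _ fG] [[s0 s2] st li o1 oM].
have fP v : rp_space r1 v -> rp_space r2 (f v) by move=> h; rewrite -fS; exists v.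
have fE w : rp_space r2 w -> exists2 v, rp_space r1 v & f v = w by rewrite -fS.
split.
- split=> [|a u v /fE[u' hu <-] /fE[v' hv <-]]; first by rewrite -(linear0 f); exact: fP.
  by rewrite -linearP; exact/fP/s2.
- by move=> g _ /fE[v hv <-]; rewrite -fG//; exact/fP/st.
- move=> g a _ _ /fE[u hu <-] /fE[v hv <-]; rewrite -linearP -!fG ?li ?linearP//.
  exact: s2.
- by move=> _ /fE[v hv <-]; rewrite -fG// o1.
- by move=> g h _ /fE[v hv <-]; rewrite -!fG ?oM//; exact: st.
Qed.

Lemma iso_irreducible : irreducible r1 -> irreducible r2.
Proof.
move=> irr; have [rr _ h] := irr; split; first exact: iso_is_repn.
  have [v rv v0] := irreducible_nonzero irr; case: iso => f [fS fI _] r20.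
  have [[s0 _] _ _ _ _] := rr.
  have : rp_space r2 (f v) by rewrite -fS; exists v.
  rewrite r20 /= -(linear0 f) => /fI h0; case/eqP: v0; apply: h0; by rewrite ?inE.
move=> A sA Ar AG; case: iso => f [fS fI fG].
have [sr st _ _ _] := rr.
pose B := [set v | rp_space r1 v /\ A (f v)]%classic.
have fB w : A w -> exists2 v, B v & f v = w.
  by move=> Aw; have := Ar _ Aw; rewrite -fS => -[v rv fv]; exists v => //; split; rewrite ?fv.
have [|||B0|BE] := h B.
- split=> [|a u v [ru Au] [rv Av]]; first by split; [exact: sr.1|rewrite linear0; exact: sA.1].
  by split; [exact: sr.2|rewrite linearP; exact: sA.2].
- by move=> v [].
- by move=> g v [rv Av]; split; [exact: st|rewrite fG//; exact: AG].
- left; apply/seteqP; split=> w; last by move=> ->; exact: sA.1.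
  by move=> /fB[v]; rewrite B0 => -> <-; rewrite linear0.
- right; apply/seteqP; split=> // w; rewrite -fS => -[v]; rewrite -BE => -[_ Av] <-.
  exact: Av.
Qed.
End Transport.

Section TransportWeil.
Variables (C : numClosedFieldType) (F : finComUnitRingType) (psi : F -> C).
Variables (V : altMod F) (gT : finGroupType) (gamma : gT -> Sp V) (S1 S2 : weilRep C V gT).
Hypothesis iso : weil_iso S1 S2.

Lemma weil_iso_heis : repn_iso (heis_repn S1) (heis_repn S2).
Proof. by case: iso => f [fS fI fH fG]; exists f. Qed.
Lemma weil_iso_grp : repn_iso (grp_repn S1) (grp_repn S2).
Proof. by case: iso => f [fS fI fH fG]; exists f. Qed.

Lemma weil_iso_core : weil_core psi gamma S1 -> weil_core psi gamma S2.
Proof.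
move=> cS; have [h1 h2 h3 h4] := cS.
split; [exact: iso_is_repn weil_iso_heis h1| |exact: iso_is_repn weil_iso_grp h3|].
  case: iso => f [fS fI fH fG] t w; rewrite -fS => -[v Ev <-].
  by rewrite -fH// h2// linearZ.
case: iso => f [fS fI fH fG] g h w; rewrite -fS => -[v Ev <-].
have Ev' := sg_in cS g^-1%g Ev.
rewrite -fG// -fH// -fG; last exact: (rho_in cS).
by rewrite h4// fH.
Qed.
End TransportWeil.

(** The group translates the argument, while [t] enters only through linear conditions on the
    functions. So [sigma_dot_sgn] can be induced before anything is known about its
    multiplicativity. *)
Lemma induced_is_repn (C : numClosedFieldType) (gT : finGroupType) (H : {set gT})
    (t : repn C gT) :
  subspace (rp_space t) -> (forall h, lin_on (rp_space t) (rp_op t h)) ->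
  is_repn (induced H t).
Proof.
move=> st lt; split=> /=.
- split=> [|a u v [u1 u2] [v1 v2]]; split.
  + by move=> g; rewrite ffunE; exact: st.1.
  + by move=> h g _; rewrite !ffunE (lin_on0 st (lt h)).
  + by move=> g; rewrite !ffunE; exact: st.2.
  + by move=> h g hH; rewrite !ffunE lt// u2// v2.
- move=> g v [v1 v2]; split=> [x|h x hH]; rewrite !ffunE; first exact: v1.
  by rewrite -mulgA (v2 _ _ hH).
- by move=> g a u v _ _; apply/ffunP => x; rewrite !ffunE.
- by move=> v _; apply/ffunP => x; rewrite ffunE mulg1.
- by move=> g h v _; apply/ffunP => x; rewrite !ffunE mulgA.
Qed.

Section Summands.
Variables (C : numClosedFieldType) (F : finComUnitRingType) (psi : F -> C).
Hypothesis psi_prim : primitive_char psi.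
Variables (V : altMod F) (U : invIso V).
Hypothesis two_unit : (2%:R : F) \is a GRing.unit.
Variable sigma : weilRep C (ubar U) (Sp V).
Hypothesis hsigma : is_weil psi (rU U) sigma.
Let cs := is_weil_core hsigma.
Let model := weil_model psi sigma.
Hypothesis cM : weil_core psi id model.

Local Notation E := (wr_space sigma).
Local Notation rho := (wr_heis sigma).
Local Notation sg := (wr_grp sigma).
Local Notation M := (wr_space model).
Local Notation G := (wr_grp model).
Local Notation opp := (sp_opp V).
Local Notation sgn e := ((-1) ^+ (e : bool) : C).
Let sE : subspace E := wspace cs.

Lemma sp_ext (g h : Sp V) : (forall x, g x = h x) -> g = h.
Proof. by move=> gh; apply/val_inj/permP. Qed.
Lemma opp_opp : (opp * opp = 1)%g.
Proof. by apply: sp_ext => x; rewrite sp_mulE !sp_oppE opprK sp_1E. Qed.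
Lemma opp_comm (g : Sp V) : (opp * g = g * opp)%g.
Proof. by apply: sp_ext => x; rewrite !sp_mulE !sp_oppE sp_N. Qed.
Lemma sgn_sqr e : sgn e * sgn e = 1.
Proof. by rewrite -expr2 sqrr_sign. Qed.
Lemma two_neq0 : (2%:R : C) != 0. Proof. by rewrite pnatr_eq0. Qed.

Lemma stabE x (h : Sp V) : (h \in stab U x) = (h x - x \in perp U).
Proof. by rewrite inE. Qed.

Lemma stabV x (h : Sp V) : h \in stab U x -> h^-1%g x - x \in perp U.
Proof.
rewrite stabE => hP; have := sp_perp h^-1%g hP.
by rewrite sp_D sp_N perm_invK -opprB rpredN.
Qed.

Lemma stab_group x : group_set (stab U x).
Proof.
apply/group_setP; split=> [|g h]; rewrite !stabE; first by rewrite sp_1E subrr rpred0.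
move=> gP hP; rewrite sp_mulE -[h x](subrK x) sp_D -addrA rpredD//.
exact: sp_perp.
Qed.

Lemma pm_stab_group x : group_set (pm_stab U x).
Proof.
have stM := (group_setP (stab_group x)).2.
have pmE (g : Sp V) : (g \in pm_stab U x) = (g \in stab U x) || ((opp * g)%g \in stab U x).
  by rewrite inE.
apply/group_setP; split=> [|g h]; rewrite !pmE.
  by rewrite (group_setP (stab_group x)).1.
move=> /orP[]gP /orP[]hP; apply/orP.
- by left; exact: stM.
- by right; rewrite mulgA opp_comm -mulgA; exact: stM.
- by right; rewrite mulgA; exact: stM.
- left; have := stM _ _ gP hP; rewrite mulgA -[(opp * g * opp)%g]mulgA -opp_comm.
  by rewrite !mulgA opp_opp mul1g.
Qed.

(** Otherwise [2 x] would be orthogonal to [U], hence also [x], as 2 is a unit. *)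
Lemma opp_notin_stab x : x \notin perp U -> opp \notin stab U x.
Proof.
apply: contra; rewrite stabE sp_oppE => h.
have -> : x = - (2%:R^-1 : F) *: (- x - x).
  rewrite -opprD scaleNr scalerN opprK -mulr2n -scaler_nat scalerA mulVr ?scale1r//.
exact: perpZ.
Qed.

Lemma opp_pm_stab x : opp \in pm_stab U x.
Proof. by rewrite inE opp_opp (group_setP (stab_group x)).1 orbT. Qed.

Local Notation sd x h := (@sigma_dot C F V U sigma x h).
Lemma sd_in x h v : E v -> E (sd x h v).
Proof. by move=> Ev; apply/(sg_in cs)/(rho_in cs). Qed.
Lemma sd_lin x h : lin_on E (sd x h).
Proof.
move=> a u v Eu Ev; rewrite /sigma_dot /rho_perp (rho_lin cs)// (sg_lin cs)//.
all: exact: (rho_in cs).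
Qed.
Lemma sds_lin e x h : lin_on E (@sigma_dot_sgn C F V U sigma e x h).
Proof.
move=> a u v Eu Ev; rewrite /sigma_dot_sgn; case: ifP => _; rewrite sd_lin//.
by rewrite scalerDr !scalerA mulrC.
Qed.

Let M_E phi x : M phi -> E (phi x). Proof. by case. Qed.

(** The origin of [sigma_dot]: a shift of the argument inside the coset of [x] is undone by the
    covariance of [phi], which leaves an operator on the value at [x]. *)
Lemma model_stab x h phi : M phi -> h \in stab U x -> G h phi x = sd x h (phi x).
Proof.
move=> [Mp hP] hx; rewrite ffunE /sigma_dot /rho_perp; congr (sg h _).
rewrite (rhoE cs)//; have := hP x _ (stabV hx); rewrite addrC subrK => ->.
by rewrite formBr am_alt subr0.
Qed.

Definition sign_proj (e : bool) (v : wr_sort sigma) :=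
  if ubar_trivial U then v else 2%:R^-1 *: (v + sgn e *: sg opp v).

(** [summand] selects one of two representations by an [if], which hides the carrier type. Here the
    test affects only the subspace, so maps into and out of the carrier typecheck. *)
Definition summand_alt (i : bool + V * bool) : repn C (Sp V) :=
  match i with
  | inl e => @Repn C (Sp V) (wr_sort sigma)
     (if ubar_trivial U then E else rp_space (sigma_sgn sigma e)) sg
  | inr (x, e) => S_dot sigma e x
  end.

Lemma summandE i : summand sigma i = summand_alt i.
Proof. by case: i => [e|[]//]; rewrite /summand /summand_alt; case: ifP. Qed.

(** Frobenius reciprocity, [g] going to the value at [x] of the translate by [g]; the half-sum then
    selects the sign [e] under [- Id]. *)
Definition eval_orbit (e : bool) (x : V) (phi : {ffun V -> wr_sort sigma}) :
    {ffun Sp V -> wr_sort sigma} :=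
  [ffun g => 2%:R^-1 *: ((G g phi : {ffun V -> wr_sort sigma}) x +
      sgn e *: (G (opp * g)%g phi : {ffun V -> wr_sort sigma}) x)].

Lemma eval_orbitE e x phi g : eval_orbit e x phi g =
  2%:R^-1 *: ((G g phi : {ffun V -> wr_sort sigma}) x +
      sgn e *: (G (opp * g)%g phi : {ffun V -> wr_sort sigma}) x).
Proof. by rewrite [LHS]ffunE. Qed.

(** If [f g] is the value at [x] of the translate of [phi] by [g], and [g y] lies in the coset of
    [x], covariance forces [phi y] to be the summand written here. The average over the eligible [g]
    makes the choice canonical. *)
Definition unfold_orbit (x : V) (f : {ffun Sp V -> wr_sort sigma}) :
    {ffun V -> wr_sort sigma} :=
  [ffun y => #|stab U x|%:R^-1 *: \sum_(g : Sp V | g y - x \in perp U)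
     sg g^-1%g (rho (ubar_pi U (g y - x), 2%:R^-1 * am_form x (g y)) (f g))].

Definition to_summand i : {ffun V -> wr_sort sigma} -> rp_sort (summand_alt i) :=
  match i with
  | inl e => fun phi => sign_proj e (phi 0)
  | inr (x, e) => eval_orbit e x
  end.

Definition of_summand i : rp_sort (summand_alt i) -> {ffun V -> wr_sort sigma} :=
  match i with
  | inl e => fun v => @extend0 C F V U sigma v
  | inr (x, e) => unfold_orbit x
  end.

Lemma sign_proj_lin e : lin_on E (sign_proj e).
Proof.
move=> a u v Eu Ev; rewrite /sign_proj; case: ifP => _ //; rewrite (sg_lin cs)//.
by rewrite scalerA mulrC -scalerA -scalerDr; congr (_ *: _); rewrite !scalerDr !scalerA [a * _]mulrC addrACA.
Qed.
Lemma sign_proj_sg e g v : E v -> sign_proj e (sg g v) = sg g (sign_proj e v).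
Proof.
move=> Ev; rewrite /sign_proj; case: ifP => _ //.
have Eo := sg_in cs opp Ev.
rewrite (sg_Z cs); last by apply: subspaceD => //; exact: subspaceZ.
rewrite (lin_onD (sg_lin cs g))//; last exact: subspaceZ.
by rewrite (sg_Z cs)// !(sg_M cs)// opp_comm.
Qed.
Lemma sign_proj_in e v : E v -> rp_space (summand_alt (inl e)) (sign_proj e v).
Proof.
move=> Ev; rewrite /sign_proj /=; case: ifP => _ //=.
have Eo := sg_in cs opp Ev; have Eso := space_Z cs (sgn e) Eo.
split; first by apply: subspaceZ => //; apply: subspaceD.
rewrite (sg_Z cs); last exact: subspaceD.
rewrite (lin_onD (sg_lin cs opp))// (sg_Z cs)// (sg_M cs)// opp_opp (sg_1 cs)//.
by rewrite scalerA mulrC -scalerA; congr (_ *: _); rewrite scalerDr scalerA sgn_sqr scale1r addrC.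
Qed.

Lemma stab_card_neq0 x : (#|stab U x|%:R : C) != 0.
Proof.
rewrite pnatr_eq0 -lt0n; apply/card_gt0P; exists 1%g.
by case/group_setP: (stab_group x).
Qed.

Lemma eval_orbit_in e x phi : x \notin perp U -> M phi ->
  rp_space (S_dot sigma e x) (eval_orbit e x phi).
Proof.
move=> xP Mp.
have fo g : eval_orbit e x phi (opp * g)%g = sgn e *: eval_orbit e x phi g.
  rewrite !eval_orbitE mulgA opp_opp mul1g scalerA mulrC -scalerA; congr (_ *: _).
  by rewrite scalerDr scalerA sgn_sqr scale1r addrC.
have Eg k : E (G k phi x) by have [h _] := sg_in cM k Mp; exact: h.
have fE g : E (eval_orbit e x phi g).
  rewrite eval_orbitE; apply: subspaceZ => //; apply: subspaceD => //.
  exact: subspaceZ.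
have fs h g : h \in stab U x -> eval_orbit e x phi (h * g)%g = sd x h (eval_orbit e x phi g).
  move=> hs; have ohg : (opp * (h * g) = h * (opp * g))%g by rewrite !mulgA (opp_comm h).
  rewrite !eval_orbitE ohg -(sg_M cM h g)//.
  rewrite -(sg_M cM h (opp * g)%g)// !(model_stab (sg_in cM _ Mp) hs).
  rewrite (lin_onZ sE (sd_lin x h)); last by apply: subspaceD => //; exact: subspaceZ.
  congr (_ *: _); rewrite (lin_onD (sd_lin x h))//; last exact: subspaceZ.
  by rewrite (lin_onZ sE (sd_lin x h)).
split=> //= h g; rewrite inE /sigma_dot_sgn; case: ifP => [hs _|hs /= ho]; first exact: fs.
by rewrite -fs// -mulgA fo scalerA sgn_sqr scale1r.
Qed.

Lemma unfold_term_in x (f : {ffun Sp V -> wr_sort sigma}) g y : (forall g, E (f g)) ->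
  E (sg g^-1%g (rho (ubar_pi U (g y - x), 2%:R^-1 * am_form x (g y)) (f g))).
Proof. by move=> fE; apply/(sg_in cs)/(rho_in cs). Qed.

Lemma rU_ubar g x : x \in perp U -> rU U g (ubar_pi U x) = ubar_pi U (g x).
Proof. by move=> xP; rewrite permE; exact: rU_pi. Qed.

Lemma unfold_orbit_in x (f : {ffun Sp V -> wr_sort sigma}) :
  (forall g, E (f g)) -> M (unfold_orbit x f).
Proof.
move=> fE; split=> [y|y w wP]; rewrite !ffunE.
  by apply: subspaceZ => //; apply: subspace_sum => // g _; exact: unfold_term_in.
rewrite /rho_perp (rho_Z cs); last by apply: subspace_sum => // g _; exact: unfold_term_in.
rewrite scalerA mulrC -scalerA; congr (_ *: _).
rewrite (rho_sum cs) => [|g _]; last exact: unfold_term_in.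
rewrite scaler_sumr; apply: eq_big => [g|g].
  rewrite sp_D addrAC; apply/idP/idP => h; last by rewrite rpredD// sp_perp.
  by rewrite -[_ - x](addrK (g w)) rpredB// sp_perp.
rewrite sp_D addrAC => h.
have gwP : g w \in perp U by exact: sp_perp.
have gP : g y - x \in perp U by rewrite -[_ - x](addrK (g w)) rpredB.
have -> : ubar_pi U w = rU U g^-1%g (ubar_pi U (g w)) by rewrite rU_ubar// perm_invK.
rewrite -(sg_rho cs); last exact: (rho_in cs).
rewrite -(sg_Z cs); last by do 2 apply: (rho_in cs).
congr (sg _ _); rewrite (rhoD cs)// scalerA -psiD// (rhoE cs)// (ubar_piD gP gwP).
rewrite [X in rho (X, 0)]addrC am_form_ubar//; congr (psi _ *: _).
rewrite formBr !formDr sp_form [am_form (g w) x]formC [am_form y w]formC; ring.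
Qed.

(** Both signs are treated at once, through equivariance under [stab U x]. With [h * g] as summation
    variable the terms are indexed by that stabilizer, and each becomes [f g]. *)
Lemma eval_unfold x (f : {ffun Sp V -> wr_sort sigma}) g :
  rp_space (S_dot sigma false x) f \/ rp_space (S_dot sigma true x) f ->
  G g (unfold_orbit x f) x = f g.
Proof.
move=> hf.
have fE k : E (f k) by case: hf => -[h _]; exact: h.
have fs h k : h \in stab U x -> f (h * k)%g = sd x h (f k).
  move=> hs; have hpm : h \in pm_stab U x by rewrite inE hs.
  by case: hf => -[_ h2]; rewrite h2//= /sigma_dot_sgn hs.
rewrite !ffunE (sg_Z cs); last by apply: subspace_sum => // k _; exact: unfold_term_in.
rewrite (sg_sum cs) => [|k _]; last exact: unfold_term_in.
rewrite (reindex_inj (mulIg g)) /=.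
rewrite (eq_bigl (mem (stab U x))) => [|h]; last first.
  by rewrite sp_mulE perm_invE -stabE.
rewrite (eq_bigr (fun=> f g)) => [|h hs].
  by rewrite sumr_const -scaler_nat scalerA mulVf ?scale1r// stab_card_neq0.
rewrite sp_mulE perm_invE invMg (sg_M cs); last exact: (rho_in cs).
rewrite mulgA mulgV mul1g fs// /sigma_dot /rho_perp.
have hP : h x - x \in perp U by rewrite -stabE.
have vP := stabV hs; have vP' : x - h^-1%g x \in perp U by rewrite -opprB rpredN.
have -> : ubar_pi U (h x - x) = rU U h (ubar_pi U (x - h^-1%g x)).
  by rewrite rU_ubar// sp_D sp_N perm_invE.
rewrite -(sg_rho cs); last exact: (rho_in cs).
rewrite (sg_KV cs); last by do 2 apply: (rho_in cs).
rewrite (rhoD cs)// am_form_ubar// -ubar_piD//.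
have -> : x - h^-1%g x + (h^-1%g x - x) = 0 by rewrite addrA subrK subrr.
rewrite ubar_pi0 (rho_0 psi_prim cs)// -[RHS]scale1r -(psi0 psi_prim); congr (psi _ *: _).
have -> : am_form x (h x) = am_form (h^-1%g x) x by rewrite -(sp_form h^-1%g) perm_invK.
rewrite !formBl !formBr !am_alt [am_form (h^-1%g x) x]formC; ring.
Qed.

Section Decomposition.
Variables (X : {set V}) (hX : orbit_reps U X).
Local Notation D := (summand_index U X).
(* With the character sums this says that sigma(-Id) is not a scalar. *)
Hypothesis ubar_nondeg : forall c : ubar U, (forall d, am_form d c = 0) -> c = 0.
Hypothesis irrsigma : irreducible (heis_repn sigma).

Lemma index_inr x e : inr (x, e) \in D -> x \notin perp U.
Proof. by rewrite inE; case: hX => h _ _; exact: h. Qed.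

Lemma summand_is_repn : {in D, forall i, is_repn (summand_alt i)}.
Proof.
case=> [e _|[x e] _]; last first.
  by apply: induced_is_repn => [|h]; [exact: sE|exact: sds_lin].
split=> /=.
- case: ifP => _ //; split=> [|a u v [Eu hu] [Ev hv]]; split.
  + exact: sE.1.
  + by rewrite (lin_on0 sE (sg_lin cs opp)) scaler0.
  + exact: sE.2.
  + by rewrite (sg_lin cs)// hu hv scalerDr !scalerA mulrC.
- move=> g v; case: ifP => _; first exact: (sg_in cs).
  move=> [Ev hv]; split; first exact: (sg_in cs).
  by rewrite (sg_M cs)// opp_comm -(sg_M cs)// hv (sg_Z cs).
- by move=> g a u v; case: ifP => _ => [Eu Ev|[Eu _] [Ev _]]; exact: (sg_lin cs).
- by move=> v; case: ifP => _ => [Ev|[Ev _]]; exact: (sg_1 cs).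
- by move=> g h v; case: ifP => _ => [Ev|[Ev _]]; rewrite (sg_M cs).
Qed.

Lemma summand_sub_E e v : rp_space (summand_alt (inl e)) v -> E v.
Proof. by rewrite /=; case: ifP => // _ []. Qed.

Lemma ffun_linE (T : finType) a (u v : {ffun T -> wr_sort sigma}) y :
  (a *: u + v) y = a *: u y + v y.
Proof. by rewrite !ffunE. Qed.

Lemma to_summandP : {in D, forall i, @intertwiner _ _ (grp_repn model) _ (@to_summand i)}.
Proof.
case=> [e _|[x e] /index_inr xP]; split=> /=.
- by move=> a u v Mu Mv; rewrite !ffunE sign_proj_lin//; exact: M_E.
- by move=> phi Mp; apply: sign_proj_in; exact: M_E.
- by move=> g phi Mp; rewrite ffunE (sp_0 g^-1%g) sign_proj_sg//; exact: M_E.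
- move=> a u v Mu Mv; apply/ffunP => g; rewrite eval_orbitE !(sg_lin cM)//.
  rewrite !ffun_linE !eval_orbitE scalerA [a * _]mulrC -scalerA -scalerDr; congr (_ *: _).
  by rewrite !scalerDr !scalerA [a * _]mulrC addrACA.
- by move=> phi; exact: eval_orbit_in.
- move=> g phi Mp; rewrite -[finfun _ in LHS]/(G g phi); apply/ffunP => h.
  by rewrite [RHS]ffunE !eval_orbitE !(sg_M cM)// mulgA.
Qed.

Lemma extend0_sg g v : E v -> @extend0 C F V U sigma (sg g v) = G g (@extend0 C F V U sigma v).
Proof.
move=> Ev; apply/ffunP => x; rewrite !ffunE.
have -> : (g^-1%g x \in perp U) = (x \in perp U).
  apply/idP/idP => h; last exact: sp_perp.
  by rewrite -(perm_invE g x); exact: sp_perp.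
case: ifP => xP; last by rewrite (lin_on0 sE (sg_lin cs g)).
by rewrite (sg_rho cs)// rU_ubar ?sp_perp// perm_invE.
Qed.

Lemma of_summandP :
  {in D, forall i, @intertwiner _ _ (summand_alt i) (grp_repn model) (@of_summand i)}.
Proof.
case=> [e _|[x e] /index_inr xP]; split=> /=.
- move=> a u v /summand_sub_E Eu /summand_sub_E Ev; apply/ffunP => y; rewrite !ffunE.
  by case: ifP => _; rewrite ?(rho_lin cs)// scaler0 addr0.
- by move=> v /summand_sub_E; exact: extend0_in.
- by move=> g v /summand_sub_E Ev; exact: extend0_sg.
- move=> a u v [Eu _] [Ev _]; apply/ffunP => y; rewrite !ffunE.
  rewrite scalerA [a * _]mulrC -scalerA -scalerDr; congr (_ *: _).
  rewrite scaler_sumr -big_split; apply: eq_bigr => g _ /=.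
  by rewrite !ffunE (rho_lin cs)// (sg_lin cs)//; exact: (rho_in cs).
- by move=> f [fE _]; exact: unfold_orbit_in.
- move=> k f [fE _]; apply/ffunP => y; rewrite [in RHS]ffunE !ffunE (sg_Z cs); last first.
    by apply: subspace_sum => // g _; exact: unfold_term_in.
  congr (_ *: _); rewrite (sg_sum cs) => [|g _]; last exact: unfold_term_in.
  rewrite (reindex_inj (mulIg k^-1%g)); apply: eq_big => [g|g _].
    by rewrite sp_mulE.
  rewrite ffunE sp_mulE (sg_M cs); last exact: (rho_in cs).
  by rewrite invMg invgK mulgKV.
Qed.

Lemma sign_projK e v : rp_space (summand_alt (inl e)) v -> sign_proj e v = v.
Proof.
rewrite /= /sign_proj; case: ifP => // _ [Ev ->]; rewrite scalerA sgn_sqr scale1r.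
by rewrite -mulr2n -scaler_nat scalerA mulVf ?scale1r ?two_neq0.
Qed.

Lemma orbit_opp e x (f : {ffun Sp V -> wr_sort sigma}) g : x \notin perp U ->
  rp_space (S_dot sigma e x) f -> f (opp * g)%g = sgn e *: f g.
Proof.
move=> xP [fE ->] /=; last exact: opp_pm_stab.
rewrite /sigma_dot_sgn (negPf (opp_notin_stab xP)) opp_opp /sigma_dot /rho_perp.
have -> : (1^-1%g : Sp V) x = x by rewrite invg1 sp_1E.
have Ef : E (f g) := fE g.
by rewrite subrr ubar_pi0 am_alt mulr0 (rho_0 psi_prim cs)// (sg_1 cs).
Qed.

Lemma eval_unfold_sgn e e' x (f : {ffun Sp V -> wr_sort sigma}) :
  x \notin perp U -> rp_space (S_dot sigma e x) f ->
  eval_orbit e' x (unfold_orbit x f) = if e == e' then f else 0.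
Proof.
move=> xP hf; have hf' : rp_space (S_dot sigma false x) f \/ rp_space (S_dot sigma true x) f.
  by case: (e) hf; [right|left].
apply/ffunP => g; rewrite eval_orbitE !eval_unfold// (orbit_opp _ xP hf) scalerA.
have [<-|ne] := eqVneq.
  by rewrite sgn_sqr scale1r -mulr2n -scaler_nat scalerA mulVf ?scale1r ?two_neq0.
rewrite ffunE (_ : sgn e' * sgn e = -1) ?scaleN1r ?subrr ?scaler0//.
by case: e e' ne {hf} => -[]//= _; rewrite ?expr1 ?expr0 ?mulr1 ?mul1r.
Qed.

Lemma to_of_summand : {in D, forall i v, rp_space (summand_alt i) v ->
  to_summand i (@of_summand i v) = v}.
Proof.
case=> [e _|[x e] /index_inr xP] v hv /=.
  rewrite ffunE rpred0 ubar_pi0 (rho_0 psi_prim cs) ?sign_projK//.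
  exact: summand_sub_E hv.
by rewrite (eval_unfold_sgn _ xP hv) eqxx.
Qed.

Lemma unfold_orbit_out x (f : {ffun Sp V -> wr_sort sigma}) y :
  (forall g : Sp V, g y - x \notin perp U) ->
  unfold_orbit x f y = 0.
Proof.
by move=> h; rewrite ffunE big1 ?scaler0// => g; rewrite (negPf (h g)).
Qed.

(** Distinct summands are supported on disjoint orbits of cosets, [sigma] on the zero coset, or
    share an orbit and differ by the sign of [- Id]. *)
Lemma to_of_summand0 : {in D &, forall i j, i != j ->
  forall v : rp_sort (summand_alt i), rp_space (summand_alt i) v ->
  to_summand j (@of_summand i v) = 0}.
Proof.
case=> [e|[x e]] [e'|[x' e']] iD jD ij v hv /=.
- have Ev := summand_sub_E hv.
  rewrite ffunE rpred0 ubar_pi0 (rho_0 psi_prim cs)//; move: hv iD jD ij.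
  rewrite /= /sign_proj !inE; case: ifP => _ => [_|[_ ->] _ _ ne].
    by rewrite !andbT; case: (e); case: (e').
  rewrite scalerA (_ : sgn e' * sgn e = -1) ?scaleN1r ?subrr ?scaler0//.
  by move: ne; case: (e); case: (e') => //= _; rewrite ?expr1 ?expr0 ?mulr1 ?mul1r.
- have xP := index_inr jD.
  have h0 (g : Sp V) : (G g (extend0 v) : {ffun V -> wr_sort sigma}) x' = 0.
    rewrite !ffunE (_ : (g^-1%g x' \in perp U) = false) ?(lin_on0 sE (sg_lin cs g))//.
    by apply/negP => h; move/negP: xP; apply; rewrite -(perm_invE g x'); exact: sp_perp.
  by apply/ffunP => g; rewrite eval_orbitE !h0 scaler0 addr0 scaler0 ffunE.
- rewrite unfold_orbit_out ?(lin_on0 sE (sign_proj_lin e'))// => g.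
  by rewrite sp_0 add0r rpredN; exact: index_inr iD.
- have xP := index_inr iD.
  have [xx|xx] := eqVneq x x'.
    case: _ / xx ij hv jD => ij hv _; rewrite (eval_unfold_sgn _ xP hv).
    by case: eqP => // ee; case/eqP: ij; rewrite ee.
  have h0 (g : Sp V) : (G g (unfold_orbit x v) : {ffun V -> wr_sort sigma}) x' = 0.
    rewrite ffunE unfold_orbit_out ?(lin_on0 sE (sg_lin cs g))// => k; apply/negP => h.
    move/eqP: xx; apply; apply/esym; case: hX => _ _; apply.
    + by move: jD; rewrite inE.
    + by move: iD; rewrite inE.
    + by exists (k * g^-1)%g; rewrite sp_mulE.
  by apply/ffunP => g; rewrite eval_orbitE !h0 scaler0 addr0 scaler0 ffunE.
Qed.

(** Were [- Id] a scalar, conjugation by it would give [rho (d, 0) = rho (- d, 0)], so [2 d] and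
    hence everything in the quotient would act trivially. Then [psi] would be 1 on all values of a
    nondegenerate form. *)
Lemma sign_nonscalar e : ~~ ubar_trivial U ->
  exists2 v, E v & v + sgn e *: sg opp v != 0.
Proof.
move=> nt; apply: contrapT => h.
have ho v : E v -> sg opp v = - sgn e *: v.
  move=> Ev; have h0 : v + sgn e *: sg opp v = 0.
    by apply/eqP; apply: contrapT => /negP h0; apply: h; exists v.
  move/eqP: h0; rewrite addr_eq0 => /eqP h0; rewrite {2}h0 scaleNr scalerN opprK.
  by rewrite scalerA sgn_sqr scale1r.
have rU_opp c : rU U opp c = - c.
  elim/ubar_ind: c => x xP; rewrite rU_ubar// sp_oppE.
  apply/eqP; rewrite -addr_eq0 -ubar_piD ?rpredN// addNr ubar_pi0.
  by [].
have [v Ev v0] := irreducible_nonzero irrsigma.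
have triv c u : E u -> rho (c, 0) u = u.
  move=> Eu; pose d := 2%:R^-1 *: c : ubar U.
  have -> : c = d + d by rewrite -scalerDl -[2%:R^-1]mulr1 halfD// scale1r.
  have hd w : E w -> rho (d, 0) w = rho (- d, 0) w.
    move=> Ew; have := sg_rho cs opp d 0 Ew; rewrite !ho//; last exact: (rho_in cs).
    rewrite rU_opp (rho_Z cs)// => /(congr1 (fun z => (- sgn e) *: z)).
    by rewrite !scalerA mulrNN sgn_sqr !scale1r.
  have := rhoD cs d d 0 0 Eu; rewrite am_alt mulr0 !addr0 psi0// scale1r => <-.
  rewrite (hd _ (rho_in cs _ Eu)) (rhoD cs)// formNl am_alt oppr0 mulr0 !addr0 psi0//.
  by rewrite addNr scale1r (rho_0 psi_prim cs).
move/negP: nt; apply; apply/forallP => c; apply/eqP; apply: ubar_nondeg => d.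
have := @primitive_form _ _ _ psi_prim (ubar U) [set: ubar U]%SET (c : ubar U).
move=> /(_ _ _ d (finset.in_setT _)); apply.
  by split=> [|a x y _ _]; exact: finset.in_setT.
(* The factor 2 cancels the 1/2 of the Heisenberg law, leaving [psi (am_form c' c)]. *)
move=> c' _; pose d' := 2%:R *: c' : ubar U.
have := rhoD cs d' c 0 0 Ev; rewrite !triv//.
rewrite !add0r formZl mulrA mulVr// mul1r => /esym/eqP.
by rewrite -subr_eq0 -{2}[v]scale1r -scalerBl scaler_eq0 (negPf v0) orbF subr_eq0 => /eqP.
Qed.

Lemma summand_nonzero : {in D, forall i, exists2 v, rp_space (summand_alt i) v & v != 0}.
Proof.
have [v Ev v0] := irreducible_nonzero irrsigma.
case=> [e iD|[x e] /index_inr xP].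
  case nt : (ubar_trivial U); first by exists v => //=; rewrite nt.
  have [w Ew w0] := sign_nonscalar e (negbT nt).
  exists (sign_proj e w); first exact: sign_proj_in.
  by rewrite /sign_proj nt scaler_eq0 invr_eq0 (negPf two_neq0).
(* This translate lives on the coset of [x], which is not that of [- x]; so the two halves of
   [eval_orbit] cannot cancel at 1. *)
pose phi := wr_heis model (- x, 0) (@extend0 C F V U sigma v).
have Mp : M phi by apply: (rho_in cM); exact: extend0_in.
exists (eval_orbit e x phi); first exact: eval_orbit_in.
have px : phi x = v.
  rewrite ffunE /= subrr formNr am_alt oppr0 mulr0 addr0 psi0// scale1r ffunE rpred0.
  by rewrite ubar_pi0 (rho_0 psi_prim cs).
have pNx : phi (- x) = 0.
  rewrite ffunE /= ffunE (_ : (- x - x \in perp U) = false) ?scaler0//.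
  by have := opp_notin_stab xP; rewrite stabE sp_oppE => /negPf.
have h1 : eval_orbit e x phi 1%g = 2%:R^-1 *: v.
  rewrite eval_orbitE (sg_1 cM)// px mulg1 [X in _ + _ *: X]ffunE.
  have -> : (opp^-1%g : Sp V) x = - x by rewrite -{1}[x]opprK -(sp_oppE (- x)) perm_invK.
  by rewrite pNx (lin_on0 sE (sg_lin cs opp)) scaler0 addr0.
apply/eqP => /ffunP/(_ 1%g); rewrite h1 ffunE => /eqP.
by rewrite scaler_eq0 invr_eq0 (negPf two_neq0) (negPf v0).
Qed.

Hypothesis nondeg : forall x : V, (forall y, am_form y x = 0) -> x = 0.
Hypothesis irrM : irreducible (heis_repn model).
Variables (J : finType) (o : V -> J).
Hypothesis o_orbit : forall x y, o x = o y -> exists g : Sp V, g x = y.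
Hypothesis cardJ : (#|J| <= #|D|)%N.

Let span (T : wr_sort model -> wr_sort model) :
  @intertwiner _ _ (grp_repn model) (grp_repn model) T ->
  exists c : J -> C, forall v, M v ->
    T v = \sum_j c j *: \sum_(x | o x == j) wr_heis model (x, 0) v.
Proof.
by move=> hT; exact: (commutant_orbits psi_prim two_unit nondeg cM irrM hT o_orbit).
Qed.

Let M_repn : is_repn (grp_repn model). Proof. by case: cM. Qed.

Lemma decomposition_irreducible : {in D, forall i, irreducible (summand sigma i)}.
Proof.
move=> i iD; rewrite summandE.
exact: (summands_irreducible M_repn span cardJ summand_is_repn summand_nonzero
  to_summandP of_summandP to_of_summand to_of_summand0).
Qed.

Lemma decomposition_distinct :
  {in D &, forall i j, i != j -> ~ repn_iso (summand sigma i) (summand sigma j)}.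
Proof.
move=> i j iD jD ij; rewrite !summandE.
exact: (summands_distinct M_repn span cardJ summand_is_repn summand_nonzero
  to_summandP of_summandP to_of_summand to_of_summand0).
Qed.
End Decomposition.
End Summands.

(** * One-dimensional representations and monomiality *)

Section Monomial.
Variables (C : numClosedFieldType) (gT : finGroupType).

Lemma line_functional (E : vectType C) (v0 : E) : v0 != 0 ->
  exists f : 'Hom(E, C^o), f v0 = 1.
Proof.
move=> v0n; have [||f hf] := @lin_on_extend C E C^o setT (coord [tuple v0] ord0).
- by [].
- by move=> a u v _ _; rewrite linearP.
have fr : free [tuple v0] by rewrite seq1_free.
by exists f; rewrite hf// -[v0 in LHS]/([tuple v0]`_(@ord0 0)) coord_free.
Qed.

Variables (t : repn C gT) (v0 : rp_sort t).
Hypotheses (st : subspace (rp_space t)) (tv0 : rp_space t v0) (v0n : v0 != 0).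
Hypothesis tline : forall v, rp_space t v -> exists a, v = a *: v0.

(* The multiplicativity of the character is read off a nonzero element of the
   induced representation. *)
Lemma induced_line_monomial (H : {group gT}) :
  (forall h, lin_on (rp_space t) (rp_op t h)) ->
  (forall h v, rp_space t v -> rp_space t (rp_op t h v)) ->
  (exists2 f, rp_space (induced H t) f & f != 0) -> monomial (induced H t).
Proof.
move=> lt tt [f0 [f0E f0H] f0n]; have [lam lam1] := line_functional v0n.
have lamE v : rp_space t v -> v = lam v *: v0.
  by move=> /tline[a ->]; rewrite linearZ /= lam1 [a *: 1]mulr1.
pose chi h : C := lam (rp_op t h v0).
have chiE h v : rp_space t v -> rp_op t h v = chi h *: v.
  move=> tv; rewrite {1}(lamE _ tv) (lin_onZ st (lt h))// (lamE _ (tt h _ tv0)).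
  by rewrite -/(chi h) scalerA mulrC -scalerA -lamE.
have [g0 fg0] : exists g, f0 g != 0.
  apply: contrapT => h; case/eqP: f0n; apply/ffunP => g; rewrite ffunE.
  by apply/eqP; apply: contrapT => /negP hg; apply: h; exists g.
have canc a b : a *: f0 g0 = b *: f0 g0 -> a = b.
  by move/eqP; rewrite -subr_eq0 -scalerBl scaler_eq0 (negPf fg0) orbF subr_eq0 => /eqP.
exists H, chi; split.
- by apply: canc; rewrite -chiE// -f0H ?group1// mul1g scale1r.
- move=> g h gH hH; apply: canc; rewrite -chiE// -f0H ?groupM// -mulgA f0H//.
  by rewrite f0H// (chiE _ _ (tt h _ (f0E g0))) (chiE _ _ (f0E g0)) scalerA.
have [||f hf] := @lin_on_extend C {ffun gT -> rp_sort t} {ffun gT -> C^o} setT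
  (fun F => [ffun g => lam (F g)]).
- by [].
- by move=> a u v _ _; apply/ffunP => g; rewrite !ffunE linearP.
exists f; split.
- apply/seteqP; split=> [_ [F [FE FH] <-]|F [_ FH]] /=.
    by rewrite hf//; split=> // h g hH; rewrite !ffunE FH// chiE// linearZ.
  exists [ffun g => F g *: v0]; last first.
    by rewrite hf//; apply/ffunP => g; rewrite !ffunE linearZ /= lam1 [_ *: 1]mulr1.
  split=> [g|h g hH]; rewrite !ffunE; first exact: subspaceZ.
  by rewrite FH// chiE ?scalerA//; exact: subspaceZ.
- move=> F F'; rewrite !inE => -[FE _] [FE' _]; rewrite !hf// => /ffunP h.
  apply/ffunP => g; have := h g; rewrite !ffunE => hg.
  by rewrite [LHS]lamE ?hg -?lamE.
- by move=> g F _; rewrite !hf//; apply/ffunP => h; rewrite !ffunE.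
Qed.

(** The inducing subgroup is the whole group, and [v] becomes its matrix coefficient
    [g -> lam (rp_op t g v)]. *)
Lemma line_monomial : is_repn t -> monomial t.
Proof.
move=> [_ tt lt t1 tM]; have [lam lam1] := line_functional v0n.
have lamE v : rp_space t v -> v = lam v *: v0.
  by move=> /tline[a ->]; rewrite linearZ /= lam1 [a *: 1]mulr1.
pose chi h : C := lam (rp_op t h v0).
have chiE h v : rp_space t v -> lam (rp_op t h v) = chi h * lam v.
  by move=> tv; rewrite {1}(lamE _ tv) (lin_onZ st (lt h))// linearZ mulrC.
exists [set: gT]%G, chi; split.
- by rewrite /chi t1.
- by move=> g h _ _; rewrite {1}/chi tM// chiE//; exact: tt.
have [||f hf] := @lin_on_extend C (rp_sort t) {ffun gT -> C^o} (rp_space t)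
  (fun v => [ffun g => lam (rp_op t g v)]).
- by [].
- by move=> a u v tu tv; apply/ffunP => g; rewrite !ffunE lt// linearP.
exists f; split.
- apply/seteqP; split=> [_ [v tv <-]|F [_ FH]] /=.
    rewrite hf//; split=> // h g _; rewrite !ffunE tM// chiE//; exact: tt.
  exists (F 1%g *: v0); first exact: subspaceZ.
  rewrite hf; last exact: subspaceZ.
  apply/ffunP => g; rewrite ffunE (lin_onZ st (lt g))// linearZ /= -/(chi g).
  by rewrite -[g in RHS]mulg1 FH ?inE//= [_ *: _]mulrC.
- move=> u v; rewrite !inE => tu tv; rewrite !hf// => /ffunP/(_ 1%g).
  by rewrite !ffunE !t1// => h; rewrite (lamE _ tu) h -lamE.
- move=> g v tv; rewrite hf; last exact: tt.
  by rewrite hf//; apply/ffunP => h; rewrite !ffunE tM.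
Qed.
End Monomial.

Section MonomialSummands.
Variables (C : numClosedFieldType) (F : finComUnitRingType) (psi : F -> C).
Hypothesis psi_prim : primitive_char psi.
Variables (V : altMod F) (U : invIso V).
Hypothesis two_unit : (2%:R : F) \is a GRing.unit.
Variable sigma : weilRep C (ubar U) (Sp V).
Hypothesis hsigma : is_weil psi (rU U) sigma.
Let cs := is_weil_core hsigma.
Hypothesis triv : ubar_trivial U.
Variable X : {set V}.
Hypothesis nonzero : {in summand_index U X, forall i,
  exists2 v, rp_space (summand sigma i) v & v != 0}.

(** The Heisenberg group of the zero module is its centre, which acts by scalars; every line is then
    stable, so irreducibility leaves a single one. *)
Lemma trivial_line : exists v0, [/\ wr_space sigma v0, v0 != 0 &
  forall v, wr_space sigma v -> exists a, v = a *: v0].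
Proof.
have [[irr _] cen _ _] := hsigma.
have [v0 Ev0 v0n] := irreducible_nonzero irr; exists v0; split=> // v Ev.
pose A := [set v | exists a, v = a *: v0]%classic.
have [_ _ h] := irr; have [|||A0|AE] := h A.
- split; first by exists 0; rewrite scale0r.
  by move=> a _ _ [b ->] [c ->]; exists (a * b + c); rewrite scalerDl scalerA.
- by move=> _ [a ->]; exact: (space_Z cs).
- move=> [c t] _ [a ->]; have /eqP -> : c == 0 by move/forallP: triv.
  by rewrite /= cen; [exists (psi t * a); rewrite scalerA|exact: (space_Z cs)].
- have : A v0 by exists 1; rewrite scale1r.
  by rewrite A0 /= => h0; rewrite h0 eqxx in v0n.
- suff : A v by [].
  by rewrite AE.
Qed.

(** On the line [sigma] the operators [sigma_dot_sgn] are scalars. That these form a character of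
    [pm_stab U x] is drawn from a nonzero function in the summand, whence the hypothesis
    [nonzero]. *)
Lemma decomposition_monomial :
  {in summand_index U X, forall i, monomial (summand sigma i)}.
Proof.
have [v0 [Ev0 v0n line]] := trivial_line.
move=> i iD; have := nonzero iD; case: i iD => [e|[x e]] iD /=.
  rewrite triv => _; apply: (@line_monomial _ _ (grp_repn sigma) v0) => //; first exact: (wspace cs).
  by case: hsigma.
move=> nz; rewrite /S_dot -[pm_stab U x]/(gval (Group (pm_stab_group U x))).
apply: (@induced_line_monomial _ _ (Repn (wr_space sigma) (sigma_dot_sgn e x)) v0) => //=; first exact: (wspace cs).
- exact: (sds_lin hsigma).
move=> h v Ev; rewrite /sigma_dot_sgn; case: ifP => _; last apply: (space_Z cs).
all: exact: (sd_in hsigma).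
Qed.
End MonomialSummands.

(** * Counting orbits *)

Section Counting.
Variables (F : finComUnitRingType) (V : altMod F) (U : invIso V) (n : nat).

(** [lev v] models the index of the last term of the chain containing [v]; the count sees the
    lattices only through these properties. [lev_even] reflects that [P] differs from pi [P'].
    Whether odd levels occur depends on [P'] and [P] being different, which is left to the two
    definitions below. *)
Record level_structure (lev : V -> nat) : Prop := LevelStructure {
  lev_le : forall v, (lev v <= n.*2.+1)%N;
  lev_sp : forall (g : Sp V) v, lev (g v) = lev v;
  lev_trans : forall v w, lev v = lev w -> exists g : Sp V, g v = w;
  lev_perp : forall v, (v \in perp U) = (n <= lev v)%N;
  lev_ii : forall v, (v \in ii_set U) = (n < lev v)%N;
  lev_sub : forall j v w, (j <= lev v)%N -> (j <= lev w)%N -> (j <= lev (v - w)%R)%N;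
  lev_even : forall j, ~~ odd j -> (j <= n.*2)%N -> exists v, lev v = j
}.

Definition full_levels (lev : V -> nat) : Prop :=
  forall j, odd j -> (j <= n.*2)%N -> exists v, lev v = j.
(** The exception is the level of the zero vector, whose index is odd in every case. *)
Definition half_levels (lev : V -> nat) : Prop :=
  forall v, odd (lev v) -> lev v = n.*2.+1.

Variables (lev : V -> nat) (hlev : level_structure lev).
Variables (X : {set V}) (hX : orbit_reps U X).

(** The ultrametric principle: a perturbation deeper than [w] does not change its level. So outside
    the orthogonal of [U] the level is a function of the coset. *)
Lemma lev_cong v w j : (lev w < j)%N -> (j <= lev (v - w)%R)%N -> lev v = lev w.
Proof.
move=> wj hj.
have lev0 i u : (i <= lev u)%N -> (i <= lev 0%R)%N.
  by move=> iu; rewrite -(subrr u); exact: (lev_sub hlev).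
have levN i u : (i <= lev u)%N -> (i <= lev (- u)%R)%N.
  by move=> iu; rewrite -sub0r; apply: (lev_sub hlev) => //; exact: lev0 iu.
have levD i u u' : (i <= lev u)%N -> (i <= lev u')%N -> (i <= lev (u + u')%R)%N.
  by move=> iu iu'; rewrite -[u']opprK; apply: (lev_sub hlev) => //; exact: levN.
apply/eqP; rewrite eqn_leq; apply/andP; split.
  rewrite leqNgt; apply/negP => h; suff : (lev w < lev w)%N by rewrite ltnn.
  have -> : w = v - (v - w) by rewrite opprB addrC subrK.
  rewrite {1}opprB addrC subrK; apply: (lev_sub hlev) => //; exact: leq_trans wj hj.
by rewrite -[v](subrK w); apply: levD => //; apply: ltnW; exact: leq_trans wj hj.
Qed.

(** A level below [n] is one orbit of vectors and also one orbit of nonzero cosets, so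
    representatives correspond to attained levels below [n]. *)
Lemma lev_reps (A : {set 'I_n}) :
  (forall j : 'I_n, j \in A <-> exists v, lev v = j) -> #|X| = #|A|.
Proof.
move=> hA; have [X1 X2 X3] := hX.
have levX x : x \in X -> (lev x < n)%N by move=> /X1; rewrite (lev_perp hlev) -ltnNge.
(* For [n = 0] every vector is orthogonal to [U] and [X] is empty; [inord] needs a successor. *)
case: n A hA levX (lev_perp hlev) => [|n'] A hA levX levp.
  rewrite !eq_card0// => [[]//|x]; apply/negP => /levX; by rewrite ltn0.
rewrite -(card_in_imset (f := fun x => inord (lev x) : 'I_n'.+1) (D := X)); last first.
  move=> x y xX yX /(congr1 val); rewrite /= !inordK ?levX// => /(lev_trans hlev)[g gxy].
  by apply: X3 => //; exists g; rewrite gxy subrr rpred0.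
apply: eq_card => j; apply/imsetP/idP => [[x xX ->]|/hA[v hv]].
  by apply/hA; exists x; rewrite inordK ?levX.
have vP : v \notin perp U by rewrite levp -ltnNge hv.
have [x xX [g gP]] := X2 _ vP; exists x => //; apply: val_inj; rewrite /= inordK ?levX//.
have e : lev (g x) = lev v.
  by apply: (lev_cong (j := n'.+1)); [rewrite hv|rewrite -levp].
by rewrite -hv -e (lev_sp hlev).
Qed.

Lemma card_index : #|summand_index U X| = (2 * #|X| + (if ubar_trivial U then 1 else 2))%N.
Proof.
pose A := [set e : bool | ~~ (e && ubar_trivial U)]%SET.
have -> : summand_index U X =
    [set inl e | e in A]%SET :|: [set inr p | p in finset.setX X [set: bool]%SET]%SET.
  apply/setP => i; rewrite finset.in_setU; case: i => [e|[x e]].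
    rewrite mem_imset; last by move=> ? ? [].
    rewrite !inE; case: imsetP => [[]//|_]; by rewrite orbF.
  rewrite [X in _ || X]mem_imset; last by move=> ? ? [].
  rewrite !inE andbT; case: imsetP => [[]//|_]; by [].
rewrite cardsU disjoint_setI0; last first.
  by apply/pred0P => i; apply/negP => /andP[/imsetP[e _ ->] /imsetP[]].
rewrite cards0 subn0 !card_imset; try by move=> ? ? [].
rewrite cardsX cardsT card_bool mulnC addnC; congr (_ + _)%N.
rewrite -sum1_card big_mkcond big_bool /= !inE /=.
by case: (ubar_trivial U).
Qed.

Lemma ubar_trivial_lev : reflect (forall v, lev v != n) (ubar_trivial U).
Proof.
apply: (iffP forallP) => [h v|h c].
  apply/eqP => vn; have vP : v \in perp U by rewrite (lev_perp hlev) vn.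
  by have := h (ubar_pi U v); rewrite ubar_pi_eq0// (lev_ii hlev) vn ltnn.
rewrite -(ubar_reprK c) ubar_pi_eq0 ?ubar_reprP// (lev_ii hlev) ltn_neqAle eq_sym h.
by rewrite -(lev_perp hlev) ubar_reprP.
Qed.

(** Each of the [n] levels below [n] carries two signs; level [n] being attained, the quotient is
    nonzero and [sigma] splits in two. *)
Lemma card_index_full : full_levels lev -> #|summand_index U X| = (2 * n + 2)%N.
Proof.
move=> fl; have att j : (j <= n.*2)%N -> exists v, lev v = j.
  by move=> jn; have [oj|oj] := boolP (odd j); [exact: fl|exact: (lev_even hlev)].
rewrite card_index (lev_reps (A := [set: 'I_n]%SET)) => [|j]; last first.
  split=> [_|_]; last exact: finset.in_setT.
  apply: att; apply: ltnW; apply: leq_trans (ltn_ord j) _.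
  by rewrite -addnn leq_addr.
rewrite cardsT card_ord; case: (ubar_trivial_lev) => // h.
have [|v /eqP] := att n; first by rewrite -addnn leq_addr.
by rewrite (negPf (h v)).
Qed.

Lemma card_even k : #|[set j : 'I_k | ~~ odd j]%SET| = uphalf k.
Proof.
rewrite -sum1_card; under eq_bigl do rewrite inE.
rewrite -(big_mkord (fun j => ~~ odd j) (fun=> 1%N)) big_mkcond /=.
elim: k => [|k IH]; first by rewrite big_geq.
rewrite big_nat_recr //= IH uphalf_half /=; case: (odd k) => /=; lia.
Qed.

(** Parity acts on both terms. For [n] odd, (n+1)/2 levels count twice and [sigma] once; for [n]
    even, n/2 levels count twice and [sigma] twice. *)
Lemma card_index_half : half_levels lev -> #|summand_index U X| = (n + 2)%N.
Proof.
move=> hl; rewrite card_index (lev_reps (A := [set j : 'I_n | ~~ odd j]%SET)) => [|j].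
  rewrite card_even; case: ubar_trivial_lev => h.
    have on : odd n.
      apply: contraT => on; have [|v /eqP] := lev_even hlev on; first by rewrite -addnn leq_addr.
      by rewrite (negPf (h v)).
    by rewrite uphalf_half on; have := odd_double_half n; rewrite on; lia.
  have on : ~~ odd n.
    apply/negP => on; apply: h => v; apply/eqP => vn; have := hl v; rewrite vn => /(_ on).
    by lia.
  by rewrite uphalf_half (negPf on); have := odd_double_half n; rewrite (negPf on); lia.
rewrite inE; split=> [oj|[v vj]].
  by apply: (lev_even hlev) => //; have := ltn_ord j; lia.
apply/negP => oj; have := hl v; rewrite vj => /(_ oj); have := ltn_ord j; lia.
Qed.

Lemma half_trivial : half_levels lev -> odd n -> ubar_trivial U.
Proof.
move=> hl on; apply/ubar_trivial_lev => v; apply/eqP => vn.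
by have := hl v; rewrite vn => /(_ on); lia.
Qed.

Lemma orbit_index : full_levels lev \/ half_levels lev ->
  exists (J : finType) (o : V -> J), (#|J| <= #|summand_index U X|)%N /\
    forall v w, o v = o w -> exists g : Sp V, g v = w.
Proof.
case=> h.
  exists 'I_(n.*2.+2), (fun v => inord (lev v)); split.
    by rewrite card_ord card_index_full//; lia.
  move=> v w /(congr1 val); rewrite /= !inordK ?ltnS ?(lev_le hlev)//.
  exact: (lev_trans hlev).
(* [uphalf] renumbers the possible levels 0, 2, ..., 2n and 2n+1 as 0, 1, ..., n and n+1. *)
exists 'I_(n.+2), (fun v => inord (uphalf (lev v))); split.
  by rewrite card_ord card_index_half//; lia.
have le v : (uphalf (lev v) < n.+2)%N.
  have := lev_le hlev v; have := odd_double_half (lev v); rewrite uphalf_half; lia.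
move=> v w /(congr1 val); rewrite /= !inordK// !uphalf_half => hvw.
apply: (lev_trans hlev); move: hvw (h v) (h w) (lev_le hlev v) (lev_le hlev w).
have := odd_double_half (lev v); have := odd_double_half (lev w).
case: (odd (lev v)); case: (odd (lev w)) => /=; lia.
Qed.
End Counting.

Theorem weil_decomposition (C : numClosedFieldType) (F : finComUnitRingType)
    (psi : F -> C) (V : altMod F) (U : invIso V) (n : nat) (lev : V -> nat) :
  primitive_char psi -> (2%:R : F) \is a GRing.unit ->
  (forall x : V, (forall y, am_form y x = 0) -> x = 0) ->
  (forall x, x \in perp U -> {in perp U, forall y, am_form y x = 0} -> x \in ii_set U) ->
  level_structure U n lev -> full_levels n lev \/ half_levels n lev ->
  forall S : weilRep C V (Sp V), is_weil psi id S ->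
  exists sigma : weilRep C (ubar U) (Sp V),
  [/\ is_weil psi (rU U) sigma,
      weil_iso S (weil_model psi sigma),
      forall sigma' : weilRep C (ubar U) (Sp V), is_weil psi (rU U) sigma' ->
        weil_iso S (weil_model psi sigma') -> weil_iso sigma sigma'
    & forall X : {set V}, orbit_reps U X ->
      let D := summand_index U X in
      [/\ {in D, forall i, irreducible (summand sigma i)},
          {in D &, forall i j, i != j ->
             ~ repn_iso (summand sigma i) (summand sigma j)},
          full_levels n lev -> #|D| = (2 * n + 2)%N,
          half_levels n lev -> #|D| = (n + 2)%N
        & half_levels n lev -> odd n -> {in D, forall i, monomial (summand sigma i)}]].
Proof.
move=> psi_prim two_unit nondeg perp_perp hlev hcase S hS.
have hsigma := fixed_is_weil psi_prim U two_unit nondeg hS.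
have hiso := fixed_model_iso psi_prim U two_unit nondeg hS.
exists (fixed_rep U S); split=> //.
  by move=> sigma' hs'; exact: (fixed_unique psi_prim two_unit hS hs').
move=> X hX D; set sigma := fixed_rep U S in hsigma hiso *.
have cM := weil_iso_core hiso (is_weil_core hS).
have irrM : irreducible (heis_repn (weil_model psi sigma)).
  by apply: iso_irreducible (weil_iso_heis hiso) _; case: hS => -[].
have irrs : irreducible (heis_repn sigma) by case: hsigma => -[].
have unondeg (c : ubar U) : (forall d, am_form d c = 0) -> c = 0.
  elim/ubar_ind: c => x xP h; apply/eqP; rewrite ubar_pi_eq0//; apply: perp_perp => // y yP.
  by rewrite -(am_form_ubar yP xP).
have [J [o [cJ ho]]] := orbit_index hlev hX hcase.
split.
- exact: (decomposition_irreducible psi_prim two_unit hsigma cM hX unondeg irrs nondeg irrM ho cJ).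
- exact: (decomposition_distinct psi_prim two_unit hsigma cM hX unondeg irrs nondeg irrM ho cJ).
- exact: (card_index_full hlev).
- exact: (card_index_half hlev).
- move=> hl on; apply: (decomposition_monomial hsigma) => //; first exact: (half_trivial hlev).
  move=> i iD; rewrite summandE.
  exact: (summand_nonzero psi_prim two_unit hsigma cM hX unondeg irrs iD).
Qed.

(** * Double duality of lattices *)

Section ValuationExtra.
Variable k : localField.

Lemma val_inv (x : k) : x != 0 -> lf_val x^-1 = - lf_val x.
Proof.
move=> x0; have := lf_valM x0 (invr_neq0 x0); rewrite divff// val1 => /esym/eqP.
by rewrite addrC addr_eq0 => /eqP.
Qed.

Lemma ppow_val (x : k) : x \in ppow k (lf_val x).
Proof. by rewrite inE lexx orbT. Qed.

Lemma ppow_inv (x : k) i : x != 0 -> x \notin ppow k (i + 1) -> x^-1 \in ppow k (- i).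
Proof.
move=> x0; rewrite !inE (negPf x0) /= -ltNge => h.
by rewrite val_inv// lerN2 -ltzD1 h orbT.
Qed.

Lemma ppow_div (x y : k) : y != 0 -> (x == 0) || (lf_val y <= lf_val x) -> x / y \in ppow k 0.
Proof.
move=> y0 h; have := ppowM (h : x \in ppow k (lf_val y)) (ppow_val y^-1).
by rewrite val_inv// subrr.
Qed.
End ValuationExtra.

Section Bidual.
Variables (k : localField) (W : sympSpace k).
Local Notation pi := (lf_unif k).
Local Notation e := (vbasis {:W}%VS).
Local Notation d := (\dim {:W}%VS).

(** The balls [vball (- i)] are open and exhaust the space, so compactness leaves finitely many. *)
Lemma lattice_bounded (L : lattice W) :
  exists N : int, forall x j, x \in L -> coord e j x \in ppow k N.
Proof.
have := @lat_compact _ _ L; rewrite compact_cover => /(_ nat setT (fun i => @vball k W (- i%:Z))).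
case=> [i _|x _|s _ hs].
- rewrite vopenE => w hw; exists (- i%:Z) => w' hw' j.
  have -> : (w' : W) = (w' : W) - (w : W) + (w : W) by rewrite subrK.
  by rewrite linearD /=; apply: ppowD; [exact: hw'|exact: hw].
- exists (\max_(j < d) `|lf_val (coord e j (x : W))|)%N => //= j.
  rewrite inE; apply/orP; right.
  have absN (z : int) (m : nat) : (`|z| <= m)%N -> - m%:Z <= z by lia.
  exact/absN/(leq_bigmax (F := fun j => `|lf_val (coord e j (x : W))|%N)).
- exists (- (\max_(i <- finmap.enum_fset s) i)%N%:Z) => x j /hs[i /= si /(_ j)].
  apply: ppowW; rewrite lerN2 lez_nat.
  exact: (leq_bigmax_seq (F := id)).
Qed.

Lemma lattice_ball (L : lattice W) :
  exists N : int, forall x, (forall j, coord e j x \in ppow k N) -> x \in L.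
Proof.
have [N hN] := (@lat_open _ _ L : vopen _) _ (os_0 L); exists N => x hx.
by apply: hN => j; rewrite subr0.
Qed.

Lemma functional (f : W -> k) : (forall a u v, f (a *: u + v) = a * f u + f v) ->
  exists l : 'Hom(W, k^o), forall w, l w = f w.
Proof.
move=> hf; have [||l hl] := @lin_on_extend k W k^o setT f.
- by [].
- by move=> a u v _ _; exact: hf.
by exists l => w; exact: hl.
Qed.

(* A non-archimedean Hahn-Banach argument along the flag of the basis e: in each
   step the lattice contains a vector whose new coordinate has minimal valuation. *)
Lemma lattice_separation (L : lattice W) (i : nat) : (i <= d)%N ->
  forall x, (forall j : 'I_d, (i <= j)%N -> coord e j x = 0) -> x \notin L ->
  exists l : 'Hom(W, k^o), (l x : k) \notin ppow k 0 /\
    forall b, b \in L -> (forall j : 'I_d, (i <= j)%N -> coord e j b = 0) ->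
    (l b : k) \in ppow k 0.
Proof.
have cb x : x = \sum_(j < d) coord e j x *: e`_j.
  exact: coord_basis (vbasisP _) (memvf x).
have cZ a (w : W) (j : 'I_d) : coord e j (a *: w) = a * coord e j w by rewrite linearZ.
have fr : free e by exact: basis_free (vbasisP _).
have ce (j j' : 'I_d) : coord e j e`_j' = (j == j')%:R.
  by rewrite (coord_free _ _ fr) eq_sym.
elim: i => [|i IH] id x hx xL.
  by case/negP: xL; rewrite (cb x) big1 ?os_0// => j _; rewrite hx// scale0r.
pose j0 := Ordinal id.
pose Z b := forall j : 'I_d, (i.+1 <= j)%N -> coord e j b = 0.
have [N hN] := lattice_bounded L; have [N' hN'] := lattice_ball L.
have [b0 [b0L b0Z b0n b0min]] : exists b0, [/\ b0 \in L, Z b0, coord e j0 b0 != 0 &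
    forall b, b \in L -> Z b -> coord e j0 b / coord e j0 b0 \in ppow k 0].
  (* Shifting valuations by the bound [N] of the lattice makes them natural numbers, so that a least
     one exists; a small multiple of the basis vector shows that there are any. *)
  pose P m := `[< exists b, [/\ b \in L, Z b, coord e j0 b != 0 &
    lf_val (coord e j0 b) = N + m%:Z] >].
  have shift b : b \in L -> coord e j0 b != 0 -> exists m : nat, lf_val (coord e j0 b) = N + m%:Z.
    move=> bL b0; have := hN b j0 bL; rewrite inE (negPf b0) /= => h.
    by exists `|lf_val (coord e j0 b) - N|%N; lia.
  have exP : exists m, P m.
    pose b := pi ^ N' *: e`_j0.
    have cj j : coord e j b = if j == j0 then pi ^ N' else 0.
      by rewrite cZ (ce j j0); case: eqP => _; rewrite ?mulr1 ?mulr0.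
    have bL : b \in L by apply: hN' => j; rewrite cj; case: eqP => _; [exact: ppow_unif|exact: ppow0].
    have bn : coord e j0 b != 0 by rewrite cj eqxx unifX_neq0.
    have [m hm] := shift b bL bn; exists m; apply/asboolP; exists b; split=> // j ij.
    rewrite cj; case: eqP => // jj; move: ij; rewrite jj /= ltnn.
    by [].
  case: (ex_minnP exP) => m /asboolP[b0 [b0L b0Z b0n b0v]] hmin.
  exists b0; split=> // b bL bZ; apply: ppow_div => //.
  have [//|bn] := eqVneq (coord e j0 b) 0.
  have [m' hm'] := shift b bL bn; rewrite b0v hm' /= lerD2l lez_nat; apply: hmin.
  by apply/asboolP; exists b.
pose c0 := coord e j0 b0; pose q w := coord e j0 w / c0.
have qlin a u v : q (a *: u + v) = a * q u + q v.
  by rewrite /q linearP /= mulrDl mulrA.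
have redZ w : Z w -> forall j : 'I_d, (i <= j)%N -> coord e j (w - q w *: b0) = 0.
  move=> wZ j ij; rewrite linearB /= cZ; have [ji|ji] := eqVneq j j0.
    by rewrite ji /q divfK ?subrr.
  have ij' : (i < j)%N by rewrite ltn_neqAle ij andbT eq_sym; apply: contraNneq ji => h; apply/eqP/val_inj.
  by rewrite wZ// b0Z// mulr0 subrr.
(* If [q x] is not integral, [q] itself separates. Otherwise subtracting [q x *: b0] descends one
   step in the flag and stays outside [L]. *)
have [qx|qx] := boolP (q x \in ppow k 0); last first.
  have [l hl] := functional qlin; exists l; split=> [|b bL bZ]; rewrite hl//.
  exact: b0min.
have x'L : x - q x *: b0 \notin L.
  apply: contra xL => h; rewrite -[x](subrK (q x *: b0)); apply: os_D => //.
  exact: os_Z.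
have [l' [l'x hl']] := IH (ltnW id) _ (redZ _ hx) x'L.
have [|l hl] := @functional (fun w => l' (w - q w *: b0)).
  move=> a u v; rewrite qlin scalerDl -scalerA opprD addrACA -scalerBr.
  by rewrite linearP.
exists l; split=> [|b bL bZ]; rewrite hl//; apply: hl'; last exact: redZ.
rewrite rpredB//; apply: os_Z => //; exact: b0min.
Qed.

(** Nondegeneracy makes the Gram matrix invertible, as a left kernel vector gives a vector
    orthogonal to the basis. *)
Lemma form_represents (l : 'Hom(W, k^o)) : exists y, forall w, l w = ss_form w y.
Proof.
have cb x : x = \sum_(j < d) coord e j x *: e`_j.
  exact: coord_basis (vbasisP _) (memvf x).
have suml (I : finType) (a : I -> k) (u : I -> W) y :
    ss_form (\sum_i a i *: u i) y = \sum_i a i * ss_form (u i) y.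
  elim/big_rec2: _ => [|i z w _ <-]; first by rewrite wform0l.
  by rewrite wformDl wformZl.
have sumr (I : finType) (a : I -> k) (u : I -> W) x :
    ss_form x (\sum_i a i *: u i) = \sum_i a i * ss_form x (u i).
  elim/big_rec2: _ => [|i z w _ <-]; first by rewrite wform0r.
  by rewrite wformDr wformZr.
pose A : 'M[k]_d := \matrix_(i, j) ss_form e`_i e`_j.
have Au : A \in unitmx.
  rewrite -row_free_unit -kermx_eq0; apply: contraT => /rowV0Pn[x /sub_kermxP xA x0].
  pose w := \sum_i x 0 i *: e`_i.
  have w0 : w = 0.
    apply: ss_nondegenerate => y; rewrite (cb y) sumr big1 // => j _.
    have := congr1 (fun B : 'rV_d => B 0 j) xA; rewrite !mxE /w suml.
    under eq_bigr do rewrite mxE; move=> ->; rewrite mulr0.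
    by [].
  case/negP: x0; apply/eqP/rowP => i; rewrite mxE.
  by have /freeP := basis_free (vbasisP {:W}%VS); apply; exact: w0.
pose v : 'cV[k]_d := \col_i l e`_i.
pose y := \sum_j (invmx A *m v) j 0 *: e`_j.
exists y => w; rewrite [in LHS](cb w) linear_sum [in RHS](cb w) suml.
apply: eq_bigr => i _; rewrite linearZ /=; congr (_ * _).
rewrite sumr; have := congr1 (fun B : 'cV_d => B i 0) (mulKVmx Au v); rewrite !mxE => <-.
by apply: eq_bigr => j _; rewrite mulrC !mxE.
Qed.

Lemma lattice_bidual (lam : int) (L : lattice W) x :
  (forall y, y \in dual lam L -> ss_form x y \in ppow k lam) -> x \in L.
Proof.
move=> h; apply: contraT => xL.
have [|l [lx lL]] := lattice_separation (leqnn d) (x := x) _ xL.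
  by move=> j; rewrite leqNgt ltn_ord.
have [y hy] := form_represents l.
have yd : pi ^ lam *: y \in dual lam L.
  apply/dualP => b bL; rewrite wformC wformZr ppowN// ppow_shift subrr -hy.
  by apply: lL => // j; rewrite leqNgt ltn_ord.
by have := h _ yd; rewrite wformZr ppow_shift subrr -hy (negPf lx).
Qed.
End Bidual.

(** * The chain of lattices *)

Section LatticePair.
Variables (k : localField) (W : sympSpace k) (n : nat) (d : sqData W n) (P' : osub W).
Local Notation pi := (lf_unif k).
Local Notation P := (sqd_P d).
Local Notation Q := (sqd_Q d).
Local Notation c := (sqd_c d).
Local Notation V := (sqm d).
Hypothesis QE : Q =i oscale n.+1 P'.
Hypothesis dualP : forall x, (forall b, b \in P -> c * ss_form x b \in ppow k 0) <-> x \in P'.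
Hypothesis dualP' : forall x, (forall b, b \in P' -> c * ss_form x b \in ppow k 0) <-> x \in P.
Hypothesis sub1 : {subset oscale 1 P' <= P}.
Hypothesis sub2 : {subset P <= P'}.

Let dual_scale (L : osub W) i x :
  (forall b, b \in L -> c * ss_form (pi ^ (- i) *: x) b \in ppow k 0) <->
  (forall b, b \in L -> c * ss_form x b \in ppow k i).
Proof.
by split=> h b bL; have := h b bL; rewrite wformZl mulrCA ppow_shift sub0r opprK.
Qed.

Lemma mem_scale_dual i x :
  x \in oscale i P' <-> forall b, b \in P -> c * ss_form x b \in ppow k i.
Proof. by rewrite in_oscale -dual_scale; apply: iff_sym; exact: dualP. Qed.

Lemma mem_scale i x :
  x \in oscale i P <-> forall b, b \in P' -> c * ss_form x b \in ppow k i.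
Proof. by rewrite in_oscale -dual_scale; apply: iff_sym; exact: dualP'. Qed.

(* P > pi P' > pi P > pi^2 P' > ... > pi^(n+1) P' = Q *)
Definition chain (j : nat) : osub W :=
  if odd j then oscale j./2.+1 P' else oscale j./2 P.

Lemma chain_double i : chain i.*2 = oscale i P.
Proof. by rewrite /chain odd_double doubleK. Qed.
Lemma chain_doubleS i : chain i.*2.+1 = oscale i.+1 P'.
Proof. by rewrite /chain /= odd_double uphalf_double. Qed.

Lemma parity j : (exists i, j = i.*2) \/ (exists i, j = i.*2.+1).
Proof.
rewrite -(odd_double_half j); case: (odd j); [right|left]; exists j./2 => //.
Qed.

Lemma chainS j : {subset chain j.+1 <= chain j}.
Proof.
move=> x; have [[i ->]|[i ->]] := parity j.
  rewrite chain_doubleS chain_double !in_oscale => h; apply: sub1.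
  by rewrite in_oscale unifXD -opprD -PoszD add1n.
by rewrite -doubleS chain_double chain_doubleS !in_oscale; exact: sub2.
Qed.

Lemma chain_mono i j : (i <= j)%N -> {subset chain j <= chain i}.
Proof.
move=> ij x; rewrite -(subnK ij); elim: (j - i)%N => [//|m IH].
by rewrite addSn => /chainS/IH.
Qed.

Lemma chain_top : chain n.*2.+1 =i Q.
Proof. by move=> x; rewrite chain_doubleS QE. Qed.
Lemma chain0 x : (x \in chain 0) = (x \in P).
Proof. by rewrite -[0%N]double0 chain_double in_oscale oppr0 expr0z scale1r. Qed.

Lemma chain1 : chain 1 = oscale 1 P'.
Proof. by []. Qed.
Lemma chain2 : chain 2 = oscale 1 P.
Proof. by []. Qed.

Lemma oscaleP i (L : osub W) x : x \in oscale i L -> exists2 b, b \in L & x = pi ^ i *: b.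
Proof. by rewrite in_oscale => h; exists (pi ^ (- i) *: x); rewrite ?unifXK. Qed.
Lemma mem_oscale i (L : osub W) b : b \in L -> pi ^ i *: b \in oscale i L.
Proof. by move=> bL; rewrite in_oscale unifXD addNr expr0z scale1r. Qed.

(** Duality exchanges the multiples of [P] with those of [P'], that is even indices with odd ones,
    which is why the two indices add up to the odd number 2n+1. *)
Lemma chain_dual j x : (j <= n.*2.+1)%N ->
  (forall y, y \in chain j -> c * ss_form x y \in ppow k n.+1) <->
  x \in chain (n.*2.+1 - j).
Proof.
have [[i ->]|[i ->]] := parity j => jn.
  have -> : (n.*2.+1 - i.*2 = (n - i).*2.+1)%N by lia.
  have ni : (n - i).+1%:Z = n.+1%:Z - i%:Z by lia.
  rewrite chain_doubleS chain_double mem_scale_dual ni; split=> h b.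
    by move=> /(mem_oscale i%:Z)/h; rewrite wformZr mulrCA ppow_shift.
  by move=> /oscaleP[b' b'P ->]; rewrite wformZr mulrCA ppow_shift h.
have -> : (n.*2.+1 - i.*2.+1 = (n - i).*2)%N by lia.
have ni : (n - i)%N%:Z = n.+1%:Z - i.+1%:Z by lia.
rewrite chain_doubleS chain_double mem_scale ni; split=> h b.
  by move=> /(mem_oscale i.+1%:Z)/h; rewrite wformZr mulrCA ppow_shift.
by move=> /oscaleP[b' b'P ->]; rewrite wformZr mulrCA ppow_shift h.
Qed.

Lemma chain_sub j : {subset chain j <= P}.
Proof. by move=> x /(chain_mono (leq0n j)); rewrite chain0. Qed.

(** The last term of the chain is [Q], contained in all others, so the choice of representative does
    not matter; see [level_pi]. *)
Definition level (v : V) : nat :=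
  \max_(j < n.*2.+2 | sqm_repr v \in chain j) j.

Lemma level_le v : (level v <= n.*2.+1)%N.
Proof. by apply/bigmax_leqP => j _; rewrite -ltnS. Qed.

Lemma level_repr j v : (j <= n.*2.+1)%N -> (j <= level v)%N = (sqm_repr v \in chain j).
Proof.
move=> jn; apply/idP/idP => [h|h]; last first.
  by have := @leq_bigmax_cond _ (fun j : 'I__ => sqm_repr v \in chain j) (fun j => val j)
    (Ordinal (jn : (j < n.*2.+2)%N)) h.
have [|j0 vj0 lE] := @eq_bigmax_cond _ (fun j : 'I_n.*2.+2 => sqm_repr v \in chain j) (fun j => val j).
  by apply/card_gt0P; exists ord0; change (sqm_repr v \in chain 0); rewrite chain0 sq_reprP.
by apply: chain_mono vj0; move: h; rewrite /level lE.
Qed.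

Lemma level_pi j x : (j <= n.*2.+1)%N -> x \in P ->
  (j <= level (sqm_pi d x))%N = (x \in chain j).
Proof.
move=> jn xP; rewrite level_repr//.
have : sqm_repr (sqm_pi d x) - x \in chain j.
  by apply: (chain_mono jn); rewrite chain_top; exact: sq_repr_pi.
move=> h; apply/idP/idP => hx; last by rewrite -[sqm_repr _](subrK x) rpredD.
by rewrite -[x](subKr (sqm_repr (sqm_pi d x))) rpredB.
Qed.

Lemma level_pi_eq j x : (j < n.*2.+1)%N -> x \in chain j -> x \notin chain j.+1 ->
  level (sqm_pi d x) = j.
Proof.
move=> jn xj xj1; have xP := chain_sub xj.
apply/eqP; rewrite eqn_leq; apply/andP; split; first by rewrite leqNgt level_pi.
by rewrite level_pi// ltnW.
Qed.

Lemma mem_img_level j v : (j <= n.*2.+1)%N -> (v \in sqm_img d (chain j)) = (j <= level v)%N.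
Proof.
move=> jn; apply/sqm_imgP/idP => [[x xj ->]|]; first by rewrite level_pi//; exact: chain_sub xj.
by rewrite level_repr// => h; exists (sqm_repr v) => //; rewrite [RHS]sq_reprK.
Qed.

(** The module structure alone sees both kinds of terms: pi^i [P] is an image of multiplication by
    pi^i, and pi^(i+1) [P'] a kernel of multiplication by pi^(n-i). *)
Lemma img_chain_inv j (g : Sp V) : (j <= n.*2.+1)%N ->
  {in sqm_img d (chain j), forall v, g v \in sqm_img d (chain j)}.
Proof.
have [[i ->]|[i ->]] := parity j => jn.
  by apply: (@sqm_img_inv_im _ _ _ _ _ i) => x; rewrite chain_double.
apply: (@sqm_img_inv_ker _ _ _ _ _ _ (n - i)) => [|x xP].
  exact: chain_sub.
rewrite chain_doubleS QE in_oscale_shift; congr (x \in oscale _ _); lia.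
Qed.

Lemma level_sp (g : Sp V) v : level (g v) = level v.
Proof.
have h (h : Sp V) w : (level w <= level (h w))%N.
  have jn := level_le w.
  by rewrite -mem_img_level//; apply: img_chain_inv => //; rewrite mem_img_level.
apply/eqP; rewrite eqn_leq h andbT.
by have := h g^-1%g (g v); rewrite perm_invK.
Qed.

Lemma level_sub j v w : (j <= level v)%N -> (j <= level w)%N -> (j <= level (v - w)%R)%N.
Proof.
move=> jv jw; have jn := leq_trans jv (level_le v).
move: jv jw; rewrite -!mem_img_level// => /sqm_imgP[x xj ->] /sqm_imgP[y yj ->].
apply/sqm_imgP; exists (x - y); first by rewrite rpredB.
have xP := chain_sub xj; have yP := chain_sub yj.
have yE : sqm_pi d (- y) = - sqm_pi d y.
  apply/eqP; rewrite -addr_eq0 -sqm_piD ?rpredN// addNr; apply/eqP; exact: sq_pi0.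
by rewrite sqm_piD ?rpredN// yE.
Qed.

(** * Transvections and transitivity on each level *)

Section Transvection.
Variables (s : k) (v : W).
Hypothesis sP : forall z, z \in P -> (s * ss_form z v) *: v \in P.
Hypothesis sQ : forall z, z \in Q -> (s * ss_form z v) *: v \in Q.

(** Only [a = 1] and [a = -1] occur: the sign lets the inverse share the lemmas. *)
Let tau (a : k) (z : W) := z + (a * s * ss_form z v) *: v.

Let tauP a z : (a == 1) || (a == -1) -> z \in P -> tau a z \in P.
Proof.
move=> /orP[]/eqP-> zP; rewrite /tau ?mulN1r ?mul1r ?mulNr ?scaleNr ?rpredB ?rpredD ?sP//.
Qed.

Let tau_sub a y z : tau a y - tau a z = (y - z) + (a * s * ss_form (y - z) v) *: v.
Proof.
rewrite /tau -[- z]scaleN1r wformDl wformZl mulN1r scaleN1r opprD addrACA -scalerBl.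
by rewrite -mulrBr.
Qed.

Let tau_pi a y z : (a == 1) || (a == -1) -> y \in P -> z \in P ->
  y - z \in Q -> sqm_pi d (tau a y) = sqm_pi d (tau a z).
Proof.
move=> ha yP zP yz; apply: sq_eqP; rewrite ?tauP// tau_sub rpredD//.
by case/orP: ha => /eqP->; rewrite ?mulN1r ?mul1r ?mulNr ?scaleNr ?rpredN sQ.
Qed.

Let tauK a z : tau (- a) (tau a z) = z.
Proof.
rewrite /tau wformDl wformZl ss_alt mulr0 addr0 !mulNr scaleNr.
by rewrite -addrA subrr addr0.
Qed.

Let tV (a : k) (w : V) : V := sqm_pi d (tau a (sqm_repr w)).

Let tV_pi a z : (a == 1) || (a == -1) -> z \in P -> tV a (sqm_pi d z) = sqm_pi d (tau a z).
Proof. by move=> ha zP; apply: tau_pi => //; [exact: sq_reprP|exact: sq_repr_pi]. Qed.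

Let tV_inj : injective (tV 1).
Proof.
apply: (@can_inj _ _ _ (tV (-1))); elim/sqm_ind => z zP.
by rewrite !tV_pi ?eqxx ?orbT// ?tauP ?eqxx// tauK.
Qed.

Let tV_sp : is_sp (perm tV_inj : {perm V}).
Proof.
apply/is_spP; split.
- move=> a; elim/On_ind: a => a ha; elim/sqm_ind => x xP; elim/sqm_ind => y yP.
  rewrite !permE [_ *: sqm_pi d x]sqm_scale_pi// -sqm_piD ?os_Z// !tV_pi ?eqxx ?rpredD ?os_Z//.
  rewrite [_ *: sqm_pi d (tau _ _)]sqm_scale_pi ?tauP ?eqxx// -sqm_piD ?tauP ?eqxx//; last first.
    by apply: os_Z => //; rewrite tauP ?eqxx.
  congr (sqm_pi d _); rewrite /tau wformDl wformZl scalerDr scalerA addrACA; congr (_ + _).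
  by rewrite -scalerDl; congr (_ *: _); ring.
- elim/sqm_ind => x xP; elim/sqm_ind => y yP.
  rewrite !permE !tV_pi ?eqxx// [LHS]sqm_form_pi ?tauP ?eqxx// [RHS]sqm_form_pi//.
  congr (redn n (c * _)); rewrite /tau !wformDl !wformDr !wformZl !wformZr ss_alt.
  by rewrite [ss_form v y]wformC; ring.
Qed.

Lemma transvection : exists g : Sp V, forall z, z \in P ->
  g (sqm_pi d z) = sqm_pi d (z + (s * ss_form z v) *: v).
Proof.
exists (MkSp tV_sp) => z zP.
by rewrite permE [LHS]tV_pi ?eqxx// /tau mul1r.
Qed.
End Transvection.

Lemma pairing_in (t : bool) z v : z \in P -> v \in chain t -> c * ss_form z v \in ppow k t.
Proof.
case: t => zP.
  rewrite [chain _]chain1 => /mem_scale_dual/(_ _ zP).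
  by rewrite [ss_form z v]wformC mulrN => /ppowN.
by rewrite chain0 => vP; exact: sqd_int.
Qed.

Lemma pairing_Q (t : bool) z v : z \in Q -> v \in chain t -> c * ss_form z v \in ppow k n.+1.
Proof.
move=> zQ vt; rewrite wformC mulrN; apply: ppowN.
by apply: sqd_rad => //; exact: chain_sub vt.
Qed.

Lemma chain_scale_dual (t : bool) v : v \in chain t -> v \in oscale t P'.
Proof.
case: t; first by rewrite [chain _]chain1.
by rewrite chain0 in_oscale oppr0 expr0z scale1r; exact: sub2.
Qed.

(** Since [x] pairs with [y - x] as with [y], the transvection along [y - x] with coefficient
    [c / e] adds exactly [y - x] to [x]. It preserves [P] because [e] has the least valuation, [t],
    that pairings with [chain t] allow. *)
Lemma unit_orbit (t : bool) x y : x \in chain t -> y \in chain t ->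
  c * ss_form x y \notin ppow k (t%:Z + 1) ->
  exists g : Sp V, g (sqm_pi d x) = sqm_pi d y.
Proof.
move=> xt yt; set e := c * ss_form x y => he.
have e0 : e != 0 by apply: contraNneq he => ->; exact: ppow0.
have einv := ppow_inv e0 he.
pose v := y - x; have vt : v \in chain t by rewrite rpredB.
have fxv : c * ss_form x v = e.
  by rewrite /v -scaleN1r wformDr wformZr ss_alt mulr0 addr0.
have [||g hg] := @transvection (c / e) v.
- move=> z zP; rewrite mulrAC; apply: os_Z (chain_sub vt).
  by have := ppowM (pairing_in zP vt) einv; rewrite subrr.
(* Dividing by [e] loses [t] powers of the uniformizer, and [v] lying in pi^t [P'] restores them. *)
- move=> z zQ; rewrite mulrAC QE in_oscale scalerA.
  have [b bP vE] := oscaleP (chain_scale_dual vt).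
  rewrite {2}vE scalerA; apply: os_Z => //; rewrite -mulrA ppow_shift sub0r opprK mulrC ppow_shift.
  by have := ppowM (pairing_Q zQ vt) einv; rewrite vE.
exists g; rewrite hg; last exact: chain_sub xt.
by rewrite mulrAC fxv divff// scale1r addrC subrK.
Qed.

(** The duality of [P] and [P'] read contrapositively; for [t = 1] the witness in [P'] is multiplied
    by the uniformizer to enter the chain. *)
Lemma exists_unit (t : bool) x : x \in chain t -> x \notin chain t.+1 ->
  exists2 z, z \in chain t & c * ss_form x z \notin ppow k (t%:Z + 1).
Proof.
case: t => xt xt1; apply: contrapT => h; case/negP: xt1.
  rewrite [chain _]chain2; apply/mem_scale => b bP'.
  apply: contraT => hb; exfalso; apply: h; exists (pi ^ 1%:Z *: b).
    by rewrite [chain _]chain1 mem_oscale.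
  by rewrite wformZr mulrCA ppow_shift.
rewrite [chain _]chain1; apply/mem_scale_dual => b bP.
by apply: contraT => hb; exfalso; apply: h; exists b; rewrite ?chain0.
Qed.

Lemma stratum_orbit (t : bool) x y : x \in chain t -> x \notin chain t.+1 ->
  y \in chain t -> y \notin chain t.+1 ->
  exists g : Sp V, g (sqm_pi d x) = sqm_pi d y.
Proof.
move=> xt xt1 yt yt1.
(* As [x] and [y] may pair badly with each other, the path goes through a [z] that pairs well with
   both. If neither partner found below serves both, their sum does. *)
suff [z zt [hx hy]] : exists2 z, z \in chain t &
    c * ss_form x z \notin ppow k (t%:Z + 1) /\ c * ss_form y z \notin ppow k (t%:Z + 1).
  have [g hg] := unit_orbit xt zt hx.
  have [|h hh] := unit_orbit zt yt.
    by rewrite wformC mulrN; apply: contra hy => /ppowN; rewrite opprK.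
  by exists (h * g)%g; rewrite sp_mulE hg.
have [z1 z1t h1] := exists_unit xt xt1; have [z2 z2t h2] := exists_unit yt yt1.
have [h3|h3] := boolP (c * ss_form y z1 \in ppow k (t%:Z + 1)); last by exists z1.
have [h4|h4] := boolP (c * ss_form x z2 \in ppow k (t%:Z + 1)); last by exists z2.
exists (z1 + z2); first by rewrite rpredD.
rewrite !wformDr !mulrDr; split.
  by apply: contra h1 => h; have := ppowB h h4; rewrite addrK.
by apply: contra h2 => h; have := ppowB h h3; rewrite addrC addKr.
Qed.

Lemma chain_shift i j x : (pi ^ i%:Z *: x \in chain (i.*2 + j)) = (x \in chain j).
Proof.
have [[m ->]|[m ->]] := parity j.
  rewrite -doubleD !chain_double in_oscale_shift; congr (x \in oscale _ _); lia.
rewrite addnS -doubleD !chain_doubleS in_oscale_shift; congr (x \in oscale _ _); lia.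
Qed.

Lemma level_trans v w : level v = level w -> exists g : Sp V, g v = w.
Proof.
move=> vw; have jn := level_le v; set j := level v in vw jn.
elim/sqm_ind: v @j vw jn => x xP j; elim/sqm_ind: w => y yP vw jn.
have xj : x \in chain j by rewrite -level_pi// leqnn.
have yj : y \in chain j by rewrite -level_pi// vw leqnn.
have [jl|jl] := ltnP j n.*2.+1; last first.
  have je : j = n.*2.+1 by apply/eqP; rewrite eqn_leq jn jl.
  exists 1%g; rewrite sp_1E; apply: sq_eqP => //.
  by rewrite -chain_top -je rpredB.
have xj1 : x \notin chain j.+1 by rewrite -level_pi// -ltnNge.
have yj1 : y \notin chain j.+1 by rewrite -level_pi// -ltnNge vw.
(* Dividing by pi^i brings the level down to 0 or 1; linearity of the symplectic map brings it
   back. *)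
pose i := j./2; pose t := odd j; have jE : j = (i.*2 + t)%N by rewrite addnC odd_double_half.
pose x0 := pi ^ (- i%:Z) *: x; pose y0 := pi ^ (- i%:Z) *: y.
have xE : x = pi ^ i%:Z *: x0 by rewrite unifXK.
have yE : y = pi ^ i%:Z *: y0 by rewrite unifXK.
move: xj yj xj1 yj1; rewrite xE yE jE -addnS !chain_shift => x0t y0t x0t1 y0t1.
have [g hg] := stratum_orbit x0t x0t1 y0t y0t1; exists g.
by rewrite !sqm_pi_unif ?(chain_sub x0t) ?(chain_sub y0t)// sp_scale hg.
Qed.

Lemma form_pi_eq0 x y : x \in P -> y \in P ->
  (am_form (sqm_pi d x : V) (sqm_pi d y) == 0) = (c * ss_form x y \in ppow k n.+1).
Proof.
move=> xP yP; rewrite [am_form _ _]sqm_form_pi// -(redn0 k n) redn_eqE ?ppow0 ?subr0//.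
exact: sqd_int.
Qed.

Lemma orthogonal_level j v : (j <= n.*2.+1)%N ->
  (forall w : V, (j <= level w)%N -> am_form v w = 0) <-> (n.*2.+1 - j <= level v)%N.
Proof.
move=> jn; elim/sqm_ind: v => x xP; rewrite level_pi ?leq_subr//.
have -> : is_true (x \in chain (n.*2.+1 - j)) =
    (forall y, y \in chain j -> c * ss_form x y \in ppow k n.+1).
  by apply/propext; apply: iff_sym; exact: chain_dual.
split=> h.
  move=> y yj; have yP := chain_sub yj; rewrite -form_pi_eq0//; apply/eqP/h.
  by rewrite level_pi.
elim/sqm_ind => y yP; rewrite level_pi// => /h; rewrite -form_pi_eq0// => /eqP.
by [].
Qed.

Lemma sqm_nondeg (x : V) : (forall y, am_form y x = 0) -> x = 0.
Proof.
move=> h; have : (n.*2.+1 - 0 <= level x)%N.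
  by apply/orthogonal_level => // w _; rewrite formC h oppr0.
rewrite subn0; elim/sqm_ind: x {h} => x xP; rewrite level_pi// chain_top => xQ.
by rewrite -(sq_pi0 (os_pred P) (os_pred Q)); apply: sq_eqP; rewrite ?rpred0 ?subr0.
Qed.

Variable U : invIso V.
Hypothesis UE : forall v, (v \in ii_set U) = (v \in sqm_img d (chain n.+1)).

Let nn : (n.+1 <= n.*2.+1)%N. Proof. by rewrite ltnS -addnn leq_addr. Qed.

Lemma ii_level v : (v \in ii_set U) = (n < level v)%N.
Proof. by rewrite UE mem_img_level. Qed.

Lemma perp_level v : (v \in perp U) = (n <= level v)%N.
Proof.
have nE : (n.*2.+1 - n.+1 = n)%N by lia.
apply/perpP/idP => [h|h w].
  by have := (@orthogonal_level n.+1 v nn).1; rewrite nE; apply => w; rewrite -ii_level; exact: h.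
by rewrite ii_level; have := (@orthogonal_level n.+1 v nn).2; rewrite nE; apply.
Qed.

Lemma perp_perp x : x \in perp U -> {in perp U, forall y, am_form y x = 0} ->
  x \in ii_set U.
Proof.
move=> _ h; rewrite ii_level; have nE : (n.*2.+1 - n = n.+1)%N by lia.
have := (@orthogonal_level n x (ltnW nn)).1; rewrite nE; apply => w.
by rewrite -perp_level => wP; rewrite formC h ?oppr0.
Qed.

Hypothesis proper : ~ {subset P <= oscale 1 P'}.

Lemma lattice_levels : level_structure U n level.
Proof.
split; [exact: level_le|exact: level_sp|exact: level_trans|exact: perp_level|
  exact: ii_level|exact: level_sub|].
move=> j; have [[i ->]|[i ->]] := parity j; last by rewrite /= odd_double.
move=> _ jn.
have [b bP bP'] : exists2 b, b \in P & b \notin oscale 1 P'.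
  by apply: contrapT => h; apply: proper => b bP; apply: contraT => h'; exfalso; apply: h; exists b.
exists (sqm_pi d (pi ^ i%:Z *: b)); apply: level_pi_eq => //.
  by rewrite -[i.*2]addn0 chain_shift chain0.
by rewrite -addn1 chain_shift [chain _]chain1.
Qed.

Lemma lattice_full : ~ {subset P' <= P} -> full_levels n level.
Proof.
move=> proper' j; have [[i ->]|[i ->]] := parity j; first by rewrite odd_double.
move=> _ jn.
have [b bP bP'] : exists2 b, b \in P' & b \notin P.
  by apply: contrapT => h; apply: proper' => b bP; apply: contraT => h'; exfalso; apply: h; exists b.
exists (sqm_pi d (pi ^ i.+1%:Z *: b)); apply: level_pi_eq; first by rewrite ltnS.
  by rewrite chain_doubleS mem_oscale.
by rewrite -doubleS chain_double in_oscale unifXD addNr expr0z scale1r.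
Qed.

(** When [P'] lies in [P], the terms 2i+1 and 2i+2 of the chain coincide. *)
Lemma lattice_half : {subset P' <= P} -> half_levels n level.
Proof.
move=> sub v ov; apply/eqP; rewrite eqn_leq level_le /= leqNgt; apply/negP => vl.
suff : (level v < level v)%N by rewrite ltnn.
have [[i vE]|[i vE]] := parity (level v); first by rewrite vE odd_double in ov.
have : (level v <= level v)%N by [].
rewrite {1}vE level_repr -?vE ?(ltnW vl)//.
rewrite {2}vE level_repr -?vE// vE chain_doubleS -doubleS chain_double.
by rewrite !in_oscale; exact: sub.
Qed.

End LatticePair.

(** * The theorem *)

(** Outside residue characteristic 2 the element 2 has valuation 0, so its inverse in [k] is
    integral and can be reduced. *)
Lemma On_two_unit (k : localField) (n : nat) :
  2%N \notin [pchar (On k 0)] -> (2%:R : On k n) \is a GRing.unit.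
Proof.
have twoE m : (2%:R : On k m) = redn m (2%:R : k).
  by rewrite [RHS](rednD _ (ppow1 k) (ppow1 k)) redn1.
have two0 : (2%:R : k) \in ppow k 0 by apply: ppowD; exact: ppow1.
move=> pchar2; have two1 : (2%:R : k) \notin ppow k 1.
  apply: contra pchar2 => h; apply/andP; split=> //=; apply/eqP.
  by rewrite twoE; exact: redn_eq0.
have twon : (2%:R : k) != 0 by apply: contraNneq two1 => ->; exact: ppow0.
have inv0 : (2%:R : k)^-1 \in ppow k 0.
  by have := @ppow_inv k 2%:R 0 twon; rewrite add0r oppr0; apply.
rewrite twoE; apply/unitrPr; exists (redn n (2%:R : k)^-1).
by rewrite -rednM// divff// redn1.
Qed.

(** * Duality for the two pairs of lattices *)

Section Duality.
Variables (k : localField) (W : sympSpace k) (lam : int) (B : goodLattice W lam).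
Local Notation pi := (lf_unif k).
Local Notation Bd := (dual lam B).

Lemma bn_dual x : (forall b, b \in B -> pi ^ (- lam) * ss_form x b \in ppow k 0) <-> x \in Bd.
Proof.
by split=> [h|/dualP h]; [apply/dualP|] => b bB; have := h b bB;
   rewrite ppow_shift sub0r opprK.
Qed.

Lemma bn_bidual x : (forall b, b \in Bd -> pi ^ (- lam) * ss_form x b \in ppow k 0) <-> x \in B.
Proof.
split=> [h|xB b /dualP bB].
  by apply: (lattice_bidual (lam := lam)) => y yB; have := h y yB; rewrite ppow_shift sub0r opprK.
by rewrite ppow_shift sub0r opprK wformC ppowN// bB.
Qed.

(** The extra uniformizer in the form on b*_n is what makes pi^(-1) [B], rather than [B], the dual
    of [Bd]. *)
Lemma bs_dual x : (forall b, b \in Bd -> pi ^ (1 - lam) * ss_form x b \in ppow k 0) <->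
  x \in oscale (-1) B.
Proof.
rewrite in_oscale opprK -bn_bidual.
by split=> h b bB; have := h b bB; rewrite wformZl mulrA -expfzDr ?lf_unif_neq0// [- lam + 1]addrC.
Qed.

Lemma bs_bidual x : (forall b, b \in oscale (-1) B -> pi ^ (1 - lam) * ss_form x b \in ppow k 0) <->
  x \in Bd.
Proof.
rewrite -bn_dual; split=> h b bB.
  have := h _ (mem_oscale (-1) bB); rewrite wformZr mulrA -expfzDr ?lf_unif_neq0//.
  by rewrite addrAC subrr add0r.
have [b' b'B ->] := oscaleP bB; rewrite wformZr mulrA -expfzDr ?lf_unif_neq0//.
by rewrite addrAC subrr add0r h.
Qed.
End Duality.

Theorem lattice_weil_decomposition (R : realType) (k : localField) (W : sympSpace k)
    (n : nat) (d : sqData W n) (P' : osub W) (U : invIso (sqm d)) (psi : On k n -> R[i]) :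
  primitive_char psi -> (2%:R : On k n) \is a GRing.unit ->
  sqd_Q d =i oscale n.+1 P' ->
  (forall x, (forall b, b \in sqd_P d -> sqd_c d * ss_form x b \in ppow k 0) <-> x \in P') ->
  (forall x, (forall b, b \in P' -> sqd_c d * ss_form x b \in ppow k 0) <-> x \in sqd_P d) ->
  {subset oscale 1 P' <= sqd_P d} -> {subset sqd_P d <= P'} ->
  (forall v, (v \in ii_set U) = (v \in sqm_img d (chain d P' n.+1))) ->
  ~ {subset sqd_P d <= oscale 1 P'} ->
  forall S : weilRep R[i] (sqm d) (Sp (sqm d)), is_weil psi id S ->
  exists sigma : weilRep R[i] (ubar U) (Sp (sqm d)),
  [/\ is_weil psi (rU U) sigma,
      weil_iso S (weil_model psi sigma),
      forall sigma' : weilRep R[i] (ubar U) (Sp (sqm d)), is_weil psi (rU U) sigma' ->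
        weil_iso S (weil_model psi sigma') -> weil_iso sigma sigma'
    & forall X : {set sqm d}, orbit_reps U X ->
      let D := summand_index U X in
      [/\ {in D, forall i, irreducible (summand sigma i)},
          {in D &, forall i j, i != j ->
             ~ repn_iso (summand sigma i) (summand sigma j)},
          ~ {subset P' <= sqd_P d} -> #|D| = (2 * n + 2)%N,
          {subset P' <= sqd_P d} -> #|D| = (n + 2)%N
        & {subset P' <= sqd_P d} -> odd n -> {in D, forall i, monomial (summand sigma i)}]].
Proof.
move=> psi_prim two QE hP hP' sub1 sub2 UE prop S hS.
have lv := lattice_levels QE hP hP' sub1 sub2 UE prop.
have full := lattice_full QE sub1 sub2; have half := lattice_half sub1 sub2.
have [|sigma [h1 h2 h3 h4]] := weil_decomposition psi_prim two
  (sqm_nondeg QE hP hP' sub1 sub2) (perp_perp QE hP hP' sub1 sub2 UE) lv _ hS.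
  by have [h|h] := pselect {subset P' <= sqd_P d}; [right; exact: half|left; exact: full].
exists sigma; split=> // X hX D; have [k1 k2 k3 k4 k5] := h4 X hX.
by split=> // [/full/k3|/half/k4|/half/k5].
Qed.

Lemma bn_img (k : localField) (W : sympSpace k) (lam : int) (B : goodLattice W lam) n v :
  (v \in ii_set (u_n B n)) = (v \in sqm_img (bn_data B n) (chain (bn_data B n) (dual lam B) n.+1)).
Proof.
congr (v \in sqm_img _ _); rewrite /u_osub /chain /= uphalf_half.
by case: (odd n).
Qed.

Lemma bs_img (k : localField) (W : sympSpace k) (lam : int) (B : goodLattice W lam) n v :
  (v \in ii_set (us_n B n)) = (v \in sqm_img (bs_data B n) (chain (bs_data B n) (oscale (-1) B) n.+1)).
Proof.
have E x : (x \in us_osub B n) = (x \in chain (bs_data B n) (oscale (-1) B) n.+1).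
  rewrite /us_osub /chain /= uphalf_half; case: (odd n) => //=.
  rewrite in_oscale [RHS]in_oscale [RHS]in_oscale unifXD.
  by congr (lf_unif k ^ _ *: x \in B); lia.
by apply/sqm_imgP/sqm_imgP => -[x xT ->]; exists x; rewrite // -?E // E.
Qed.

Theorem mainTheorem1 (R : realType) (k : localField)
    (residue_char : 2%N \notin [pchar (On k 0)])
    (lam : int) (r : nat) (W : sympSpace k) (dimW : \dim {:W}%VS = (2 * r)%N)
    (B : goodLattice W lam) (n : nat)
    (psi : On k n -> R[i]) (psi_primitive : primitive_char psi) :
  (osub_proper (oscale 1 (dual lam B)) B ->
   forall S : weilRep R[i] (bn B n) (Sp (bn B n)),
   is_weil psi id S ->
   exists sigma : weilRep R[i] (ubar (u_n B n)) (Sp (bn B n)),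
   [/\ is_weil psi (rU (u_n B n)) sigma,
       weil_iso S (weil_model psi sigma),
       forall sigma' : weilRep R[i] (ubar (u_n B n)) (Sp (bn B n)),
         is_weil psi (rU (u_n B n)) sigma' ->
         weil_iso S (weil_model psi sigma') -> weil_iso sigma sigma'
     & forall X : {set bn B n}, orbit_reps (u_n B n) X ->
       let D := summand_index (u_n B n) X in
       [/\ {in D, forall i, irreducible (summand sigma i)},
           {in D &, forall i j, i != j ->
              ~ repn_iso (summand sigma i) (summand sigma j)},
           osub_proper B (dual lam B) -> #|D| = (2 * n + 2)%N,
           B =i dual lam B -> #|D| = (n + 2)%N
         & B =i dual lam B -> odd n ->
             {in D, forall i, monomial (summand sigma i)}]]) /\
  (osub_proper B (dual lam B) ->
   forall S : weilRep R[i] (bs B n) (Sp (bs B n)),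
   is_weil psi id S ->
   exists sigma : weilRep R[i] (ubar (us_n B n)) (Sp (bs B n)),
   [/\ is_weil psi (rU (us_n B n)) sigma,
       weil_iso S (weil_model psi sigma),
       forall sigma' : weilRep R[i] (ubar (us_n B n)) (Sp (bs B n)),
         is_weil psi (rU (us_n B n)) sigma' ->
         weil_iso S (weil_model psi sigma') -> weil_iso sigma sigma'
     & forall X : {set bs B n}, orbit_reps (us_n B n) X ->
       let D := summand_index (us_n B n) X in
       [/\ {in D, forall i, irreducible (summand sigma i)},
           {in D &, forall i j, i != j ->
              ~ repn_iso (summand sigma i) (summand sigma j)},
           osub_proper (oscale 1 (dual lam B)) B -> #|D| = (2 * n + 2)%N,
           oscale 1 (dual lam B) =i B -> #|D| = (n + 2)%N
         & oscale 1 (dual lam B) =i B -> odd n ->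
             {in D, forall i, monomial (summand sigma i)}]]).
Proof.
have two := On_two_unit n residue_char.
split=> [[_ prop] S hS|[_ prop] S hS].
  have QE : sqd_Q (bn_data B n) =i oscale n.+1 (dual lam B) by [].
  have [sigma [h1 h2 h3 h4]] := lattice_weil_decomposition psi_primitive two
    QE (bn_dual B) (bn_bidual B) (@gl_sub1 _ _ _ B) (@gl_sub2 _ _ _ B)
    (@bn_img _ _ _ B n) prop hS.
  exists sigma; split=> // X hX D; have [k1 k2 k3 k4 k5] := h4 X hX.
  split=> //.
  - by move=> [_ h]; exact: k3.
  - by move=> h; apply: k4 => x; rewrite -h.
  - by move=> h; apply: k5 => x; rewrite -h.
(* With [dual lam B] and pi^(-1) [B] as the pair, the two inclusions of a good lattice change
   places: [gl_sub2] provides [s1] and [gl_sub1] provides [s2]. *)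
have shift (i : int) x : (x \in oscale i (oscale (-1) B)) = (x \in oscale (i - 1) B).
  rewrite in_oscale [LHS]in_oscale [RHS]in_oscale unifXD.
  by congr (lf_unif k ^ _ *: x \in B); ring.
have QE : sqd_Q (bs_data B n) =i oscale n.+1 (oscale (-1) B).
  by move=> x; rewrite shift; congr (x \in oscale _ B); lia.
have s1 : {subset oscale 1 (oscale (-1) B) <= sqd_P (bs_data B n)}.
  by move=> x; rewrite shift subrr oscale0; exact: gl_sub2.
have dE x : (x \in dual lam B) = (lf_unif k ^ 1 *: x \in oscale 1 (dual lam B)).
  by rewrite in_oscale_shift subrr oscale0.
have oE x : (x \in oscale (-1) B) = (lf_unif k ^ 1 *: x \in B) by rewrite in_oscale opprK.
have s2 : {subset sqd_P (bs_data B n) <= oscale (-1) B}.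
  by move=> x xB; rewrite oE; apply: gl_sub1; rewrite -dE.
have prop' : ~ {subset sqd_P (bs_data B n) <= oscale 1 (oscale (-1) B)}.
  by move=> h; apply: prop => x /h; rewrite shift subrr oscale0.
have [sigma [h1 h2 h3 h4]] := lattice_weil_decomposition psi_primitive two
  QE (bs_dual B) (bs_bidual B) s1 s2 (@bs_img _ _ _ B n) prop' hS.
exists sigma; split=> // X hX D; have [k1 k2 k3 k4 k5] := h4 X hX.
split=> //.
- move=> [_ h]; apply: k3 => h'; apply: h => x xB.
  by rewrite in_oscale; apply: h'; rewrite oE unifXK.
- by move=> h; apply: k4 => x; rewrite oE -h -dE.
- by move=> h; apply: k5 => x; rewrite oE -h -dE.
Qed.
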